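(* Suppose $|v_{ij}(x)|\lesssim\langle x\rangle^{-1-\epsilon}$ for some $\epsilon>0$ and all $i,j$. If $\phi\in S_1(L^2\times L^2)=\mathrm{Ker}(QTQ)$ (kernel in $Q(L^2\times L^2)$), then $\phi=Uv\psi$, where $$\psi=c_0(1,0)^T-\mathcal G_0v^*\phi,\qquad c_0=\frac{\langle (a,c)^T,T\phi\rangle}{\|(a,c)^T\|_2^2}.$$ Moreover, $\psi\in L^\infty\times L^\infty(\mathbb R^2)$, and $\psi$ is a distributional solution of $(H-mI)\psi=0$.
   Context: Let $m>0$ and let $V:\mathbb R^2\to\mathbb C^{2\times2}$ be self-adjoint-matrix valued; $H=D_m+V$ with $D_m=-i\alpha\cdot\nabla+m\beta=-i\alpha_1\partial_1-i\alpha_2\partial_2+m\beta$ on $\mathbb C^2$-valued functions on $\mathbb R^2$, $\beta=\begin{pmatrix}1&0\\0&-1\end{pmatrix}$, $\alpha_1=\begin{pmatrix}0&1\\1&0\end{pmatrix}$, $\alpha_2=\begin{pmatrix}0&-i\\i&0\end{pmatrix}$; $\langle x\rangle=(1+|x|^2)^{1/2}$. Write $V=B^*\,\mathrm{diag}(\lambda_1,\lambda_2)\,B$ pointwise with $B(x)$ unitary and $\lambda_j(x)$ real, $\eta_j=|\lambda_j|^{1/2}$, $U=\mathrm{diag}(\mathrm{sign}\lambda_1,\mathrm{sign}\lambda_2)$ (convention $\mathrm{sign}(0)=1$), $v=\mathrm{diag}(\eta_1,\eta_2)B=\begin{pmatrix}a&b\\c&d\end{pmatrix}$, so $V=v^*Uv$.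 Assume $(a,c)^T$ is not identically zero. Let $I_1=\mathrm{diag}(1,0)$, $G_0f(x)=-\frac1{2\pi}\int_{\mathbb R^2}\log|x-y|f(y)\,dy$, $\mathcal G_0=-i\alpha\cdot\nabla G_0+2mG_0I_1$, $T=U+v\mathcal G_0v^*$; $P$ is the orthogonal projection in $L^2\times L^2$ onto the span of $(a,c)^T$, $Q=1-P$. $S_1$ is the (orthogonal) Riesz projection onto the kernel of $QTQ$ as an operator on $Q(L^2\times L^2)$. In the formula for $c_0$ the inner product is linear in the second slot, i.e. $\langle(a,c)^T,T\phi\rangle=\int_{\mathbb R^2}\big(\overline a\,(T\phi)_1+\overline c\,(T\phi)_2\big)dx$, so that $PT\phi=c_0(a,c)^T$. *)

(* Defs.v *)
From HB Require Import structures.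
From mathcomp Require Import all_boot all_order all_algebra.
From mathcomp Require Import all_classical all_reals all_analysis.
From mathcomp Require Import complex.

Set Implicit Arguments.
Unset Strict Implicit.
Unset Printing Implicit Defensive.

Import Order.TTheory GRing.Theory Num.Theory.
Import numFieldNormedType.Exports.

Local Open Scope classical_set_scope.
Local Open Scope ring_scope.
Local Open Scope complex_scope.
Local Open Scope sesquilinear_scope.

Section Plane.
Variable R : realType.
Local Notation C := R[i].
Local Notation R2 := (R * R)%type.

(* The copy of [R * R] whose Borel sigma-algebra is the one [leb2] lives on. *)
Definition plane := (measurableTypeR R * measurableTypeR R)%type.

Definition leb2 := (@lebesgue_measure R \x @lebesgue_measure R)%E.

(* The Euclidean norm; the norm of [R * R] in the library is the maximum norm. *)
Definition enorm (x : R2) : R := Num.sqrt (x.1 ^+ 2 + x.2 ^+ 2).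

Definition jbracket (x : R2) : R := Num.sqrt (1 + enorm x ^+ 2).

(* The library has no sigma-algebra or integral on [R[i]]: measurability and
   integration go through real and imaginary parts. *)
Definition cmeasurable (f : R2 -> C) : Prop :=
  measurable_fun [set: plane] (fun x => complex.Re (f x)) /\
  measurable_fun [set: plane] (fun x => complex.Im (f x)).

Definition cint (f : R2 -> C) : C :=
  (\int[leb2]_x complex.Re (f x))%R +i* (\int[leb2]_x complex.Im (f x))%R.

Definition cLp (p : \bar R) (f : R2 -> C) : Prop :=
  cmeasurable f /\
  (Lnorm leb2 p (fun x => (ComplexField.Normc.normc (f x))%:E) < +oo)%E.

Definition cloc_integrable (f : R2 -> C) : Prop :=
  forall K : set R2, compact K ->
    leb2.-integrable K (fun x => (complex.Re (f x))%:E) /\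
    leb2.-integrable K (fun x => (complex.Im (f x))%:E).

Definition evec (k : 'I_2) : R2 := if k == 0 then (1, 0) else (0, 1).

Definition dpartial (k : 'I_2) (f : R2 -> R) : R2 -> R :=
  fun x => 'D_(evec k) f x.

Fixpoint Ck (n : nat) (f : R2 -> R) : Prop :=
  continuous f /\
  if n is n'.+1 then
    forall k, (forall x, derivable f x (evec k)) /\ Ck n' (dpartial k f)
  else True.

(* C^infinity with compact support. Real values suffice: by linearity they
   determine a complex-valued distribution. *)
Definition test_function (chi : R2 -> R) : Prop :=
  (forall n, Ck n chi) /\ compact (closure [set x | chi x != 0]).

Definition is_weak_partial (k : 'I_2) (u w : R2 -> C) : Prop :=
  [/\ cloc_integrable u, cloc_integrable w &
    forall chi, test_function chi ->
      cint (fun x => u x * (dpartial k chi x)%:C) =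
      - cint (fun x => w x * (chi x)%:C)].

(* A representative, chosen among almost everywhere equal functions; the value
   is the zero function if [u] has no weak derivative. *)
Definition weak_partial (k : 'I_2) (u : R2 -> C) : R2 -> C :=
  xget (fun=> 0) [set w | is_weak_partial k u w].

Local Notation field := (R2 -> 'cV[C]_2).

Definition coordf (u : field) (j : 'I_2) : R2 -> C := fun x => u x j 0.

Definition vLp (p : \bar R) (u : field) : Prop := forall j, cLp p (coordf u j).

Definition vloc_integrable (u : field) : Prop :=
  forall j, cloc_integrable (coordf u j).

(* Inner product of L^2 x L^2, linear in the second argument. *)
Definition L2inner (f g : field) : C := cint (fun x => ((f x)^t* *m g x) 0 0).

Definition L2norm (f : field) : R :=
  Num.sqrt (\int[leb2]_x \sum_j ComplexField.Normc.normc (f x j 0) ^+ 2)%R.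

Definition mxapply (A : R2 -> 'M[C]_2) (u : field) : field := fun x => A x *m u x.

Definition mxadj (A : R2 -> 'M[C]_2) : R2 -> 'M[C]_2 := fun x => (A x)^t*.

Definition mx22 (a b c d : C) : 'M[C]_2 :=
  \matrix_(i, j) if i == 0 then (if j == 0 then a else b)
                 else (if j == 0 then c else d).

(* [dirac_alpha 0] and [dirac_alpha 1] are alpha_1 and alpha_2. *)
Definition dirac_alpha (k : 'I_2) : 'M[C]_2 :=
  if k == 0 then mx22 0 1 1 0 else mx22 0 (- 'i) 'i 0.

Definition dirac_beta : 'M[C]_2 := mx22 1 0 0 (- 1).

Definition I1 : 'M[C]_2 := mx22 1 0 0 0.

Definition e1 : 'cV[C]_2 := delta_mx 0 0.

(* Pairings of the distributions [u], [d_k u] and [(D_m + V) u] with a test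
   function. *)
Definition pairing (u : field) (chi : R2 -> R) : 'cV[C]_2 :=
  \col_j cint (fun x => coordf u j x * (chi x)%:C).

Definition pairing_partial (k : 'I_2) (u : field) (chi : R2 -> R) : 'cV[C]_2 :=
  - pairing u (dpartial k chi).

Definition pairing_H (m : R) (V : R2 -> 'M[C]_2) (u : field) (chi : R2 -> R)
    : 'cV[C]_2 :=
  - 'i *: (\sum_k dirac_alpha k *m pairing_partial k u chi)
  + m%:C *: (dirac_beta *m pairing u chi) + pairing (mxapply V u) chi.

(* [(H - m I) u = 0] in the sense of distributions, where [H = D_m + V]. *)
Definition threshold_solution (m : R) (V : R2 -> 'M[C]_2) (u : field) : Prop :=
  [/\ vloc_integrable u, vloc_integrable (mxapply V u) &
    forall chi, test_function chi ->
      pairing_H m V u chi - m%:C *: pairing u chi = 0].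

(* [ln 0 = 0] in the library; this only affects the null set [y = x]. *)
Definition G0s (f : R2 -> C) : R2 -> C := fun x =>
  - ((2 * pi)^-1)%:C *
    cint (fun y => (ln (enorm (x.1 - y.1, x.2 - y.2)))%:C * f y).

Definition G0 (u : field) : field := fun x => \col_j G0s (coordf u j) x.

Definition wgrad (k : 'I_2) (u : field) : field :=
  fun x => \col_j weak_partial k (coordf u j) x.

(* The gradient of [G0 f] is taken in the sense of distributions. *)
Definition calG0 (m : R) (f : field) : field := fun x =>
  - 'i *: (\sum_k dirac_alpha k *m wgrad k (G0 f) x)
  + (2 * m)%:C *: (G0 (mxapply (fun=> I1) f) x).

(* [Num.sg 0 = 0], whereas here the sign of 0 is 1. *)
Definition sgn1 (r : R) : R := if 0 <= r then 1 else - 1.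

Definition diagC (d : 'I_2 -> R) : 'M[C]_2 := diag_mx (\row_j (d j)%:C).

Definition Umx (lam : 'I_2 -> R2 -> R) : R2 -> 'M[C]_2 :=
  fun x => diagC (fun j => sgn1 (lam j x)).

Definition vmx (lam : 'I_2 -> R2 -> R) (B : R2 -> 'M[C]_2) : R2 -> 'M[C]_2 :=
  fun x => diagC (fun j => Num.sqrt `|lam j x|) *m B x.

Definition Top (m : R) (U v : R2 -> 'M[C]_2) (f : field) : field := fun x =>
  U x *m f x + v x *m calG0 m (mxapply (mxadj v) f) x.

(* Orthogonal projection onto the span of [w], assumed nonzero in L^2. *)
Definition Pop (w f : field) : field := fun x =>
  (L2inner w f / (L2norm w ^+ 2)%:C) *: w x.

Definition Qop (w f : field) : field := fun x => f x - Pop w f x.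

(* [phi] is a representative of an element of the kernel of [QTQ] acting on
   [Q(L^2 x L^2)], i.e. of the range of the projection [S_1]. *)
Definition in_ker_QTQ (m : R) (U v : R2 -> 'M[C]_2) (w phi : field) : Prop :=
  [/\ vLp 2%:E phi,
      exists2 g, vLp 2%:E g & {ae leb2, forall x, phi x = Qop w g x} &
      {ae leb2, forall x, Qop w (Top m U v (Qop w phi)) x = 0}].

End Plane.

Arguments leb2 R : clear implicits.
Arguments e1 R : clear implicits.

(* Main.v *)
Require Import Defs.
From HB Require Import structures.
From mathcomp Require Import all_boot all_order all_algebra.
From mathcomp Require Import all_classical all_reals all_analysis.
From mathcomp Require Import complex measurable_realfun ess_sup_inf ring lra.
Import Order.TTheory GRing.Theory Num.Theory.
Import numFieldNormedType.Exports.
Local Open Scope classical_set_scope.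
Local Open Scope ring_scope.

Set Implicit Arguments.
Unset Strict Implicit.
Unset Printing Implicit Defensive.

(** Write [f = v^* phi], so that [psi = c0 e1 - calG0 f].

    Since [phi] is in the range of the projection [Q], it is orthogonal to the first
    column [w] of [v], and the kernel equation says that [T phi] is a multiple of [w]. As
    [w = v e1] and [T = U + v calG0 v^*], this reads [U phi = v psi]; the matrix [U] is its
    own inverse, whence [phi = U v psi] ([phi_factor]). Since [V = v^* U v], it follows
    that [f = V psi] almost everywhere.

    The differential equation then says that [(D_m - m) calG0 f = f]. This rests on three
    facts about the logarithmic potential of [f]. Its weak gradient is the integral of [f]
    against the kernel [z / |z|^2] ([potential_gradient]), that gradient is curl free
    ([potential_curl]), and its divergence is a multiple of [f] ([potential_laplacian]).
    All three follow by Fubini's theorem from statements on the kernels, which are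
    obtained by integration by parts; the last two use the regularization
    [z / (|z|^2 + d)], whose divergence is an approximate identity with mass [2 * pi]
    ([rk_divergence]). The operator [calG0] is defined by an arbitrary choice of weak
    derivatives. Because test functions separate locally integrable functions
    ([test_functions_separate]), the choice agrees almost everywhere with the explicit
    kernel.

    Boundedness of [psi] has a global and a local side. Globally, the potential of a
    density grows like its total mass times [ln <x>]; the mass of the upper component of
    [f] is the inner product of [w] and [phi], which is zero, and the lower component
    enters [psi] only through its gradient ([lnk_potential_bounded]). Locally, [f] is only
    square integrable, so the kernel [1 / |z|] does not immediately give a bounded
    potential. But [f = V psi] with [V] bounded, so [|f|] is dominated by a constant plus
    the potential of [|f|] with the kernel [1 / |z|] cut off at [|z| = 1]. Inserting this
    estimate once yields a double potential, which Young's inequality bounds uniformly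
    ([riesz_bootstrap]). *)

(** * Real-valued integrals and Fubini's theorem *)

Section RealIntegral.
Context d (T : measurableType d) (R : realType) (mu : {measure set T -> \bar R}).
Implicit Types f g : T -> R.

Lemma integrable_dom f g : measurable_fun setT f ->
  (forall x, `|f x| <= g x) ->
  mu.-integrable setT (EFin \o g) -> mu.-integrable setT (EFin \o f).
Proof.
move=> mf fg; apply: le_integrable => //; first exact/measurable_EFinP.
by move=> x _ /=; rewrite lee_fin (le_trans (fg x))// ler_norm.
Qed.

Lemma ge0_integrable f : measurable_fun setT f -> (forall x, 0 <= f x) ->
  (\int[mu]_x (f x)%:E < +oo)%E -> mu.-integrable setT (EFin \o f).
Proof.
move=> mf f0 foo; apply/integrableP; split; first exact/measurable_EFinP.
by under eq_integral do rewrite /= ger0_norm//.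
Qed.

Lemma integrable_ltoo f : (forall x, 0 <= f x) ->
  mu.-integrable setT (EFin \o f) -> (\int[mu]_x (f x)%:E < +oo)%E.
Proof.
move=> f0 /integrableP[_]; congr (_ < _)%E.
by apply: eq_integral => x _ /=; rewrite ger0_norm.
Qed.

Lemma integrable_measurable f :
  mu.-integrable setT (EFin \o f) -> measurable_fun setT f.
Proof. by move/measurable_int/measurable_EFinP. Qed.

Lemma integrable_addr f g : mu.-integrable setT (EFin \o f) ->
  mu.-integrable setT (EFin \o g) ->
  mu.-integrable setT (EFin \o (fun x => f x + g x)).
Proof. exact: integrableD. Qed.

Lemma integrable_subr f g : mu.-integrable setT (EFin \o f) ->
  mu.-integrable setT (EFin \o g) ->
  mu.-integrable setT (EFin \o (fun x => f x - g x)).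
Proof. exact: integrableB. Qed.

Lemma integrable_scale (k : R) f : mu.-integrable setT (EFin \o f) ->
  mu.-integrable setT (EFin \o (fun x => k * f x)).
Proof. exact: integrableZl. Qed.

Lemma integrable_mulb f g (M : R) : mu.-integrable setT (EFin \o f) ->
  measurable_fun setT g -> (forall x, `|g x| <= M) ->
  mu.-integrable setT (EFin \o (fun x => f x * g x)).
Proof.
move=> intf mg gM; apply: (@integrable_dom _ (fun x => M * `|f x|)).
- by apply: measurable_funM => //; exact: integrable_measurable.
- by move=> x; rewrite normrM mulrC ler_wpM2r.
- by apply: integrable_scale; exact: integrable_norm.
Qed.

(** A product is dominated by the sum of the squares. *)
Lemma integrable_mul2 f g : measurable_fun setT f -> measurable_fun setT g ->
  mu.-integrable setT (EFin \o (fun x => f x ^+ 2)) ->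
  mu.-integrable setT (EFin \o (fun x => g x ^+ 2)) ->
  mu.-integrable setT (EFin \o (fun x => f x * g x)).
Proof.
move=> mf mg f2 g2; apply: (@integrable_dom _ (fun x => f x ^+ 2 + g x ^+ 2)).
- exact: measurable_funM.
- move=> x; rewrite normrM -(real_normK (num_real (f x))) -(real_normK (num_real (g x))).
  have := sqr_ge0 (`|f x| - `|g x|); have := sqr_ge0 (`|f x| + `|g x|); nra.
- exact: integrable_addr.
Qed.

Lemma ae_eq_Rintegral f g : measurable_fun setT f -> measurable_fun setT g ->
  {ae mu, forall x, f x = g x} ->
  \int[mu]_x f x = \int[mu]_x g x.
Proof.
move=> mf mg fg; rewrite /Rintegral; congr fine; apply: ae_eq_integral => //.
- exact/measurable_EFinP.
- exact/measurable_EFinP.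
by apply: filterS fg => x + _ => ->.
Qed.

Lemma ae_eq_integrable f g : measurable_fun setT g ->
  {ae mu, forall x, f x = g x} ->
  mu.-integrable setT (EFin \o f) -> mu.-integrable setT (EFin \o g).
Proof.
move=> mg fg intf; have mf := integrable_measurable intf.
move/integrableP : intf => [_ foo]; apply/integrableP; split.
  exact/measurable_EFinP.
rewrite (ae_eq_integral (fun x => `|(EFin \o f) x|)%E)//.
- by apply: measurableT_comp => //; exact/measurable_EFinP.
- by apply: measurableT_comp => //; exact/measurable_EFinP.
by apply: filterS fg => x + _ /= => ->.
Qed.

End RealIntegral.

Section RealFubini.
Context d1 d2 (T1 : measurableType d1) (T2 : measurableType d2) (R : realType).
Variables (m1 : {sigma_finite_measure set T1 -> \bar R})
          (m2 : {sigma_finite_measure set T2 -> \bar R}).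
Variable f : T1 * T2 -> R.

Lemma fubini_section1 : (m1 \x m2)%E.-integrable setT (EFin \o f) ->
  {ae m1, forall x, m2.-integrable setT (EFin \o (fun y => f (x, y)))}.
Proof. by move=> intf; exact: (ae_integrable1 intf). Qed.

Lemma fubini_section2 : (m1 \x m2)%E.-integrable setT (EFin \o f) ->
  {ae m2, forall y, m1.-integrable setT (EFin \o (fun x => f (x, y)))}.
Proof. by move=> intf; exact: (ae_integrable2 intf). Qed.

Lemma fubini_measurable1 : (m1 \x m2)%E.-integrable setT (EFin \o f) ->
  measurable_fun setT (fun x => \int[m2]_y f (x, y)).
Proof.
move=> intf; apply: measurableT_comp (measurable_fubini_F intf).
exact: fine_measurable.
Qed.

Lemma fubini_measurable2 : (m1 \x m2)%E.-integrable setT (EFin \o f) ->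
  measurable_fun setT (fun y => \int[m1]_x f (x, y)).
Proof.
move=> intf; apply: measurableT_comp (measurable_fubini_G intf).
exact: fine_measurable.
Qed.

Let F1 : (m1 \x m2)%E.-integrable setT (EFin \o f) ->
  {ae m1, forall x, fubini_F m2 (EFin \o f) x = (\int[m2]_y f (x, y))%:E}.
Proof.
move=> /fubini_section1; apply: filterS => x intfx.
by rewrite /Rintegral fineK//; exact: integrable_fin_num.
Qed.

Let F2 : (m1 \x m2)%E.-integrable setT (EFin \o f) ->
  {ae m2, forall y, fubini_G m1 (EFin \o f) y = (\int[m1]_x f (x, y))%:E}.
Proof.
move=> /fubini_section2; apply: filterS => x intfx.
by rewrite /Rintegral fineK//; exact: integrable_fin_num.
Qed.

Lemma fubini_integrable1 : (m1 \x m2)%E.-integrable setT (EFin \o f) ->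
  m1.-integrable setT (EFin \o (fun x => \int[m2]_y f (x, y))).
Proof.
move=> intf; have /integrableP[m foo] := integrable_fubini_F intf.
apply/integrableP; split; first exact/measurable_EFinP/fubini_measurable1.
rewrite (ae_eq_integral (fun x => `|fubini_F m2 (EFin \o f) x|)%E)//.
- by apply: measurableT_comp => //; exact/measurable_EFinP/fubini_measurable1.
- exact: measurableT_comp.
by apply: filterS (F1 intf) => x /= -> _.
Qed.

Lemma fubini_integrable2 : (m1 \x m2)%E.-integrable setT (EFin \o f) ->
  m2.-integrable setT (EFin \o (fun y => \int[m1]_x f (x, y))).
Proof.
move=> intf; have m := measurable_fubini_G intf.
have mf := measurable_int _ intf.
have foo : (\int[m2]_y `|fubini_G m1 (EFin \o f) y| < +oo)%E.
  apply: le_lt_trans ((integrable21ltyP m1 m2 mf).1 intf).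
  apply: ge0_le_integral => //.
  - exact: measurableT_comp.
  - by apply: (measurable_fun_fubini_tonelli_G (abse \o (EFin \o f))) => //=;
      exact: measurableT_comp.
  - move=> y _; apply: le_abse_integral => //.
    exact: (measurableT_comp mf (pair2_measurable _)).
apply/integrableP; split; first exact/measurable_EFinP/fubini_measurable2.
rewrite (ae_eq_integral (fun x => `|fubini_G m1 (EFin \o f) x|)%E)//.
- by apply: measurableT_comp => //; exact/measurable_EFinP/fubini_measurable2.
- exact: measurableT_comp.
by apply: filterS (F2 intf) => x /= -> _.
Qed.

Lemma fubini_prod1 : (m1 \x m2)%E.-integrable setT (EFin \o f) ->
  \int[(m1 \x m2)%E]_z f z = \int[m1]_x \int[m2]_y f (x, y).
Proof.
move=> intf; rewrite /Rintegral; congr fine.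
have -> := esym (integral12_prod_meas1 intf); apply: ae_eq_integral => //.
- exact: (measurable_fubini_F intf).
- exact/measurable_EFinP/fubini_measurable1.
by apply: filterS (F1 intf) => x /= -> _.
Qed.

Lemma fubini_prod2 : (m1 \x m2)%E.-integrable setT (EFin \o f) ->
  \int[(m1 \x m2)%E]_z f z = \int[m2]_y \int[m1]_x f (x, y).
Proof.
move=> intf; rewrite /Rintegral; congr fine.
have -> := esym (integral21_prod_meas1 intf); apply: ae_eq_integral => //.
- exact: (measurable_fubini_G intf).
- exact/measurable_EFinP/fubini_measurable2.
by apply: filterS (F2 intf) => x /= -> _.
Qed.

Lemma fubini_swap : (m1 \x m2)%E.-integrable setT (EFin \o f) ->
  \int[m1]_x \int[m2]_y f (x, y) = \int[m2]_y \int[m1]_x f (x, y).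
Proof. by move=> intf; rewrite -fubini_prod1// fubini_prod2. Qed.

Lemma tonelli_integrable2 : measurable_fun setT f ->
  (\int[m2]_y \int[m1]_x (`|f (x, y)|)%:E < +oo)%E ->
  (m1 \x m2)%E.-integrable setT (EFin \o f).
Proof. by move=> mf ?; apply/integrable21ltyP => //; exact/measurable_EFinP. Qed.

End RealFubini.

Section PlaneMeasure.
Variable R : realType.

Lemma leb2_sigma_finite : sigma_finite [set: plane R] (leb2 R).
Proof.
have /sigma_finiteP[F [TF ndF Foo]] := sigma_finiteT (@lebesgue_measure R).
exists (fun n => F n `*` F n).
 rewrite -setXTT TF predeqE => -[x y]; split.
    move=> [/= [n _ Fnx] [k _ Gky]]; exists (maxn n k) => //; split.
    - by move: x Fnx; exact/subsetPset/ndF/leq_maxl.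
    - by move: y Gky; exact/subsetPset/ndF/leq_maxr.
  by move=> [n _ []/= ? ?]; split; exists n.
move=> k; have [? ?] := Foo k.
split; first exact: measurableX.
by rewrite [X in (X < _)%E]product_measure1E// lte_mul_pinfty// ge0_fin_numE.
Qed.

HB.instance Definition _ := Measure.copy (leb2 R)
  (leb2 R : {measure set (plane R) -> \bar R}).
HB.instance Definition _ :=
  Measure_isSigmaFinite.Build _ (plane R) R (leb2 R) leb2_sigma_finite.
End PlaneMeasure.

(** * Topology and measurability of the plane *)

Section PlaneTopology.
Variable R : realType.
Local Notation mu := (leb2 R).

(** The Borel sets of the product topology are measurable because rational
    boxes form a countable basis. *)
Lemma plane_open_measurable (A : set (R * R)) :
  open A -> measurable (A : set (plane R)).
Proof.
move=> oA.
(* boxes with rational end points that are contained in [A] *)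
pose B (i : (rat * rat) * (rat * rat)) : set (plane R) :=
  `]ratr i.1.1, ratr i.1.2[%classic `*` `]ratr i.2.1, ratr i.2.2[%classic.
have -> : A = \bigcup_i (if `[< B i `<=` A >] then B i else set0).
  apply/seteqP; split => [[x y] Axy|z [i _]]; last first.
    by case: ifPn => // /asboolP; exact.
  have /nbhs_ballP[e /= e0 eA] := open_nbhs_nbhs (conj oA Axy).
  have rat_l (t : R) : exists q : rat, t - e < ratr q < t.
    have [|q] := @rat_in_itvoo R (t - e) t; first by rewrite ltrBlDr ltrDl.
    by rewrite in_itv/=; exists q.
  have rat_r (t : R) : exists q : rat, t < ratr q < t + e.
    have [|q] := @rat_in_itvoo R t (t + e); first by rewrite ltrDl.
    by rewrite in_itv/=; exists q.
  have [a /andP[a1 a2]] := rat_l x; have [b /andP[b1 b2]] := rat_r x.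
  have [c /andP[c1 c2]] := rat_l y; have [d /andP[d1 d2]] := rat_r y.
  exists ((a, b), (c, d)) => //; rewrite ifT; last first.
    apply/asboolP => -[u w] [/= /[!in_itv]/= /andP[u1 u2] /andP[w1 w2]].
    apply: eA; split; rewrite /ball/= ltr_norml; apply/andP; split; lra.
  by split; rewrite /= in_itv/= ?a2 ?b1 ?c2 ?d1.
apply: countable_bigcupT_measurable => [|i]; first exact: countableP.
by case: ifP => // _; apply: measurableX; exact: measurable_itv.
Qed.

Lemma plane_closed_measurable (A : set (R * R)) :
  closed A -> measurable (A : set (plane R)).
Proof.
by move=> cA; rewrite -(setCK A); apply: measurableC;
  apply: plane_open_measurable; exact: closed_openC.
Qed.

Lemma plane_compact_measurable (A : set (R * R)) :
  compact A -> measurable (A : set (plane R)).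
Proof.
move=> cA; apply: plane_closed_measurable; apply: compact_closed cA.
exact: norm_hausdorff.
Qed.

Lemma plane_continuous_measurable (f : R * R -> R) :
  continuous f -> measurable_fun [set: plane R] f.
Proof.
move=> cf; apply: (measurability _ (RGenOpens.measurableE R)).
move=> _ [_ [a [b ->]] <-]; rewrite setTI.
by apply: plane_open_measurable; apply: open_comp => // x _; exact: cf.
Qed.

Definition box (M : R) : set (plane R) := `[- M, M]%classic `*` `[- M, M]%classic.

Lemma boxE (M : R) (x : R * R) : box M x <-> `|x.1| <= M /\ `|x.2| <= M.
Proof. by rewrite /box/= !in_itv/= -!ler_norml. Qed.

Lemma box_compact (M : R) : compact (box M : set (R * R)).
Proof. by apply: compact_setX; exact: segment_compact. Qed.

Lemma box_measurable (M : R) : measurable (box M).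
Proof. by apply: measurableX; exact: measurable_itv. Qed.

Lemma box_finite (M : R) : (mu (box M) < +oo)%E.
Proof.
have -> : mu (box M) = (@lebesgue_measure R `[(- M)%R, M] * @lebesgue_measure R `[(- M)%R, M])%E.
  by rewrite -product_measure1E; try exact: measurable_itv.
by rewrite lebesgue_measure_itv; case: ifP => // _; rewrite ?mule0// -EFinB -EFinM ltry.
Qed.

Lemma compact_sub_box (K : set (R * R)) : compact K ->
  exists2 M, 0 < M & K `<=` box M.
Proof.
move=> /compact_bounded[M [_ Mb]]; exists (`|M| + 1); first by rewrite ltr_pwDr.
move=> x Kx; have := Mb (`|M| + 1); rewrite (le_lt_trans (ler_norm M)) ?ltrDl// => /(_ isT x Kx).
by rewrite /= /Num.norm/= ge_max => /andP[x1 x2]; apply/boxE.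
Qed.

Lemma bounded_box_integrable (f : R * R -> R) (M C : R) :
  measurable_fun [set: plane R] f -> (forall x, `|f x| <= C) ->
  (forall x, ~ box M x -> f x = 0) ->
  mu.-integrable setT (EFin \o f).
Proof.
move=> mf fC f0.
apply: (@integrable_dom _ _ _ _ _ (fun x => C * \1_(box M) x)) => //.
  move=> x; rewrite indicE; case: (boolP (x \in box M)) => [|/negP xM]; first by rewrite mulr1.
  by rewrite f0 ?normr0 ?mulr0// => bx; apply: xM; rewrite inE.
apply: integrable_scale; apply: ge0_integrable => //.
  exact: measurable_indic (box_measurable M).
by rewrite integral_indic ?setIT ?box_finite//; exact: box_measurable.
Qed.

End PlaneTopology.

(** * Smooth functions built from flat functions *)

Section FlatFunctions.
Variable R : realType.
Implicit Types p : {poly R}.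

(** Each monomial is dominated by one term of the exponential series. *)
Lemma horner_le_expR p : exists C, forall t, 0 <= t -> `|p.[t]| <= C * expR t.
Proof.
exists (\sum_(i < size p) `|p`_i| * i`!%:R) => t t0.
rewrite horner_coef (le_trans (ler_norm_sum _ _ _))// mulr_suml.
apply: ler_sum => i _; rewrite normrM -mulrA ler_wpM2l//.
rewrite ger0_norm ?exprn_ge0//; case: (nat_of_ord i) => [|n].
  by rewrite expr0 fact0 mul1r -[leLHS]addr0 (le_trans _ (expR_ge1Dx t))// lerD2l.
rewrite -ler_pdivrMl ?ltr0n ?fact_gt0// mulrC.
by rewrite (le_trans _ (expR_ge1Dxn n t0))// lerDr.
Qed.

(** The functions [p(1/s) exp(-1/s)], extended by zero to [s <= 0]; this family is
    stable under differentiation, which makes its members smooth. *)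
Definition flat p (s : R) : R := if 0 < s then p.[s^-1] * expR (- s^-1) else 0.

Definition flat_deriv p : {poly R} := 'X^2 * (p - p^`()).

Lemma flat_le0 p s : s <= 0 -> flat p s = 0.
Proof. by rewrite /flat leNgt => /negbTE ->. Qed.

(** The quadratic bound makes the derivative at the origin vanish. *)
Lemma flat_quadratic p : exists C, 0 <= C /\ forall s, `|flat p s| <= C * s ^+ 2.
Proof.
have [C HC] := horner_le_expR (p * 'X^2).
have C0 : 0 <= C.
  by have := HC 0 (lexx _); rewrite expR0 mulr1; apply: le_trans.
exists C; split=> // s; have [s0|s0] := ltP 0 s; last first.
  by rewrite flat_le0// normr0 mulr_ge0// sqr_ge0.
rewrite /flat s0 normrM (ger0_norm (expR_ge0 _)) expRN.
rewrite ler_pdivrMr ?expR_gt0//.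
have := HC s^-1; rewrite invr_ge0 (ltW s0) => /(_ isT).
rewrite hornerM hornerXn normrM (ger0_norm (sqr_ge0 _)) exprVn.
by rewrite ler_pdivrMr ?exprn_gt0// mulrAC.
Qed.

Lemma is_derive_inv (s : R) : s != 0 -> is_derive s (1 : R) (fun s : R => s^-1) (- s ^- 2).
Proof.
move=> s0; have := @is_deriveV R id s 1 1 s0 (is_derive_id _ _).
by rewrite [X in is_derive _ _ _ X]mulr1.
Qed.

Lemma is_derive_horner p (s : R) : is_derive s (1 : R) (horner p) (p^`()).[s].
Proof.
apply: DeriveDef; first exact: derivable_horner.
by rewrite -derive1E -derivE.
Qed.

(** Away from the origin this is the chain rule in [1/s]; at the origin the
    difference quotient is bounded by a multiple of [|s|]. *)
Lemma is_derive_flat p (s : R) : is_derive s 1 (flat p) (flat (flat_deriv p) s).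
Proof.
have [s0|s0|s0] := ltgtP 0 s.
- have h : is_derive s (1 : R) (fun s => p.[s^-1] * expR (- s^-1)) (flat (flat_deriv p) s).
    have dV := is_derive_inv (lt0r_neq0 s0).
    have dp := @is_derive1_comp _ (horner p) (fun s => s^-1) s _ _ (is_derive_horner _ _) dV.
    have dN := @is_deriveN _ _ _ (fun s : R => s^-1) _ _ _ dV.
    have de := @is_derive1_comp _ expR _ s _ _ (is_derive_expR _) dN.
    apply: is_derive_eq (@is_deriveM _ _ _ _ _ _ _ _ dp de) _.
    rewrite /flat s0 /flat_deriv !(hornerE,hornerXn) /= exprVn /GRing.scale/=; ring.
  apply: near_eq_is_derive h.
  near=> t; rewrite /flat ifT//.
  by near: t; exact: lt_nbhsr.
- have h : is_derive s (1 : R) (cst 0 : R -> R) (flat (flat_deriv p) s).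
    by rewrite flat_le0 ?(ltW s0)//; exact: is_derive_cst.
  apply: near_eq_is_derive h.
  near=> t; rewrite flat_le0//; apply: ltW.
  by near: t; exact: lt_nbhsl.
- rewrite -s0 flat_le0//; apply/is_derive1_caratheodory.
  exists (fun z => flat p z / z); split.
  + move=> z; rewrite (@flat_le0 _ 0)// !subr0; have [->|z0] := eqVneq z 0.
      by rewrite mulr0 flat_le0.
    by rewrite divfK.
  + have [C [C0 HC]] := flat_quadratic p.
    rewrite /prop_for /continuous_at /= invr0 mulr0.
    apply/cvgr0Pnorm_lt => e e0.
    have C1 : 0 < C + 1 by rewrite ltr_pwDr.
    have small : \forall z \near (0 : R), `|z| < e / (C + 1).
      by apply: nbhs0_lt; rewrite divr_gt0.
    apply: filterS small => z ze.
    have [->|z0] := eqVneq z 0; first by rewrite invr0 mulr0 normr0.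
    rewrite normrM normrV ?unitfE// ltr_pdivrMr ?normr_gt0//.
    apply: le_lt_trans (HC z) _; rewrite -real_normK ?num_real// expr2 mulrA ltr_pM2r ?normr_gt0//.
    apply: (@le_lt_trans _ _ ((C + 1) * `|z|)).
      by rewrite ler_wpM2r// lerDl.
    by rewrite -ltr_pdivlMl// mulrC.
  + by rewrite invr0 mulr0.
Unshelve. all: by end_near. Qed.

End FlatFunctions.
Section Lines.
Variable R : realType.

Lemma is_derive_lineP (V : normedModType R) (f : V -> R) (x v : V) (df : R) :
  is_derive x v f df <-> is_derive (0 : R) (1 : R) (fun h : R => f (h *: v + x)) df.
Proof.
have E : 'D_v f x = 'D_1 (fun h : R => f (h *: v + x)) 0.
  rewrite /derive.
  have -> // : (fun h : R => h^-1 *: ((f \o shift x) (h *: v) - f x)) =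
    (fun h : R => h^-1 *: (((fun h : R => f (h *: v + x)) \o shift 0) (h *: (1:R)) - f (0 *: v + x))).
  apply/funext => h /=.
  by rewrite [h *: 1 + 0]addr0 [h *: 1]mulr1 scale0r add0r.
split=> -[H1 H2]; apply: DeriveDef.
- by move/derivable1P : H1.
- by rewrite -E.
- exact/derivable1P.
- by rewrite E.
Qed.

Lemma is_derive_translate (g : R -> R) (s dg : R) :
  is_derive s (1 : R) g dg <-> is_derive (0 : R) (1 : R) (fun h => g (h + s)) dg.
Proof.
have -> : (fun h => g (h + s)) = (fun h : R => g (h *: (1 : R) + s)).
  by apply/funext => h; rewrite [h *: 1]mulr1.
exact: is_derive_lineP.
Qed.

Lemma ord2P (k : 'I_2) : k = 0 \/ k = 1.
Proof. by case: k => -[|[|//]] ?; [left|right]; apply/val_inj. Qed.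

Definition coord (k : 'I_2) (x : R * R) : R := if k == 0 then x.1 else x.2.

Lemma coord_line j k (h : R) (x : R * R) :
  coord j (h *: evec R k + x) = (if j == k then h else 0) + coord j x.
Proof.
have s1 : h *: (1 : R) = h := mulr1 h.
have s0 : h *: (0 : R) = 0 := mulr0 h.
by case: j k => -[|[|//]] ? [[|[|//]] ?]; rewrite /coord /evec /= ?s1 ?s0.
Qed.

Lemma coord_continuous k : continuous (coord k).
Proof. by rewrite /coord; case: (k == 0) => x; [exact: cvg_fst|exact: cvg_snd]. Qed.

Lemma is_derive_coord (g : R -> R) (dg : R) j k (x : R * R) :
  is_derive (coord j x) (1 : R) g dg ->
  is_derive x (evec R k) (g \o coord j) (if j == k then dg else 0).
Proof.
move=> dgx; apply/is_derive_lineP.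
have -> : (fun h : R => (g \o coord j) (h *: evec R k + x)) =
          (fun h : R => g ((if j == k then h else 0) + coord j x)).
  by apply/funext => h; rewrite /= coord_line.
by case: (j == k); [apply: (is_derive_translate _ _ _).1|exact: is_derive_cst].
Qed.

Definition upd (k : 'I_2) (x : R * R) (s : R) : R * R :=
  if k == 0 then (s, x.2) else (x.1, s).

Lemma is_derive_upd (f : R * R -> R) k (x : R * R) (s df : R) :
  is_derive (upd k x s) (evec R k) f df <->
  is_derive s (1 : R) (fun s => f (upd k x s)) df.
Proof.
apply: (iff_trans (is_derive_lineP _ _ _ _)).
apply: iff_sym; apply: (iff_trans (is_derive_translate _ _ _)).
have -> // : (fun h : R => f (h *: evec R k + upd k x s)) =
          (fun h : R => f (upd k x (h + s))).
apply/funext => h; congr f; rewrite /upd /evec; case: ifP => _; apply/pair_equal_spec; split => /=;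
  by rewrite /GRing.scale/= ?(mulr1,mulr0,add0r).
Qed.

End Lines.

Section TestFunctions.
Variable R : realType.
Implicit Types (f g : R * R -> R).

(** The partial derivative of a member is again a member, so a structural induction
    replaces the computation of higher derivatives. *)
Inductive flat_algebra : (R * R -> R) -> Prop :=
| FlatCst c : flat_algebra (fun=> c)
| FlatCoord p j (c a : R) : flat_algebra (fun x => flat p (c * coord j x + a))
| FlatAdd f g : flat_algebra f -> flat_algebra g -> flat_algebra (fun x => f x + g x)
| FlatMul f g : flat_algebra f -> flat_algebra g -> flat_algebra (fun x => f x * g x).

Lemma flat_continuous p : continuous (@flat R p).
Proof.
move=> s; apply: differentiable_continuous; apply/derivable1_diffP.
by have [] := is_derive_flat p s.
Qed.

Lemma flat_algebra_continuous f : flat_algebra f -> continuous f.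
Proof.
elim=> [c|p j c a|{}f g _ cf _ cg|{}f g _ cf _ cg] x.
- exact: cvg_cst.
- apply: (@continuous_comp _ _ _ (fun x => c * coord j x + a) (flat p)); last exact: flat_continuous.
  by apply: cvgD; [apply: cvgM; [exact: cvg_cst|exact: coord_continuous]|exact: cvg_cst].
- by apply: cvgD; [exact: cf|exact: cg].
- by apply: cvgM; [exact: cf|exact: cg].
Qed.

Lemma flat_algebra_partial k f : flat_algebra f ->
  exists2 df, flat_algebra df & forall x, is_derive x (evec R k) f (df x).
Proof.
elim=> [c|p j c a|{}f g _ [df fdf Df] _ [dg fdg Dg]|{}f g ff [df fdf Df] fg [dg fdg Dg]].
- by exists (fun=> 0) => [|x]; [exact: FlatCst|exact: is_derive_cst].
- exists (fun x => flat (flat_deriv p) (c * coord j x + a) * (if j == k then c else 0)).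
    by apply: FlatMul; [exact: FlatCoord|exact: FlatCst].
  move=> x; rewrite (_ : _ * _ = if j == k then flat (flat_deriv p) (c * coord j x + a) * c else 0); last first.
    by case: ifP => //; rewrite mulr0.
  apply: (@is_derive_coord R (fun s => flat p (c * s + a))).
  apply: (@is_derive1_comp R (flat p) (fun s => c * s + a)); first exact: is_derive_flat.
  by apply: is_derive_eq; rewrite addr0 [_ *: _]mulr1.
- exists (fun x => df x + dg x) => [|x]; first exact: FlatAdd.
  by have := is_deriveD (Df x) (Dg x).
- exists (fun x => f x * dg x + g x * df x) => [|x].
    by apply: FlatAdd; exact: FlatMul.
  by have := is_deriveM (Df x) (Dg x).
Qed.

(** Continuity and closure under partial derivatives give every order of smoothness. *)
Lemma flat_algebra_Ck n f : flat_algebra f -> Ck n f.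
Proof.
elim: n f => [|n IH] f ff; split => //; try exact: flat_algebra_continuous.
move=> k; have [df fdf Df] := flat_algebra_partial k ff.
split=> [x|]; first by have [] := Df x.
suff -> : dpartial k f = df by exact: IH.
by apply/funext => x; have [_ <-] := Df x.
Qed.

End TestFunctions.

(** * Test functions separate locally integrable functions *)

Section Bumps.
Variable R : realType.
Local Notation mu := (leb2 R).
Implicit Types (a b c d : R) (n : nat) (x : R * R).

(** Smooth functions that increase to the indicator of a rectangle. *)
Definition bump a b c d n x : R :=
  (flat 1 (n.+1%:R * coord 0 x + - (n.+1%:R * a)) *
   flat 1 (- n.+1%:R * coord 0 x + n.+1%:R * b)) *
  (flat 1 (n.+1%:R * coord 1 x + - (n.+1%:R * c)) *
   flat 1 (- n.+1%:R * coord 1 x + n.+1%:R * d)).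

Definition rect a b c d : set (plane R) := `]a, b[%classic `*` `]c, d[%classic.

Lemma bumpE a b c d n x : bump a b c d n x =
  (flat 1 (n.+1%:R * (x.1 - a)) * flat 1 (n.+1%:R * (b - x.1))) *
  (flat 1 (n.+1%:R * (x.2 - c)) * flat 1 (n.+1%:R * (d - x.2))).
Proof. by rewrite /bump /coord/= !mulrBr !mulNr [- _ + _ * b]addrC [- _ + _ * d]addrC. Qed.

Lemma flat1_ge0 (s : R) : 0 <= flat 1 s.
Proof. by rewrite /flat; case: ifP => // _; rewrite hornerC mul1r expR_ge0. Qed.

Lemma flat1_le1 (s : R) : flat 1 s <= 1.
Proof.
rewrite /flat; case: ifP => // s0.
by rewrite hornerC mul1r expR_le1 oppr_le0 invr_ge0 ltW.
Qed.

Lemma flat1_cvg (t : R) : flat 1 (n.+1%:R * t) @[n --> \oo] --> ((0 < t)%R%:R : R).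
Proof.
have [t0|t0] := ltP 0 t; last first.
  rewrite (_ : (fun n => _) = fun=> 0); first exact: cvg_cst.
  by apply/funext => n; rewrite flat_le0// mulr_ge0_le0.
rewrite (_ : (fun n => _) = fun n => expR (- (n.+1%:R^-1 * t^-1))); last first.
  by apply/funext => n; rewrite /flat mulr_gt0// hornerC mul1r invfM.
rewrite -[X in _ --> X]expR0; apply: (continuous_cvg _ (@continuous_expR R 0)).
rewrite -oppr0 -[X in - X](mul0r t^-1); apply: cvgN; apply: cvgM; last exact: cvg_cst.
exact: cvg_harmonic.
Qed.

Lemma bump_cvg a b c d x :
  bump a b c d n x @[n --> \oo] --> (\1_(rect a b c d) x : R).
Proof.
under eq_fun do rewrite bumpE.
have -> : \1_(rect a b c d) x = ((0 < x.1 - a)%R%:R * (0 < b - x.1)%R%:R) *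
   ((0 < x.2 - c)%R%:R * (0 < d - x.2)%R%:R) :> R.
  rewrite indicE -!natrM !mulnb; congr (_%:R); congr nat_of_bool.
  apply/idP/idP; rewrite !subr_gt0 ?inE /rect /= !in_itv/=.
    by move=> [/andP[-> ->] /andP[-> ->]].
  by move=> /andP[/andP[-> ->] /andP[-> ->]].
by apply: cvgM; apply: cvgM; exact: flat1_cvg.
Qed.

Lemma bump_ge0 a b c d n x : 0 <= bump a b c d n x.
Proof. by rewrite !mulr_ge0// flat1_ge0. Qed.

Lemma bump_le1 a b c d n x : bump a b c d n x <= 1.
Proof. by rewrite !mulr_ile1// ?mulr_ge0// ?flat1_ge0// flat1_le1. Qed.

Lemma bump_supp a b c d n x : bump a b c d n x != 0 -> rect a b c d x.
Proof.
have pos (s : R) : flat 1 (n.+1%:R * s) != 0 -> 0 < s.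
  by rewrite ltNge; apply: contraNN => s0; rewrite flat_le0// mulr_ge0_le0.
rewrite bumpE !mulf_eq0 !negb_or => /andP[/andP[/pos h1 /pos h2] /andP[/pos h3 /pos h4]].
by rewrite /rect /= !in_itv/= -(subr_gt0 a) -(subr_gt0 _ b) -(subr_gt0 c) -(subr_gt0 _ d) h1 h2 h3 h4.
Qed.

(** The bump is a product of flat functions of the coordinates, and it vanishes
    outside a compact rectangle. *)
Lemma bump_test a b c d n : test_function (bump a b c d n).
Proof.
split=> [m|].
  apply: flat_algebra_Ck.
  by apply: FlatMul; apply: FlatMul; exact: FlatCoord.
apply: (@subclosed_compact _ _ (`[a, b]%classic `*` `[c, d]%classic)).
- exact: closed_closure.
- by apply: compact_setX; exact: segment_compact.
have cl : closed (`[a, b]%classic `*` `[c, d]%classic : set (R * R)).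
  apply: compact_closed; first exact: norm_hausdorff.
  by apply: compact_setX; exact: segment_compact.
move/closure_id : cl => ->; apply: closureS => x /bump_supp[/= h1 h2].
by split => /=; exact: subset_itv_oo_cc.
Qed.

End Bumps.

Section DominatedConvergence.
Context d (T : measurableType d) (R : realType) (mu : {measure set T -> \bar R}).

Lemma dominated_cvg_Rintegral (f_ : nat -> T -> R) (f g : T -> R) :
  (forall n, measurable_fun setT (f_ n)) -> measurable_fun setT f ->
  {ae mu, forall x, f_ n x @[n --> \oo] --> f x} ->
  mu.-integrable setT (EFin \o g) ->
  {ae mu, forall x n, `|f_ n x| <= g x} ->
  \int[mu]_x f_ n x @[n --> \oo] --> \int[mu]_x f x.
Proof.
move=> mf_ mf cf ig dg.
have [||] := @dominated_convergence _ _ _ mu setT measurableT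
  (fun n => EFin \o f_ n) (EFin \o f) (EFin \o g)
  (fun n => (measurable_EFinP _ _).2 (mf_ n)) ((measurable_EFinP _ _).2 mf) _ ig _.
- by apply: filterS cf => x fx _; apply: cvg_EFin => //; exact: nearW.
- by apply: filterS dg => x gx n _; rewrite lee_fin.
move=> i1 _ h; apply: fine_cvg; rewrite fineK//; exact: integrable_fin_num.
Qed.
End DominatedConvergence.

Section WeakUniqueness.
Variable R : realType.
Local Notation mu := (leb2 R).
Variable w : R * R -> R.
Hypothesis mw : measurable_fun [set: plane R] w.
Hypothesis iw : forall M : R, mu.-integrable (box M) (EFin \o w).

Let w_box M : mu.-integrable setT (EFin \o (fun x => w x * \1_(box M) x)).
Proof.
have -> : EFin \o (fun x => w x * \1_(box M) x) = (EFin \o w) \_ (box M).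
  apply/funext => x /=; rewrite patchE indicE; case: ifP => _; rewrite ?mulr1 ?mulr0//.
by apply/(integrable_mkcond _ (box_measurable M)).
Qed.

Lemma rect_measurable (a b c d : R) : measurable (rect a b c d).
Proof. by apply: measurableX; exact: measurable_itv. Qed.

Hypothesis w0 : forall chi, test_function chi -> \int[mu]_x (w x * chi x) = 0.

(** Bumps converge pointwise to the indicator and stay below it. *)
Lemma rect_integral0 (a b c d : R) : \int[mu]_x (w x * \1_(rect a b c d) x) = 0.
Proof.
(* a box that contains the rectangle, on which [w] is integrable *)
pose M := `|a| + `|b| + `|c| + `|d|.
have rM : rect a b c d `<=` box M.
  move=> x [/= /[!in_itv]/= /andP[x1 x2] /andP[x3 x4]]; apply/boxE.
  have := ler_norm (- a); have := ler_norm b; have := ler_norm (- c); have := ler_norm d.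
  have := normr_ge0 a; have := normr_ge0 b; have := normr_ge0 c; have := normr_ge0 d.
  rewrite /M !normrN => ? ? ? ? ? ? ? ?; split; rewrite ler_norml; apply/andP; split; lra.
have : \int[mu]_x (w x * bump a b c d n x) @[n --> \oo] -->
       \int[mu]_x (w x * \1_(rect a b c d) x).
  apply: (@dominated_cvg_Rintegral _ (plane R) R mu (fun n x => w x * bump a b c d n x)
    (fun x => w x * \1_(rect a b c d) x) (fun x => `|w x * \1_(box M) x|)).
  - move=> n; apply: measurable_funM => //; apply: plane_continuous_measurable.
    by have [/(_ 0%N)[]] := bump_test a b c d n.
  - by apply: measurable_funM => //; exact: measurable_indic (rect_measurable _ _ _ _).
  - by apply: aeW => x; apply: cvgM; [exact: cvg_cst|exact: bump_cvg].
  - exact: integrable_norm.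
  - apply: aeW => x n; rewrite [leLHS]normrM (normrM (w x) (\1_(box M) x)).
    rewrite ler_wpM2l// (ger0_norm (bump_ge0 _ _ _ _ _ _)) indicE.
    have [->|/bump_supp/rM bx] := eqVneq (bump a b c d n x) 0; first by rewrite normr_ge0.
    by rewrite mem_set// normr1 bump_le1.
rewrite (_ : (fun n => _) = fun=> 0); last first.
  by apply/funext => n; rewrite w0//; exact: bump_test.
by move=> /cvg_lim <- //; rewrite lim_cst.
Qed.

Let G : set (set (plane R)) := [set A | exists a b c d, A = rect a b c d].

Let rectI (a b c d a' b' c' d' : R) : rect a b c d `&` rect a' b' c' d' =
  rect (Num.max a a') (Num.min b b') (Num.max c c') (Num.min d d').
Proof.
apply/seteqP; split => x; rewrite /rect /= !in_itv/= !gt_max !lt_min.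
  by move=> [[/andP[-> ->] /andP[-> ->]] [/andP[-> ->] /andP[-> ->]]].
by move=> [/andP[/andP[-> ->] /andP[-> ->]] /andP[/andP[-> ->] /andP[-> ->]]].
Qed.

Let GI : setI_closed G.
Proof. by move=> _ _ [a [b [c [d ->]]]] [a' [b' [c' [d' ->]]]]; rewrite rectI; do 4 eexists. Qed.

Let G_cover1 (a b : R) : <<s G >> (`]a, b[%classic `*` setT).
Proof.
have -> : `]a, b[%classic `*` setT = \bigcup_n rect a b (- n%:R) n%:R.
  apply/seteqP; split => -[x y] /= => [[xab _]|[n _ []]//].
  exists (Num.truncn `|y|).+1 => //; split => //=.
  by rewrite in_itv/= -ltr_norml; exact: truncnS_gt.
apply: (@bigcupT_measurable _ (g_sigma_algebraType G)) => n.
by apply: sub_sigma_algebra; do 4 eexists.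
Qed.

Let G_cover2 (a b : R) : <<s G >> (setT `*` `]a, b[%classic).
Proof.
have -> : setT `*` `]a, b[%classic = \bigcup_n rect (- n%:R) n%:R a b.
  apply/seteqP; split => -[x y] /= => [[_ xab]|[n _ []]//].
  exists (Num.truncn `|x|).+1 => //; split => //=.
  by rewrite in_itv/= -ltr_norml; exact: truncnS_gt.
apply: (@bigcupT_measurable _ (g_sigma_algebraType G)) => n.
by apply: sub_sigma_algebra; do 4 eexists.
Qed.

(** Vertical and horizontal open strips are countable unions of rectangles. *)
Let GM : @measurable _ (plane R) = <<s G >>.
Proof.
apply/seteqP; split; last first.
  apply: smallest_sub; first exact: sigma_algebra_measurable.
  by move=> _ [a [b [c [d ->]]]]; exact: rect_measurable.
apply: smallest_sub; first exact: smallest_sigma_algebra.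
rewrite subUset; split=> _ [A mA <-]; rewrite setTI.
- have m1 : measurable_fun [set: g_sigma_algebraType G] (fst : g_sigma_algebraType G -> measurableTypeR R).
    apply: (measurability _ (RGenOpens.measurableE R)).
    move=> _ [_ [a [b ->]] <-]; rewrite setTI.
    suff -> : fst @^-1` `]a, b[%classic = `]a, b[%classic `*` [set: R] by exact: G_cover1.
    by apply/seteqP; split => -[x y] //= -[].
  by have := m1 measurableT A mA; rewrite setTI.
- have m1 : measurable_fun [set: g_sigma_algebraType G] (snd : g_sigma_algebraType G -> measurableTypeR R).
    apply: (measurability _ (RGenOpens.measurableE R)).
    move=> _ [_ [a [b ->]] <-]; rewrite setTI.
    suff -> : snd @^-1` `]a, b[%classic = [set: R] `*` `]a, b[%classic by exact: G_cover2.
    by apply/seteqP; split => -[x y] //= -[].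
  by have := m1 measurableT A mA; rewrite setTI.
Qed.

Let wM (M : R) x := w x * \1_(rect (- M) M (- M) M) x.

Let iwM M : mu.-integrable setT (EFin \o wM M).
Proof.
apply: (@integrable_dom _ (plane R) R mu _ (fun x => `|w x * \1_(box M) x|)).
- by apply: measurable_funM => //; exact: measurable_indic (rect_measurable _ _ _ _).
- move=> x; rewrite /wM !normrM ler_wpM2l// !indicE.
  case: (boolP (x \in rect _ _ _ _)) => [|_]; last by rewrite normr0.
  rewrite inE => -[/= x1 x2]; rewrite mem_set//.
  by split; exact: subset_itv_oo_cc.
- exact: integrable_norm.
Qed.

(** Rectangles form a pi-system that generates the Borel sets, and the sets over
    which a fixed integrable function has integral zero form a lambda-system. *)
Let wM0 M A : measurable A -> (\int[mu]_(x in A) (wM M x)%:E = 0)%E.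
Proof.
have rect0 a b c d : (\int[mu]_(x in rect a b c d) (wM M x)%:E = 0)%E.
  rewrite integral_mkcond.
  have := rect_integral0 (Num.max (- M) a) (Num.min M b) (Num.max (- M) c) (Num.min M d).
  rewrite -rectI /Rintegral => /eqP; rewrite fine_eq0; last first.
    apply: (@integrable_fin_num _ _ _ mu) => //.
    apply: (@integrable_dom _ (plane R) R mu _ (fun x => `|wM M x|)).
    - by apply: measurable_funM => //; apply: measurable_indic; apply: measurableI; exact: rect_measurable.
    - move=> x; rewrite /wM !normrM ler_wpM2l// indicI/=.
      rewrite normrM ler_piMr//; rewrite indicE; case: (_ \in _); by rewrite ?normr1 ?normr0.
    - exact: integrable_norm.
  move=> /eqP <-; apply: eq_integral => x _.
  rewrite patchE /wM indicI/= [X in _ = (_ * (_ * X))%:E]indicE.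
  by case: ifP => _ /=; rewrite ?mulr1 ?mulr0.
rewrite GM -setI_closed_g_dynkin_g_sigma_algebra//.
suff : <<d G>> `<=` [set A | measurable A /\ (\int[mu]_(x in A) (wM M x)%:E = 0)%E].
  by move=> /[apply] -[].
have tot0 : (\int[mu]_x (wM M x)%:E = 0)%E.
  rewrite -(rect0 (- M) M (- M) M) [RHS]integral_mkcond; apply: eq_integral => x _.
  by rewrite patchE; case: ifP => // xr; rewrite /wM indicE xr mulr0.
apply: smallest_sub.
- split => [|A' [mA' A'0]|F tF F0]; first by split.
  + split; first exact: measurableC.
    have := tot0; rewrite -(setvU A') integral_setU//.
    * by rewrite A'0 adde0.
    * exact: measurableC.
    * by rewrite setvU; exact/measurable_EFinP/integrable_measurable/iwM.
    * by apply/disj_setPS; rewrite setICl.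
  + have mF n : measurable (F n) by case: (F0 n).
    split; first exact: bigcupT_measurable.
    rewrite integral_bigcup//; first by rewrite eseries0// => n _ _; case: (F0 n).
    exact: integrableS (bigcupT_measurable _ mF) _ (iwM M).
- by move=> _ [a [b [c [d ->]]]]; split => //; exact: rect_measurable.
Qed.

(** The fundamental lemma of the calculus of variations: the integral over every
    Borel subset of a rectangle vanishes, and countably many rectangles cover the plane. *)
Lemma test_functions_separate : {ae mu, forall x, w x = 0}.
Proof.
have h n : {ae mu, forall x, wM n%:R x = 0}.
  have := @integral_ae_eq _ _ _ mu setT measurableT (cst 0%E) _ (iwM n%:R) (measurable_cst _).
  move=> H; have {H} : ae_eq mu setT (EFin \o wM n%:R) (cst 0%E).
    by apply: H => E _ mE; rewrite wM0// integral0.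
  by apply: filterS => x /(_ I)[].
have := ae_foralln h.
apply: filterS => x wx.
have := wx (Num.truncn (`|x.1| + `|x.2|)).+1; rewrite /wM indicE mem_set ?mulr1//.
have lt := truncnS_gt (`|x.1| + `|x.2|).
by split => /=; rewrite in_itv/= -ltr_norml (le_lt_trans _ lt)// (lerDl, lerDr).
Qed.

End WeakUniqueness.

(** * Integrals on the line *)

Section LineIntegrals.
Variable R : realType.
Local Notation leb := (@lebesgue_measure R).
Local Open Scope ereal_scope.

(** Lebesgue measure is determined by its values on half-open intervals. *)
Lemma lebesgue_measure_translate (a : R) (A : set R) : measurable A ->
  pushforward leb (fun t : R => (t + a)%R : measurableTypeR R) A = leb A.
Proof.
have mt : measurable_fun [set: measurableTypeR R] (fun t : R => (t + a)%R : measurableTypeR R).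
  exact: measurable_funD.
move=> mA.
pose m := pushforward leb (fun t : R => (t + a)%R : measurableTypeR R) : {measure set _ -> \bar R}.
apply/esym/lebesgue_measure_unique => //= _ [[p q]] _ <-.
rewrite /pushforward.
have -> : (fun t : R => (t + a)%R) @^-1` `]p, q]%classic = `](p - a)%R, (q - a)%R]%classic.
  by apply/seteqP; split => t /=; rewrite !in_itv/= ltrBlDr lerBrDr.
rewrite !lebesgue_measure_itv/= !lte_fin ltrD2r; case: ifP => // _.
by rewrite -!EFinD; congr EFin; ring.
Qed.

Lemma ge0_integral_translate (f : R -> \bar R) (a : R) :
  measurable_fun [set: R] f -> (forall t, 0 <= f t) ->
  \int[leb]_t f (t + a)%R = \int[leb]_t f t.
Proof.
move=> mf f0.
have mt : measurable_fun [set: measurableTypeR R] (fun t : R => (t + a)%R : measurableTypeR R).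
  exact: measurable_funD.
transitivity (\int[pushforward leb (fun t : R => (t + a)%R : measurableTypeR R)]_t f t).
  by rewrite ge0_integral_pushforward.
apply: eq_measure_integral => //= A mA _.
exact: lebesgue_measure_translate.
Qed.

Lemma ge0_integral_even_le (f : R -> \bar R) :
  measurable_fun [set: R] f -> (forall t, 0 <= f t) ->
  (forall t, f (- t)%R = f t) ->
  \int[leb]_t f t <= 2%:E * \int[leb]_(t in `[0%R, +oo[) f t.
Proof.
move=> mf f0 fN.
have -> : 2%:E * \int[leb]_(t in `[0%R, +oo[) f t =
    \int[leb]_(t in `[0%R, +oo[) f t + \int[leb]_(t in `]-oo, 0%R]) f t.
  rewrite [X in X + _]ge0_integration_by_substitution0//.
  under [X in _ = X + _]eq_integral do rewrite fN.
  rewrite mule_natl mule2n; congr +%E; rewrite ge0_integration_by_substitution0//;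
    by apply: eq_integral => t _; rewrite fN.
rewrite (_ : setT = `[0%R, +oo[%classic `|` `]-oo, 0%R[%classic); last first.
  by apply/seteqP; split => t //= _; rewrite !in_itv/= andbT; case: leP; [left|right].
rewrite ge0_integral_setU//=; last 2 first.
- by apply: measurable_funTS.
- apply/disj_setPS => t /= []; rewrite !in_itv/= andbT => h1 h2.
  by move: (le_lt_trans h1 h2); rewrite ltxx.
rewrite leeD2l//; apply: ge0_subset_integral => //.
- by apply: measurable_funTS.
- by move=> t /=; rewrite !in_itv/=; exact: ltW.
Qed.

(** The singularity which the fourth power of the kernel [kap] leaves in each variable
    once [|z|^2] is bounded below by the product [|z.1| |z.2|]. *)
Definition rho (t : R) : R := (if `|t| < 1 then `|t| `^ (- (2 / 3)) else 0)%R.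

Lemma rho_ge0 t : (0 <= rho t)%R.
Proof. by rewrite /rho; case: ifP => // _; exact: powR_ge0. Qed.

Lemma rho_measurable : measurable_fun [set: R] rho.
Proof.
apply: measurable_fun_ifT.
- by apply: measurable_fun_ltr => //; exact: normr_measurable.
- by apply: (measurableT_comp (measurable_powR _)); exact: normr_measurable.
- exact: measurable_cst.
Qed.

(** The antiderivative is [3 t^(1/3)], hence the value [3] on each half line. The
    singularity at the origin is reached by monotone convergence. *)
Lemma rho_integral (a : R) : \int[leb]_t (rho (a - t))%:E <= 6%:E.
Proof.
have mr : measurable_fun [set: R] (EFin \o rho) by apply/measurable_EFinP; exact: rho_measurable.
have rN t : rho (- t)%R = rho t by rewrite /rho normrN.
have -> : \int[leb]_t (rho (a - t))%:E = \int[leb]_t (rho t)%:E.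
  have r0 t : 0 <= (EFin \o rho) t by rewrite lee_fin rho_ge0.
  transitivity (\int[leb]_t (rho (t + - a)%R)%:E).
    by apply: eq_integral => t _; rewrite -rN opprB.
  exact: (ge0_integral_translate (- a)%R mr r0).
have : \int[leb]_t (rho t)%:E <= 2%:E * \int[leb]_(t in `[0%R, +oo[) (rho t)%:E.
  apply: (@ge0_integral_even_le (EFin \o rho)) => //= t; first by rewrite lee_fin rho_ge0.
  by rewrite rN.
move=> /le_trans; apply.
rewrite (_ : 6%:E = 2%:E * 3%:E); last by rewrite -EFinM; congr EFin; ring.
rewrite lee_pmul2l//.
pose F n : set R := `[n.+1%:R^-1%R, 1%R]%classic.
have ndF : nondecreasing_seq F.
  apply/nondecreasing_seqP => n; rewrite subsetEset => t; rewrite /F /= !in_itv/= => /andP[h ->].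
  by rewrite andbT; apply: le_trans h; rewrite lef_pV2 ?posrE// ler_nat.
have : \int[leb]_(t in F n) (rho t)%:E @[n --> \oo] --> \int[leb]_(t in \bigcup_n F n) (rho t)%:E.
  apply: ge0_nondecreasing_set_cvg_integral => //.
  - by move=> i; exact: measurable_itv.
  - by move=> i; exact: measurable_funTS.
  - by move=> i t _; rewrite lee_fin rho_ge0.
have -> : \int[leb]_(t in \bigcup_n F n) (rho t)%:E = \int[leb]_(t in `[0%R, +oo[) (rho t)%:E.
  rewrite [LHS]integral_mkcond [RHS]integral_mkcond; apply: eq_integral => t _.
  rewrite !patchE; case: ifPn => [|tF].
    rewrite inE => -[n _]; rewrite /F /= in_itv/= => /andP[t1 t2]; rewrite mem_set//=.
    by rewrite in_itv/= andbT (le_trans _ t1).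
  case: ifPn => //; rewrite inE/= in_itv/= andbT => t0.
  rewrite /rho ger0_norm//; case: ifPn => // t1; congr EFin.
  move: t0; rewrite le_eqVlt => /predU1P[<-|t0].
    by rewrite powR0// oppr_eq0 mulf_neq0// invr_eq0.
  exfalso; move/negP : tF; apply; rewrite inE.
  exists (Num.truncn t^-1) => //; rewrite /F /= in_itv/= (ltW t1) andbT.
  by rewrite -[leRHS]invrK lef_pV2 ?posrE// ?invr_gt0// ltW// truncnS_gt.
move=> /cvg_lim <-//; apply: lime_le.
  apply: ereal_nondecreasing_is_cvgn; apply: ge0_nondecreasing_set_nondecreasing_integral => //.
  - by move=> i; exact: measurable_itv.
  - by move=> i; exact: measurable_funTS.
  - by move=> i t _; rewrite lee_fin rho_ge0.
apply: nearW => -[|n].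
  by rewrite /F invr1 set_itv1 integral_set1.
have n1 : (n.+2%:R^-1 < 1 :> R)%R by rewrite invf_lt1// ltr1n.
have n0 : (0 < n.+2%:R^-1 :> R)%R by rewrite invr_gt0.
pose P (t : R) := (3 * t `^ (1 / 3))%R.
have dP (t : R) : (0 < t)%R -> is_derive t (1%R : R) P (t `^ (- (2 / 3)))%R.
  move=> t0; rewrite /P.
  have := @is_deriveZ R R R (fun t => t `^ (1 / 3))%R 3%R t 1%R _ (is_derive1_powR (1 / 3) t0).
  move=> h; apply: (is_derive_eq h); rewrite /GRing.scale/= mulrA.
  have -> : (1 / 3 - 1 = - (2 / 3) :> R)%R by lra.
  by have -> : (3 * (1 / 3) = 1 :> R)%R; [lra|rewrite mul1r].
have cP (t : R) : (0 < t)%R -> {for t, continuous P}.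
  by move=> t0; apply: differentiable_continuous; apply/derivable1_diffP; have [] := dP _ t0.
have cp (t : R) : (0 < t)%R -> {for t, continuous (fun t : R => t `^ (- (2 / 3)))%R}.
  move=> t0; apply: differentiable_continuous; apply/derivable1_diffP.
  by have [] := is_derive1_powR (- (2 / 3)) t0.
have Fpos t : F n.+1 t -> (0 < t)%R.
  by rewrite /F /= in_itv/= => /andP[h _]; exact: lt_le_trans h.
apply: (@le_trans _ _ (\int[leb]_(t in F n.+1) (t `^ (- (2 / 3)))%:E)).
  apply: ge0_le_integral => //.
  - exact: measurable_itv.
  - by move=> t _; rewrite lee_fin rho_ge0.
  - by apply: measurable_funTS.
  - by apply: measurable_funTS; apply/measurable_EFinP; exact: measurable_powR.
  - move=> t /Fpos t0; rewrite lee_fin /rho; case: ifP => _; last exact: powR_ge0.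
    by rewrite gtr0_norm.
rewrite /F (@continuous_FTC2 R (fun t => t `^ (- (2 / 3)))%R P)//.
- rewrite -EFinB lee_fin /P powR1 mulr1 lerBlDr lerDl.
  by rewrite mulr_ge0// powR_ge0.
- by apply: continuous_in_subspaceT => t; rewrite inE => /Fpos; exact: cp.
- split.
  + by move=> t; rewrite in_itv/= => /andP[h _]; have [] := dP _ (lt_trans n0 h).
  + by apply: cvg_at_right_filter; exact: cP.
  + by apply: cvg_at_left_filter; exact: cP.
- move=> t; rewrite in_itv/= => /andP[h _]; have [_] := dP _ (lt_trans n0 h).
  by rewrite derive1E.
Qed.

End LineIntegrals.

(** * Derivatives in one variable and products of integrals *)

Section Calculus.
Variable R : realType.
Implicit Types (f g : R -> R) (x a b : R).

Lemma is_derive1_add f g x a b : is_derive x (1 : R) f a -> is_derive x (1 : R) g b ->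
  is_derive x (1 : R) (fun t => f t + g t) (a + b).
Proof. exact: is_deriveD. Qed.

Lemma is_derive1_mul f g x a b : is_derive x (1 : R) f a -> is_derive x (1 : R) g b ->
  is_derive x (1 : R) (fun t => f t * g t) (f x * b + g x * a).
Proof. exact: is_deriveM. Qed.

Lemma is_derive1_chain f g x a b : is_derive (g x) (1 : R) f a -> is_derive x (1 : R) g b ->
  is_derive x (1 : R) (fun t => f (g t)) (a * b).
Proof. exact: is_derive1_comp. Qed.

Lemma is_derive1_scale (k : R) f x a : is_derive x (1 : R) f a ->
  is_derive x (1 : R) (fun t => k * f t) (k * a).
Proof. exact: is_deriveZ. Qed.

Lemma is_derive1_addl (k : R) x : is_derive x (1 : R) (fun t => k + t) 1.
Proof.
have := is_derive1_add (is_derive_cst k x 1) (is_derive_id x 1).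
by rewrite add0r.
Qed.

Lemma is_derive1_inv f x a : f x != 0 -> is_derive x (1 : R) f a ->
  is_derive x (1 : R) (fun t => (f t)^-1) (- a / (f x) ^+ 2).
Proof.
move=> f0 df; apply: (is_derive_eq (is_deriveV f0 df)).
by rewrite /GRing.scale/= mulNr mulrC mulNr.
Qed.

Lemma is_derive1_continuous f x a : is_derive x (1 : R) f a -> {for x, continuous f}.
Proof.
by move=> [df _]; apply: differentiable_continuous; exact/derivable1_diffP.
Qed.

End Calculus.

Section PlaneIntegrals.
Variable R : realType.
Local Notation leb := (@lebesgue_measure R).
Local Notation mu := (leb2 R).

(** The antiderivative [- (1 + t)^(- s) / s] vanishes at infinity. *)
Lemma integral_japanese (s : R) : 0 < s ->
  (\int[leb]_t ((1 + `|t|) `^ (- 1 - s))%:E < +oo)%E.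
Proof.
move=> s0.
have mf : measurable_fun [set: R] (fun t : R => (1 + `|t|) `^ (- 1 - s)).
  apply: (measurableT_comp (measurable_powR _)).
  by apply: measurable_funD => //; exact: normr_measurable.
apply: (@le_lt_trans _ _ (2%:E * \int[leb]_(t in `[0%R, +oo[) ((1 + `|t|) `^ (- 1 - s))%:E)%E).
  apply: (@ge0_integral_even_le R (fun t => ((1 + `|t|) `^ (- 1 - s))%:E)).
  - exact/measurable_EFinP.
  - by move=> t; rewrite lee_fin powR_ge0.
  - by move=> t; rewrite normrN.
pose P (t : R) := - s^-1 * (1 + t) `^ (- s).
have dP (t : R) : -1 < t -> is_derive t (1 : R) P ((1 + t) `^ (- 1 - s)).
  move=> t1; have t0 : 0 < 1 + t by lra.
  have h := is_derive1_scale (- s^-1) (is_derive1_chain (is_derive1_powR (- s) t0) (is_derive1_addl 1 t)).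
  apply: (is_derive_eq h); rewrite /GRing.scale/= mulr1 mulrA mulNr mulrN opprK mulVf ?gt_eqF// mul1r.
  by congr (_ `^ _); rewrite addrC.
have cp (t : R) : -1 < t -> {for t, continuous (fun t : R => (1 + t) `^ (- 1 - s))}.
  move=> t1; have t0 : 0 < 1 + t by lra.
  exact: is_derive1_continuous (is_derive1_chain (is_derive1_powR (- 1 - s) t0) (is_derive1_addl 1 t)).
rewrite (@eq_integral _ _ _ leb _ (fun t => ((1 + t) `^ (- 1 - s))%:E)); last first.
  by move=> t; rewrite inE/= in_itv/= andbT => t0; rewrite ger0_norm.
rewrite (@ge0_continuous_FTC2y R (fun t => (1 + t) `^ (- 1 - s)) P 0 0).
- by rewrite -EFinB -EFinM ltry.
- by move=> t _; exact: powR_ge0.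
- apply: continuous_in_subspaceT => t; rewrite inE/= in_itv/= andbT => t0.
  by apply: cp; rewrite (lt_le_trans _ t0).
- rewrite -(mulr0 (- s^-1)); apply: cvgM; first exact: cvg_cst.
  apply/cvgr0Pnorm_lt => e e0.
  exists (e^-1 `^ s^-1); split; first exact: num_real.
  move=> t te; have K0 : 0 <= e^-1 `^ s^-1 by exact: powR_ge0.
  have t0 : 0 < 1 + t by rewrite ltr_pwDl// ltW// (le_lt_trans K0).
  rewrite ger0_norm ?powR_ge0// powRN invf_plt ?posrE ?powR_gt0//.
  have -> : e^-1 = (e^-1 `^ s^-1) `^ s.
    by rewrite -powRrM mulVf ?gt_eqF// powRr1// invr_ge0 ltW.
  by rewrite gt0_ltr_powR// ?nnegrE ?(ltW t0)// (lt_trans te)// ltrDr.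
- by move=> t t0; have [] := dP t (lt_trans (ltrN10 _) t0).
- apply: cvg_at_right_filter; exact: is_derive1_continuous (dP 0 (ltrN10 _)).
- move=> t; rewrite in_itv/= andbT => t0; rewrite derive1E.
  by have [] := dP t (lt_trans (ltrN10 _) t0).
Qed.

Lemma integral_plane_prod (f g : R -> R) :
  measurable_fun [set: R] f -> measurable_fun [set: R] g ->
  (forall t, 0 <= f t) -> (forall t, 0 <= g t) ->
  (\int[mu]_x (f x.1 * g x.2)%:E = \int[leb]_t (f t)%:E * \int[leb]_t (g t)%:E)%E.
Proof.
move=> mf mg f0 g0.
have mF : measurable_fun [set: plane R] (fun x => f x.1 * g x.2).
  by apply: measurable_funM;
     [exact: measurableT_comp mf measurable_fst|exact: measurableT_comp mg measurable_snd].
rewrite (@fubini_tonelli1 _ _ (measurableTypeR R) (measurableTypeR R) R leb leb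
  (fun x => (f x.1 * g x.2)%:E))//=; last 2 first.
  exact/measurable_EFinP.
  by move=> x; rewrite lee_fin mulr_ge0.
rewrite /fubini_F/=.
under eq_integral do under eq_integral do rewrite EFinM.
under eq_integral => t _.
  rewrite ge0_integralZl//; [|exact/measurable_EFinP|by move=> s _; rewrite lee_fin|by rewrite lee_fin].
  over.
rewrite ge0_integralZr//; first exact/measurable_EFinP.
- by move=> t _; rewrite lee_fin.
- by apply: integral_ge0 => t _; rewrite lee_fin.
Qed.
End PlaneIntegrals.

(** * The truncated singular kernel *)

(** The two instances below are for [leb2 R] itself, whose head symbol differs from
    that of a bundled measure. *)
#[export] Instance ae_leb2_filter (R : realType) : Filter (almost_everywhere (leb2 R)).
Proof. exact: ae_filter_ringOfSetsType. Qed.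

#[export] Instance nbhs_ae_leb2_filter (R : realType) :
  Filter (nbhs (almost_everywhere (leb2 R))).
Proof. exact: ae_filter_ringOfSetsType. Qed.

Section SingularKernels.
Variable R : realType.
Local Notation leb := (@lebesgue_measure R).
Local Notation mu := (leb2 R).
Implicit Types x y z : R * R.

Definition nsq z : R := z.1 ^+ 2 + z.2 ^+ 2.
Definition psub x y : R * R := (x.1 - y.1, x.2 - y.2).

Lemma nsq_ge0 z : 0 <= nsq z.
Proof. by rewrite addr_ge0// sqr_ge0. Qed.

Lemma enorm_ge0 z : 0 <= enorm z.
Proof. exact: sqrtr_ge0. Qed.

Lemma enorm_sqr z : enorm z ^+ 2 = nsq z.
Proof. by rewrite sqr_sqrtr// nsq_ge0. Qed.

Lemma jbracketE z : jbracket z = Num.sqrt (1 + nsq z).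
Proof. by rewrite /jbracket enorm_sqr. Qed.

Lemma psubC x y : enorm (psub x y) = enorm (psub y x).
Proof. by rewrite /enorm /psub/= -(opprB y.1) -(opprB y.2) !sqrrN. Qed.

Lemma measurable_fst2 : measurable_fun [set: plane R] (fun z : R * R => z.1 : R).
Proof. exact: measurable_fst. Qed.

Lemma measurable_snd2 : measurable_fun [set: plane R] (fun z : R * R => z.2 : R).
Proof. exact: measurable_snd. Qed.

Lemma nsq_measurable : measurable_fun [set: plane R] nsq.
Proof.
by apply: measurable_funD; apply: measurable_funX; [exact: measurable_fst2|exact: measurable_snd2].
Qed.

Lemma enorm_measurable : measurable_fun [set: plane R] (@enorm R).
Proof.
apply: (measurableT_comp _ nsq_measurable).
exact: continuous_measurable_fun (@sqrt_continuous R).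
Qed.

Lemma psub_measurable :
  measurable_fun [set: plane R * plane R] (fun p : plane R * plane R => psub p.1 p.2 : plane R).
Proof.
apply: measurable_fun_pair; apply: measurable_funB.
- exact: measurableT_comp measurable_fst2 measurable_fst.
- exact: measurableT_comp measurable_fst2 measurable_snd.
- exact: measurableT_comp measurable_snd2 measurable_fst.
- exact: measurableT_comp measurable_snd2 measurable_snd.
Qed.

Lemma psub_measurable1 x : measurable_fun [set: plane R] (fun y => psub x y : plane R).
Proof. exact: (measurableT_comp psub_measurable (pair1_measurable (x : plane R))). Qed.

Lemma psub_measurable2 y : measurable_fun [set: plane R] (fun x => psub x y : plane R).
Proof. exact: (measurableT_comp psub_measurable (pair2_measurable (y : plane R))). Qed.

(** The cube root of the truncated Riesz kernel [1/|z|]. Its fourth power is still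
    integrable, which leaves room for Young's inequality, and it also dominates the
    logarithm near the origin. At the origin its value is [0], as
    [powR] gives [0] there. *)
Definition kap z : R := if enorm z < 1 then enorm z `^ (- (1 / 3)) else 0.

Lemma kap_ge0 z : 0 <= kap z.
Proof. by rewrite /kap; case: ifP => // _; exact: powR_ge0. Qed.

Lemma kapC x y : kap (psub x y) = kap (psub y x).
Proof. by rewrite /kap psubC. Qed.

Lemma kap_measurable : measurable_fun [set: plane R] kap.
Proof.
apply: measurable_fun_ifT.
- by apply: measurable_fun_ltr => //; exact: enorm_measurable.
- exact: (measurableT_comp (measurable_powR (- (1 / 3))) enorm_measurable).
- exact: measurable_cst.
Qed.

Lemma kapX_measurable1 x n : measurable_fun [set: plane R] (fun y => kap (psub x y) ^+ n).
Proof. by apply: measurable_funX; exact: measurableT_comp kap_measurable (psub_measurable1 x). Qed.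

Lemma kapX_measurable2 y n : measurable_fun [set: plane R] (fun x => kap (psub x y) ^+ n).
Proof. by apply: measurable_funX; exact: measurableT_comp kap_measurable (psub_measurable2 y). Qed.

Lemma kap_0or1 z : kap z = 0 \/ 1 <= kap z.
Proof.
rewrite /kap; case: ifPn => [z1|_]; last by left.
have [->|z0] := eqVneq (enorm z) 0.
  by left; rewrite powR0// oppr_eq0 mulf_neq0// invr_eq0.
right; rewrite -[leLHS](powRr0 (enorm z)); apply: ger_powR; last by lra.
by rewrite (ltW z1) lt_neqAle eq_sym z0 enorm_ge0.
Qed.

(** The kernel only takes the value [0] and values that are at least [1]. *)
Lemma kap_exp_le m n z : (0 < m)%N -> (m <= n)%N -> kap z ^+ m <= kap z ^+ n.
Proof.
move=> m0 mn; have [->|k1] := kap_0or1 z; last exact: ler_weXn2l.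
by rewrite !expr0n !gtn_eqF// (leq_trans m0).
Qed.

Lemma kap_cube z : kap z ^+ 3 = if enorm z < 1 then (enorm z)^-1 else 0.
Proof.
rewrite /kap; case: ifP => _; last by rewrite expr0n.
rewrite -powR_mulrn ?powR_ge0// -powRrM.
rewrite (_ : - (1 / 3) * 3%:R = -1 :> R); last by lra.
by rewrite powR_inv1// enorm_ge0.
Qed.

Lemma log_le_kap z : enorm z < 1 -> - ln (enorm z) <= 3 * kap z.
Proof.
move=> z1; have [->|z0] := eqVneq (enorm z) 0.
  by rewrite ln0// oppr0 mulr_ge0// kap_ge0.
have ez : 0 < enorm z by rewrite lt_neqAle eq_sym z0 enorm_ge0.
have k0 : 0 < kap z by rewrite /kap z1 powR_gt0.
have := ln_sublinear k0; rewrite {1}/kap z1 ln_powR => h.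
by have := k0; lra.
Qed.

(** The product bound for the kernel fails only where a coordinate vanishes. *)
Lemma ae_off_axes x : {ae mu, forall y, y.1 != x.1 /\ y.2 != x.2}.
Proof.
pose A : set (plane R) := [set x.1] `*` setT; pose B : set (plane R) := setT `*` [set x.2].
have mA : measurable A by apply: measurableX.
have mB : measurable B by apply: measurableX.
exists (A `|` B); split.
- exact: measurableU.
- apply: null_set_setU => //.
  + transitivity (leb [set x.1] * leb setT)%E; first by rewrite -product_measure1E.
    by rewrite lebesgue_measure_set1 mul0e.
  + transitivity (leb setT * leb [set x.2])%E; first by rewrite -product_measure1E.
    by rewrite lebesgue_measure_set1 mule0.
- move=> y /= /not_andP[] /negP; rewrite negbK => /eqP yx; [left|right]; by split.
Qed.

(** Since [|z.1| |z.2| <= |z|^2], the fourth power [|z|^(-4/3)] is dominated by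
    [|z.1|^(-2/3) |z.2|^(-2/3)], whose integral is a product of one-dimensional ones. *)
Lemma kap_integral x : (\int[mu]_y (kap (psub x y) ^+ 4)%:E <= 36%:E)%E.
Proof.
have mk : measurable_fun [set: plane R] (fun y => kap (psub x y) ^+ 4).
  by apply: measurable_funX; exact: measurableT_comp kap_measurable (psub_measurable1 x).
have mr (a : R) : measurable_fun [set: R] (fun t => rho (a - t)).
  by apply: measurableT_comp; [exact: rho_measurable|exact: measurable_funB].
have bound : {ae mu, forall y : plane R, setT y ->
    ((kap (psub x y) ^+ 4)%:E <= (rho (x.1 - y.1) * rho (x.2 - y.2))%:E)%E}.
  have := ae_off_axes x; apply: filterS => y [y1 y2] _; rewrite lee_fin.
  set z := psub x y; rewrite -[x.1 - y.1]/(z.1) -[x.2 - y.2]/(z.2).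
  have z1 : 0 < `|z.1| by rewrite normr_gt0 subr_eq0 eq_sym.
  have z2 : 0 < `|z.2| by rewrite normr_gt0 subr_eq0 eq_sym.
  have z1E := real_normK (num_real z.1); have z2E := real_normK (num_real z.2).
  have ez : `|z.1| * `|z.2| <= enorm z ^+ 2.
    rewrite enorm_sqr /nsq -z1E -z2E; have := sqr_ge0 (`|z.1| - `|z.2|).
    by have := mulr_ge0 (ltW z1) (ltW z2); nra.
  have ez0 : 0 < enorm z.
    rewrite lt_neqAle enorm_ge0 andbT; apply/eqP => E.
    by move: ez; rewrite -E expr0n/= leNgt mulr_gt0.
  rewrite /kap; case: ifPn => [e1|_]; last by rewrite expr0n/= mulr_ge0// rho_ge0.
  have le1 (a b : R) : 0 <= a -> 0 < b -> a ^+ 2 + b ^+ 2 = enorm z ^+ 2 -> a < 1.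
    move=> a0 b0 E; have : a ^+ 2 < 1.
      have : enorm z ^+ 2 < 1 by rewrite expr_lt1// enorm_ge0.
      by rewrite -E; have := exprn_gt0 2 b0; lra.
    by rewrite expr_lt1.
  have l1 : `|z.1| < 1.
    by apply: (le1 _ `|z.2|) => //; rewrite z1E z2E enorm_sqr.
  have l2 : `|z.2| < 1.
    by apply: (le1 _ `|z.1|) => //; rewrite z1E z2E enorm_sqr /nsq addrC.
  rewrite /rho l1 l2 -powRM//.
  rewrite -powR_mulrn ?powR_ge0// -powRrM.
  rewrite (_ : - (1 / 3) * 4%:R = 2%:R * - (2 / 3) :> R); last by lra.
  rewrite powRrM powR_mulrn ?enorm_ge0// !powRN lef_pV2 ?posrE ?powR_gt0 ?mulr_gt0//.
  by apply: ge0_ler_powR => //; rewrite nnegrE ?sqr_ge0// mulr_ge0.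
apply: (@le_trans _ _ (\int[mu]_y (rho (x.1 - y.1) * rho (x.2 - y.2))%:E)%E).
  apply: ae_ge0_le_integral => //.
  - by move=> y _; rewrite lee_fin exprn_ge0// kap_ge0.
  - exact/measurable_EFinP.
  - by move=> y _; rewrite lee_fin mulr_ge0// rho_ge0.
  - apply/measurable_EFinP; apply: measurable_funM.
      exact: measurableT_comp (mr x.1) measurable_fst.
    exact: measurableT_comp (mr x.2) measurable_snd.
have := @integral_plane_prod R (fun t => rho (x.1 - t)) (fun t => rho (x.2 - t))
  (mr _) (mr _) (fun t => rho_ge0 _) (fun t => rho_ge0 _).
move=> ->; rewrite (_ : 36%:E = 6%:E * 6%:E)%E; last by rewrite -EFinM; congr EFin; ring.
apply: lee_pmul; try exact: rho_integral.
- by apply: integral_ge0 => t _; rewrite lee_fin rho_ge0.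
- by apply: integral_ge0 => t _; rewrite lee_fin rho_ge0.
Qed.

Lemma kap_integral' x : (\int[mu]_y (kap (psub y x) ^+ 4)%:E <= 36%:E)%E.
Proof. by under eq_integral do rewrite kapC; exact: kap_integral. Qed.

End SingularKernels.

(** * Logarithmic weights and tame densities *)

Section Weights.
Variable R : realType.
Local Notation leb := (@lebesgue_measure R).
Local Notation mu := (leb2 R).
Implicit Types x y z : R * R.

Lemma ln_sqrt (a : R) : 0 <= a -> ln (Num.sqrt a) = 2^-1 * ln a.
Proof. by move=> a0; rewrite -powR12_sqrt// ln_powR. Qed.

Lemma jbracket_ge1 z : 1 <= jbracket z.
Proof. by rewrite jbracketE -[leLHS]sqrtr1 ler_wsqrtr// lerDl nsq_ge0. Qed.

Definition lnj z : R := ln (jbracket z).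

Lemma lnj_ge0 z : 0 <= lnj z.
Proof. by rewrite ln_ge0// jbracket_ge1. Qed.

Lemma lnjE z : lnj z = 2^-1 * ln (1 + nsq z).
Proof. by rewrite /lnj jbracketE ln_sqrt// addr_ge0// nsq_ge0. Qed.

Lemma jbracket_measurable : measurable_fun [set: plane R] (@jbracket R).
Proof.
rewrite (_ : @jbracket R = Num.sqrt \o (fun z => 1 + nsq z)); last first.
  by apply/funext => z; rewrite jbracketE.
apply: (measurableT_comp (continuous_measurable_fun (@sqrt_continuous R))).
by apply: measurable_funD => //; exact: nsq_measurable.
Qed.

Lemma lnj_measurable : measurable_fun [set: plane R] lnj.
Proof. exact: measurableT_comp (@measurable_ln R) jbracket_measurable. Qed.

Definition lnk z : R := ln (enorm z).

Lemma lnk_measurable : measurable_fun [set: plane R] lnk.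
Proof. exact: measurableT_comp (@measurable_ln R) (@enorm_measurable R). Qed.

Lemma lnkE z : lnk z = 2^-1 * ln (nsq z).
Proof. by rewrite /lnk ln_sqrt// nsq_ge0. Qed.

Lemma peetre x y : 1 + nsq x <= 2 * (1 + nsq (psub x y)) * (1 + nsq y).
Proof.
rewrite /nsq /psub/=.
have h1 := sqr_ge0 (x.1 - 2 * y.1); have h2 := sqr_ge0 (x.2 - 2 * y.2).
have h3 := mulr_ge0 (nsq_ge0 (psub x y)) (nsq_ge0 y).
by move: h1 h2 h3; rewrite /nsq /psub/=; nra.
Qed.

Lemma peetre' x y : 1 + nsq (psub x y) <= 2 * (1 + nsq x) * (1 + nsq y).
Proof.
have h1 := sqr_ge0 (x.1 + y.1); have h2 := sqr_ge0 (x.2 + y.2).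
have h3 := mulr_ge0 (nsq_ge0 x) (nsq_ge0 y).
by move: h1 h2 h3; rewrite /nsq /psub/=; nra.
Qed.

(** Two applications of Peetre's inequality compare [|x - y|] with [<x>] up to the
    factor [<y>]; for [|x - y| < 1] the logarithm is dominated by the kernel [kap]. *)
Lemma lnk_lnj x y : `|lnk (psub x y) - lnj x| <= ln 4 + lnj y + 3 * kap (psub x y).
Proof.
set z := psub x y.
have k0 := kap_ge0 z.
have X0 : 0 < 1 + nsq x by rewrite ltr_pwDl// nsq_ge0.
have Y0 : 0 < 1 + nsq y by rewrite ltr_pwDl// nsq_ge0.
have D0 : 0 < 1 + nsq z by rewrite ltr_pwDl// nsq_ge0.
have l2 : 0 <= ln 2 :> R by rewrite ln_ge0// ler1n.
have l4 : ln 4 = ln 2 + ln 2 :> R by rewrite -lnM ?posrE//; congr ln; ring.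
have hX : ln (1 + nsq x) <= ln 2 + ln (1 + nsq z) + ln (1 + nsq y).
  rewrite -!lnM ?posrE ?mulr_gt0// ler_ln ?posrE ?mulr_gt0//.
  exact: peetre.
have hD : ln (1 + nsq z) <= ln 2 + ln (1 + nsq x) + ln (1 + nsq y).
  rewrite -!lnM ?posrE ?mulr_gt0// ler_ln ?posrE ?mulr_gt0//.
  exact: peetre'.
have y0 := lnj_ge0 y; have x0 := lnj_ge0 x.
rewrite ler_norml; apply/andP; split; last first.
  have : lnk z <= 2^-1 * ln (1 + nsq z).
    rewrite lnkE ler_pM2l ?invr_gt0//.
    have [->|z0] := eqVneq (nsq z) 0; first by rewrite addr0 ln1 ln0.
    by rewrite ler_ln ?posrE// ?lt_neqAle ?nsq_ge0 1?eq_sym ?z0// lerDr.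
  by move: y0 x0; rewrite !lnjE; lra.
have [z1|z1] := ltP (enorm z) 1.
  have /log_le_kap : enorm z < 1 by [].
  rewrite -/(lnk z) => hk.
  have : ln (1 + nsq z) <= ln 2.
    rewrite ler_ln ?posrE// -enorm_sqr.
    have : enorm z ^+ 2 < 1 by rewrite expr_lt1// enorm_ge0.
    by lra.
  by move: y0 x0; rewrite !lnjE; lra.
have : ln (1 + nsq z) <= ln 2 + ln (nsq z).
  have z2 : 1 <= nsq z by rewrite -enorm_sqr expr_ge1// enorm_ge0.
  rewrite -lnM ?posrE ?(lt_le_trans _ z2)// ler_ln ?posrE ?mulr_gt0 ?(lt_le_trans _ z2)//.
  by lra.
by move: y0 x0; rewrite lnkE !lnjE; lra.
Qed.

(** The inequality [(1 + |s|) (1 + |t|) <= 2 (1 + s^2 + t^2)] reduces the claim to a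
    product of integrals on the line. *)
Lemma integrable_japanese (s : R) : 0 < s ->
  mu.-integrable setT (EFin \o (fun z => (1 + nsq z) `^ (- 1 - s))).
Proof.
move=> s0.
pose f (t : R) := (1 + `|t|) `^ (- 1 - s).
have mf : measurable_fun [set: R] f.
  apply: (measurableT_comp (measurable_powR _)).
  by apply: measurable_funD => //; exact: normr_measurable.
have f0 t : 0 <= f t by exact: powR_ge0.
have I : mu.-integrable setT (EFin \o (fun z : plane R => f z.1 * f z.2)).
  apply: (@ge0_integrable _ (plane R) R mu).
  - by apply: measurable_funM;
      [exact: measurableT_comp mf measurable_fst|exact: measurableT_comp mf measurable_snd].
  - by move=> z; rewrite mulr_ge0.
  - rewrite (integral_plane_prod mf mf f0 f0).
    have := integral_japanese s0; rewrite -/(f _) => foo.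
    have fin : (\int[leb]_t (f t)%:E)%E \is a fin_num.
      by rewrite ge0_fin_numE//; apply: integral_ge0 => t _; rewrite lee_fin.
    by rewrite -(fineK fin) -EFinM ltry.
have {}I := @integrable_scale _ (plane R) R mu (2 `^ (1 + s)) _ I.
apply: (@integrable_dom _ (plane R) R mu _ (fun z => 2 `^ (1 + s) * (f z.1 * f z.2))) => //.
  apply: (measurableT_comp (measurable_powR _)).
  by apply: measurable_funD => //; exact: nsq_measurable.
move=> z; rewrite ger0_norm ?powR_ge0// /f -powRM ?addr_ge0//.
have e : - 1 - s = - (1 + s) by ring.
have p0 : 0 < (1 + `|z.1|) * (1 + `|z.2|) by rewrite mulr_gt0// ltr_pwDl.
rewrite e !powRN -[X in X / _]invrK -invfM lef_pV2 ?posrE ?mulr_gt0 ?invr_gt0 ?powR_gt0//; last first.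
  by rewrite ltr_pwDl// nsq_ge0.
rewrite -powR_inv1 ?powR_ge0// -powRrM mulrN1 powRN.
rewrite -[X in X * _](_ : (2^-1) `^ (1 + s) = _); last first.
  by rewrite -powR_inv1// -powRrM mulN1r powRN.
rewrite -(@powRM _ 2^-1) ?invr_ge0 ?(ltW p0)//.
apply: ge0_ler_powR; rewrite ?nnegrE ?addr_ge0 ?sqr_ge0 ?(ltW s0)//.
rewrite /nsq -(real_normK (num_real z.1)) -(real_normK (num_real z.2)).
have := normr_ge0 z.1; have := normr_ge0 z.2; move: `|z.1| `|z.2| => a b a0 b0.
have := sqr_ge0 (a - b); have := sqr_ge0 (a - 1); have := sqr_ge0 (b - 1); nra.
Qed.

End Weights.
Section ParametricMeasurability.
Context d1 d2 (T1 : measurableType d1) (T2 : measurableType d2) (R : realType).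
Variable m2 : {sigma_finite_measure set T2 -> \bar R}.

(** The integral is built from the Tonelli integrals of the positive and the negative
    part, which depend measurably on the parameter. *)
Lemma measurable_parametric_Rintegral (F : T1 * T2 -> R) :
  measurable_fun setT F -> measurable_fun setT (fun x => \int[m2]_y F (x, y)).
Proof.
move=> mF; have mE : measurable_fun setT (EFin \o F) by exact/measurable_EFinP.
rewrite (_ : (fun x => _) = fine \o (fun x => \int[m2]_y (EFin \o F)^\+ (x, y) -
    \int[m2]_y (EFin \o F)^\- (x, y))%E); last first.
  apply/funext => x; rewrite /Rintegral /= integralE; congr (fine (_ - _)).
  - by apply: eq_integral => y _; rewrite !funeposE.
  - by apply: eq_integral => y _; rewrite !funenegE.
apply: (measurableT_comp (fine_measurable _)) => //.
apply: emeasurable_funB.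
- by apply: measurable_fun_fubini_tonelli_F => //; exact: measurable_funepos.
- by apply: measurable_fun_fubini_tonelli_F => //; exact: measurable_funeneg.
Qed.

End ParametricMeasurability.

Section Tame.
Variable R : realType.
Local Notation leb := (@lebesgue_measure R).
Local Notation mu := (leb2 R).
Implicit Types (x y z : R * R) (f : R * R -> R).
Local Notation integrable f := (mu.-integrable [set: plane R] (EFin \o f)).

(** The class of densities whose logarithmic potential behaves well at infinity (the
    weighted condition) and locally (the square integrability). *)
Definition tame f := [/\ measurable_fun [set: plane R] f,
  integrable (fun y => `|f y| * (1 + lnj y)) & integrable (fun y => f y ^+ 2)].

Lemma tame_integrable f : tame f -> integrable f.
Proof.
move=> [mf If _]; apply: (@integrable_dom _ (plane R) R mu _ (fun y => `|f y| * (1 + lnj y))) => // y.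
by rewrite ler_peMr// lerDl lnj_ge0.
Qed.

(** Half of the extra decay absorbs the logarithm, because [ln t < t] for
    [t = <y>^(eps/2)]. *)
Lemma jbracket_weight (eps : R) : 0 < eps ->
  integrable (fun y => (jbracket y `^ (- 1 - eps) * (1 + lnj y)) ^+ 2).
Proof.
move=> e0; have e20 : 0 < eps / 2 by rewrite divr_gt0.
pose C := (1 + 2 / eps) ^+ 2.
apply: (@integrable_dom _ (plane R) R mu _ (fun y => C * (1 + nsq y) `^ (- 1 - eps / 2))).
- apply: measurable_funX; apply: measurable_funM.
    exact: (measurableT_comp (measurable_powR _)) (@jbracket_measurable R).
  by apply: measurable_funD => //; exact: lnj_measurable.
- move=> y; rewrite ger0_norm ?sqr_ge0//.
  have j1 := jbracket_ge1 y; have j0 : 0 < jbracket y by rewrite (lt_le_trans _ j1).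
  have sq : jbracket y ^+ 2 = 1 + nsq y by rewrite jbracketE sqr_sqrtr// addr_ge0// nsq_ge0.
  rewrite -sq -(@powR_mulrn _ (jbracket y) 2) ?(ltW j0)// -powRrM.
  rewrite /C (_ : 2%:R * (- 1 - eps / 2) = (- 1 - eps / 2) * 2%:R)//; last by rewrite mulrC.
  rewrite powRrM powR_mulrn ?powR_ge0// -exprMn.
  rewrite ler_pXn2r// ?nnegrE ?mulr_ge0 ?addr_ge0 ?powR_ge0 ?lnj_ge0 ?divr_ge0 ?(ltW e0)//.
  rewrite mulrC (_ : - 1 - eps = (- 1 - eps / 2) + (- (eps / 2))); last by lra.
  rewrite powRD; last by apply/implyP => _; rewrite gt_eqF.
  rewrite mulrA mulrAC ler_wpM2r ?powR_ge0//.
  rewrite powRN ler_pdivrMr ?powR_gt0//.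
  set t := jbracket y `^ (eps / 2).
  have t1 : 1 <= t by rewrite -[X in X <= _](powRr0 (jbracket y)) ler_powR// ltW.
  have -> : lnj y = 2 / eps * ln t.
    rewrite /t ln_powR mulrA (_ : 2 / eps * (eps / 2) = 1) ?mul1r//.
    by rewrite mulrA divfK ?gt_eqF// divff.
  have lt : ln t < t by rewrite ln_sublinear// (lt_le_trans _ t1).
  rewrite [leRHS]mulrDl; apply: lerD; first by rewrite mul1r.
  by rewrite ler_wpM2l ?(ltW lt)// divr_ge0// ltW.
- by apply: integrable_scale; exact: integrable_japanese.
Qed.

(** The weight is square integrable even with a logarithm, so the Cauchy-Schwarz
    inequality controls the weighted norm. *)
Lemma tame_weight f (g : R * R -> R) (K eps : R) : 0 < eps ->
  measurable_fun [set: plane R] f -> measurable_fun [set: plane R] g ->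
  integrable (fun y => g y ^+ 2) ->
  (forall y, `|f y| <= K * jbracket y `^ (- 1 - eps) * `|g y|) -> tame f.
Proof.
move=> e0 mf mg g2 fK.
have j1 y := jbracket_ge1 (y : R * R).
have wle y : jbracket y `^ (- 1 - eps) <= 1.
  by rewrite -[X in _ <= X](powRr0 (jbracket y)) ler_powR//; lra.
split => //.
- apply: (@integrable_dom _ (plane R) R mu _
    (fun y => `|K| * ((jbracket y `^ (- 1 - eps) * (1 + lnj y)) * `|g y|))).
  + apply: measurable_funM; first exact: measurableT_comp.
    by apply: measurable_funD => //; exact: lnj_measurable.
  + move=> y; rewrite ger0_norm ?mulr_ge0// ?addr_ge0 ?lnj_ge0//.
    rewrite mulrA mulrAC mulrA ler_wpM2r ?addr_ge0 ?lnj_ge0//.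
    rewrite mulrAC; apply: le_trans (fK y) _.
    by rewrite !ler_wpM2r ?powR_ge0// ler_norm.
  + apply: integrable_scale; apply: integrable_mul2.
    * apply: measurable_funM; first exact: (measurableT_comp (measurable_powR _)) (@jbracket_measurable R).
      by apply: measurable_funD => //; exact: lnj_measurable.
    * exact: measurableT_comp.
    * exact: jbracket_weight.
    * by under eq_fun do rewrite real_normK ?num_real//.
- apply: (@integrable_dom _ (plane R) R mu _ (fun y => K ^+ 2 * g y ^+ 2)).
  + exact: measurable_funX.
  + move=> y; rewrite ger0_norm ?sqr_ge0// -real_normK ?num_real//.
    rewrite -exprMn -[leRHS]real_normK ?num_real// ler_pXn2r ?nnegrE//.
    rewrite normrM; apply: le_trans (fK y) _; rewrite ler_wpM2r//.
    apply: (@le_trans _ _ (`|K| * jbracket y `^ (- 1 - eps))).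
      by rewrite ler_wpM2r ?powR_ge0// ler_norm.
    by rewrite ler_piMr.
  + exact: integrable_scale.
Qed.

Lemma kap4_integrable x : integrable (fun y => kap (psub x y) ^+ 4).
Proof.
apply: (@ge0_integrable _ (plane R) R mu).
- exact: kapX_measurable1.
- by move=> y; rewrite exprn_ge0// kap_ge0.
- by rewrite (le_lt_trans (kap_integral x))// ltry.
Qed.

Lemma kap4_Rintegral x : \int[mu]_y (kap (psub x y) ^+ 4) <= 36.
Proof.
rewrite -lee_fin /Rintegral fineK; first exact: kap_integral.
by have := integrable_fin_num measurableT (kap4_integrable x).
Qed.

Definition potential (K f : R * R -> R) x : R := \int[mu]_y (K (psub x y) * f y).

(** A dominating function for the logarithm against [f]: the product of the
    singularity with [f] is split by the arithmetic-geometric mean inequality. *)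
Let dom f (c : R) x y := c * (`|f y| * (1 + lnj y)) + 3 * (kap (psub x y) ^+ 4 + f y ^+ 2).

Let dom_integrable f c x : tame f -> integrable (dom f c x).
Proof.
move=> [_ I1 I2]; apply: integrable_addr; first exact: integrable_scale.
by apply: integrable_scale; apply: integrable_addr => //; exact: kap4_integrable.
Qed.

Let dom_bound f : tame f -> exists C, 0 <= C /\ forall c x, 0 <= c ->
  \int[mu]_y dom f c x y <= C * (1 + c).
Proof.
move=> tf; have [_ I1 I2] := tf.
pose A := \int[mu]_y (`|f y| * (1 + lnj y)); pose B := \int[mu]_y (f y ^+ 2).
have A0 : 0 <= A by apply: Rintegral_ge0 => y _; rewrite mulr_ge0// addr_ge0// lnj_ge0.
have B0 : 0 <= B by apply: Rintegral_ge0 => y _; exact: sqr_ge0.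
exists (A + 3 * (36 + B)); split; first by rewrite addr_ge0// mulr_ge0// addr_ge0.
move=> c x c0; rewrite /dom RintegralD//; [|exact: integrable_scale|]; last first.
  by apply: integrable_scale; apply: integrable_addr => //; exact: kap4_integrable.
rewrite !RintegralZl//; last by apply: integrable_addr => //; exact: kap4_integrable.
rewrite RintegralD//; last exact: kap4_integrable.
rewrite -/A -/B; have := kap4_Rintegral x; have := mulr_ge0 c0 B0; nra.
Qed.

Let lnk_dom f c x y (a : R) : `|a| <= c - 1 ->
  `|(lnk (psub x y) - lnj x + a) * f y| <= dom f (c + ln 4) x y.
Proof.
move=> ac; rewrite normrM /dom.
have h : `|lnk (psub x y) - lnj x + a| <= (ln 4 + lnj y + 3 * kap (psub x y)) + (c - 1).
  by rewrite (le_trans (ler_normD _ _))// lerD// lnk_lnj.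
apply: le_trans (ler_wpM2r (normr_ge0 _) h) _.
have f0 := normr_ge0 (f y); have k0 := kap_ge0 (psub x y); have j0 := lnj_ge0 y.
have kf : kap (psub x y) * `|f y| <= kap (psub x y) ^+ 4 + f y ^+ 2.
  have k24 := @kap_exp_le _ 2 4 (psub x y) isT isT.
  rewrite -(real_normK (num_real (f y))); have := sqr_ge0 (kap (psub x y) - `|f y|).
  by have := sqr_ge0 (kap (psub x y)); have := sqr_ge0 (`|f y|); nra.
have l4 : 0 <= ln 4 :> R by rewrite ln_ge0// ler1n.
have c1 : 1 <= c by have := le_trans (normr_ge0 a) ac; lra.
have h1 := mulr_ge0 f0 j0.
have h2 := mulr_ge0 h1 l4; have := mulr_ge0 h1 (ltac:(lra) : 0 <= c - 1).
nra.
Qed.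

Lemma lnk_potential_integrable f x : tame f -> integrable (fun y => lnk (psub x y) * f y).
Proof.
move=> tf; have [mf _ _] := tf.
apply: (@integrable_dom _ (plane R) R mu _ (dom f (lnj x + 1 + ln 4) x)).
- apply: measurable_funM => //.
  exact: measurableT_comp (@lnk_measurable R) (psub_measurable1 x).
- move=> y; have := @lnk_dom f (lnj x + 1) x y (lnj x); rewrite subrK; apply.
  by rewrite ger0_norm ?lnj_ge0// addrK.
- exact: dom_integrable.
Qed.

(** As the total mass is zero, [ln |x - y|] may be replaced by [ln |x - y| - ln <x>],
    which is bounded in [x] up to [ln <y>] and a local singularity. *)
Lemma lnk_potential_bounded f : tame f -> \int[mu]_y f y = 0 -> exists C, forall x, `|potential (@lnk R) f x| <= C.
Proof.
move=> tf f0; have [C [C0 HC]] := dom_bound tf.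
have l4 : 0 <= ln 4 :> R by rewrite ln_ge0// ler1n.
have If := tame_integrable tf.
exists (C * (1 + (1 + ln 4))) => x.
have -> : potential (@lnk R) f x = \int[mu]_y ((lnk (psub x y) - lnj x + 0) * f y).
  transitivity (\int[mu]_y (lnk (psub x y) * f y) - lnj x * \int[mu]_y f y).
    by rewrite f0 mulr0 subr0.
  rewrite -RintegralZl// -RintegralB//; [|exact: lnk_potential_integrable|exact: integrable_scale].
  by apply: eq_Rintegral => y _; rewrite addr0 mulrBl.
have I : integrable (fun y => (lnk (psub x y) - lnj x + 0) * f y).
  apply: (@eq_integrable _ (plane R) R mu _ measurableT (EFin \o (fun y => lnk (psub x y) * f y - lnj x * f y))).
    by move=> y _ /=; rewrite addr0 mulrBl.
  by apply: integrable_subr; [exact: lnk_potential_integrable|exact: integrable_scale].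
apply: (@le_trans _ _ (\int[mu]_y dom f (1 + ln 4) x y)); last by apply: HC; lra.
apply: le_trans (le_normr_Rintegral measurableT I) _.
apply: le_Rintegral => //.
- exact: integrable_norm I.
- exact: dom_integrable.
- by move=> y _; apply: lnk_dom; rewrite normr0 subrr.
Qed.

End Tame.

(** * Fubini's theorem for kernels against tame densities *)

Section KernelProducts.
Variable R : realType.
Local Notation leb := (@lebesgue_measure R).
Local Notation mu := (leb2 R).
Implicit Types (x y z : R * R) (f k chi : R * R -> R).
Local Notation integrable f := (mu.-integrable [set: plane R] (EFin \o f)).

Lemma lnj_box (M : R) x : box M x -> lnj x <= ln (1 + M + M).
Proof.
move=> /boxE[x1 x2]; have M0 : 0 <= M := le_trans (normr_ge0 _) x1.
rewrite /lnj ler_ln ?posrE ?(lt_le_trans _ (jbracket_ge1 x))//; last by lra.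
have s0 : 0 <= 1 + M + M by lra.
rewrite jbracketE -(ger0_norm s0) -sqrtr_sqr ler_wsqrtr//.
rewrite /nsq -(real_normK (num_real x.1)) -(real_normK (num_real x.2)).
have := normr_ge0 x.1; have := normr_ge0 x.2; nra.
Qed.

(** Tonelli's theorem, integrating in [x] first: over the bounded box that carries
    [chi], the kernel has an integral which grows at most like [1 + ln <y>]. *)
Lemma kernel_product_integrable k f chi (c D M : R) :
  measurable_fun [set: plane R] k -> tame f ->
  measurable_fun [set: plane R] chi ->
  (forall x y, `|k (psub x y)| <= c * ((1 + lnj x) * (1 + lnj y) + kap (psub x y) ^+ 3)) ->
  (forall x, `|chi x| <= D) -> (forall x, ~ box M x -> chi x = 0) ->
  (leb2 R \x leb2 R)%E.-integrable [set: plane R * plane R]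
    (EFin \o (fun p => k (psub p.1 p.2) * f p.2 * chi p.1)).
Proof.
move=> mk tf mchi hk hD hM; have [mf If _] := tf.
have D0 : 0 <= D := le_trans (normr_ge0 _) (hD (0, 0)).
have c0 : 0 <= c.
  have := hk (0, 0) (0, 0); rewrite -(pmulr_lge0 (x := (1 + lnj (0, 0)) * (1 + lnj (0, 0)) + kap (psub (0, 0) (0, 0)) ^+ 3)).
    by apply: le_trans.
  by rewrite ltr_pwDl// ?exprn_ge0 ?kap_ge0// mulr_gt0// ltr_pwDl// lnj_ge0.
pose L := 1 + `|ln (1 + M + M)|.
pose V := fine (mu (box M)).
have VE : mu (box M) = V%:E by rewrite fineK// ge0_fin_numE// box_finite.
apply: tonelli_integrable2.
  apply: measurable_funM; last exact: measurableT_comp mchi measurable_fst.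
  apply: measurable_funM; last exact: measurableT_comp mf measurable_snd.
  exact: measurableT_comp mk (@psub_measurable R).
pose G y := c * D * L * V * (`|f y| * (1 + lnj y)) + c * D * 36 * `|f y|.
have IG : integrable G.
  apply: integrable_addr; first exact: integrable_scale.
  by apply: integrable_scale; exact: integrable_norm (tame_integrable tf).
apply: (@le_lt_trans _ _ (\int[mu]_y (G y)%:E)%E); last first.
  apply: integrable_ltoo => // y; rewrite /G.
  have f0 := normr_ge0 (f y); have j0 := lnj_ge0 y; have V0 : 0 <= V by rewrite fine_ge0.
  by rewrite addr_ge0// !mulr_ge0// addr_ge0.
have mF : measurable_fun [set: plane R * plane R] (fun p : plane R * plane R => `|k (psub p.1 p.2) * f p.2 * chi p.1|).
  apply: measurableT_comp => //.
  apply: measurable_funM; last exact: measurableT_comp mchi measurable_fst.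
  apply: measurable_funM; last exact: measurableT_comp mf measurable_snd.
  exact: measurableT_comp mk (@psub_measurable R).
apply: ge0_le_integral => //.
- by move=> y _; apply: integral_ge0 => x _; rewrite lee_fin.
- apply: (measurable_fun_fubini_tonelli_G (fun p : plane R * plane R => (`|k (psub p.1 p.2) * f p.2 * chi p.1|)%:E)) => //.
  exact/measurable_EFinP.
- by apply/measurable_EFinP; exact: integrable_measurable IG.
move=> y _.
pose q x := (`|f y| * (c * D)) * (L * (1 + lnj y) * \1_(box M) x + kap (psub x y) ^+ 4).
have f0 := normr_ge0 (f y); have j0 := lnj_ge0 y.
have L1 : 1 <= L by rewrite lerDl.
have mi : measurable_fun [set: plane R] (\1_(box M) : plane R -> R).
  exact: measurable_indic (box_measurable M).
have mk4 : measurable_fun [set: plane R] (fun x => kap (psub x y) ^+ 4).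
  exact: kapX_measurable2.
apply: (@le_trans _ _ (\int[mu]_x (q x)%:E)%E).
  apply: ge0_le_integral => //.
  - by apply/measurable_EFinP; exact: measurableT_comp mF (pair2_measurable (y : plane R)).
  - apply/measurable_EFinP; apply: measurable_funM => //.
    by apply: measurable_funD => //; exact: measurable_funM.
  move=> x _; rewrite lee_fin /q /=.
  rewrite (_ : `|k (psub x y) * f y * chi x| = `|f y| * (`|k (psub x y)| * `|chi x|)); last first.
    by rewrite !normrM [`|k _| * `|f y|]mulrC mulrA.
  rewrite -mulrA ler_wpM2l//.
  have [xM|xM] := pselect (box M x); last first.
    rewrite (hM _ xM) normr0 mulr0 !mulr_ge0// addr_ge0 ?exprn_ge0 ?kap_ge0//.
    by rewrite !mulr_ge0// ?addr_ge0// ?(le_trans ler01 L1)// indicE.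
  rewrite (mulrC c D) -[leRHS]mulrA [leLHS]mulrC; apply: ler_pM => //.
  rewrite indicE mem_set// mulr1.
  have k34 := @kap_exp_le _ 3 4 (psub x y) isT isT.
  apply: le_trans (hk x y) _; rewrite ler_wpM2l//; apply: lerD => //.
  rewrite ler_wpM2r ?addr_ge0// lerD2l.
  by apply: le_trans (lnj_box xM) _; rewrite ler_norm.
rewrite /q; under eq_integral do rewrite EFinM.
rewrite ge0_integralZl//; last 3 first.
- by apply/measurable_EFinP; apply: measurable_funD => //; exact: measurable_funM.
- move=> x _; rewrite lee_fin addr_ge0 ?exprn_ge0 ?kap_ge0// !mulr_ge0// ?addr_ge0// ?(le_trans ler01 L1)//.
- by rewrite lee_fin !mulr_ge0.
under eq_integral do rewrite EFinD.
rewrite ge0_integralD//; last 4 first.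
- by move=> x _; rewrite lee_fin !mulr_ge0// ?addr_ge0// ?(le_trans ler01 L1).
- by apply/measurable_EFinP; exact: measurable_funM.
- by move=> x _; rewrite lee_fin exprn_ge0// kap_ge0.
- exact/measurable_EFinP.
under eq_integral do rewrite EFinM.
rewrite ge0_integralZl//; last 2 first.
- exact/measurable_EFinP.
- by rewrite lee_fin !mulr_ge0// ?addr_ge0// ?(le_trans ler01 L1).
have VI : (\int[mu]_x (\1_(box M) x)%:E = V%:E)%E.
  by rewrite integral_indic ?setIT//; exact: box_measurable.
rewrite [X in (_ * (_ * X + _))%E]VI.
apply: (@le_trans _ _ ((`|f y| * (c * D))%:E * ((L * (1 + lnj y))%:E * V%:E + 36%:E))%E).
  apply: lee_wpmul2l; first by rewrite lee_fin !mulr_ge0.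
  by apply: leeD2l; exact: kap_integral'.
have -> : ((L * (1 + lnj y))%:E * V%:E + 36%:E = (L * (1 + lnj y) * V + 36)%:E)%E by [].
by rewrite -EFinM lee_fin /G le_eqVlt; apply/orP; left; apply/eqP; ring.
Qed.

Lemma lnk_kernel x y : `|lnk (psub x y)| <= (4 + ln 4) * ((1 + lnj x) * (1 + lnj y) + kap (psub x y) ^+ 3).
Proof.
have h := lnk_lnj x y; have k13 := @kap_exp_le _ 1 3 (psub x y) isT isT.
have jx := lnj_ge0 x; have jy := lnj_ge0 y; have k0 := kap_ge0 (psub x y).
have l4 : 0 <= ln 4 :> R by rewrite ln_ge0// ler1n.
have {}h : `|lnk (psub x y)| <= lnj x + (ln 4 + lnj y + 3 * kap (psub x y)).
  rewrite -[X in `|X|](subrK (lnj x)) addrC (le_trans (ler_normD _ _))//.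
  by rewrite (ger0_norm jx) lerD2l.
apply: le_trans h _; rewrite expr1 in k13.
have := mulr_ge0 jx jy; have := mulr_ge0 l4 jx; have := mulr_ge0 l4 jy.
have := mulr_ge0 l4 (mulr_ge0 jx jy); have := mulr_ge0 l4 (exprn_ge0 3 k0); have := exprn_ge0 3 k0.
nra.
Qed.

Lemma riesz_kernel z : (enorm z)^-1 <= 1 + kap z ^+ 3.
Proof.
rewrite kap_cube; case: ltP => [_|z1]; first by rewrite lerDr.
by rewrite addr0 invf_le1// (lt_le_trans _ z1).
Qed.

End KernelProducts.

(** * Bootstrap for the Riesz potential *)

Section Bootstrap.
Variable R : realType.
Local Notation mu := (leb2 R).
Implicit Types (x y z : R * R).
Local Notation integrable f := (mu.-integrable [set: plane R] (EFin \o f)).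
Variables (F : R * R -> R) (A : R).
Hypotheses (mF : measurable_fun [set: plane R] F) (F0 : forall y, 0 <= F y)
  (F2 : integrable (fun y => F y ^+ 2)) (A0 : 0 <= A).

Let w y z := kap (psub y z).

Let mw : measurable_fun [set: plane R * plane R] (fun p : plane R * plane R => w p.1 p.2).
Proof. exact: measurableT_comp (@kap_measurable R) (@psub_measurable R). Qed.

Let mF2 : measurable_fun [set: plane R * plane R] (fun p : plane R * plane R => F p.2).
Proof. exact: measurableT_comp mF measurable_snd. Qed.

Let B := fine (\int[mu]_y (F y ^+ 2)%:E)%E.

Let BE : (\int[mu]_y (F y ^+ 2)%:E = B%:E)%E.
Proof. by rewrite fineK//; have := integrable_fin_num measurableT F2. Qed.

Let B0 : 0 <= B.
Proof. by rewrite fine_ge0//; apply: integral_ge0 => y _; rewrite lee_fin sqr_ge0. Qed.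

(** Writing [a], [b], [c] for the values of [g], of the kernel and of [F],
    [a^3 b^3 c <= a^4 b^4 + a^4 c^2 + b^4 c^2], and Tonelli's theorem bounds the
    double integral of each term. *)
Lemma young3 (g : R * R -> R) : measurable_fun [set: plane R] g -> (forall y, 0 <= g y) ->
  (\int[mu]_y (g y ^+ 4)%:E <= 36%:E)%E ->
  (\int[mu]_y ((g y ^+ 3)%:E * \int[mu]_z (w y z ^+ 3 * F z)%:E) <= (36 * 36 + 36 * B + 36 * B)%:E)%E.
Proof.
move=> mg g0 g36.
have mg2 : measurable_fun [set: plane R * plane R] (fun p : plane R * plane R => g p.1).
  exact: measurableT_comp mg measurable_fst.
have w0 y z : 0 <= w y z by exact: kap_ge0.
pose H1 (p : plane R * plane R) := g p.1 ^+ 4 * w p.1 p.2 ^+ 4.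
pose H2 (p : plane R * plane R) := g p.1 ^+ 4 * F p.2 ^+ 2.
pose H3 (p : plane R * plane R) := w p.1 p.2 ^+ 4 * F p.2 ^+ 2.
have mH1 : measurable_fun [set: plane R * plane R] H1.
  by apply: measurable_funM; exact: measurable_funX.
have mH2 : measurable_fun [set: plane R * plane R] H2.
  by apply: measurable_funM; exact: measurable_funX.
have mH3 : measurable_fun [set: plane R * plane R] H3.
  by apply: measurable_funM; exact: measurable_funX.
have H10 p : 0 <= H1 p by rewrite mulr_ge0// exprn_ge0.
have H20 p : 0 <= H2 p by rewrite mulr_ge0// exprn_ge0.
have H30 p : 0 <= H3 p by rewrite mulr_ge0// exprn_ge0.
have mg4 : measurable_fun [set: plane R] (fun y => g y ^+ 4) by exact: measurable_funX.
have mFF : measurable_fun [set: plane R] (fun y => F y ^+ 2) by exact: measurable_funX.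
have mw1 y : measurable_fun [set: plane R] (fun z => w y z ^+ 4).
  exact: kapX_measurable1.
have mw2 z : measurable_fun [set: plane R] (fun y => w y z ^+ 4).
  exact: kapX_measurable2.
have mI (H : plane R * plane R -> R) : measurable_fun setT H -> (forall p, 0 <= H p) ->
    measurable_fun [set: plane R] (fun y => \int[mu]_z (H (y, z))%:E)%E.
  move=> mH H0; apply: (measurable_fun_fubini_tonelli_F (EFin \o H)) => //=.
  exact/measurable_EFinP.
have I0 (H : plane R * plane R -> R) y : (forall p, 0 <= H p) -> (0 <= \int[mu]_z (H (y, z))%:E)%E.
  by move=> H0; apply: integral_ge0 => z _; rewrite lee_fin.
have b1 : (\int[mu]_y \int[mu]_z (H1 (y, z))%:E <= (36 * 36)%:E)%E.
  apply: (@le_trans _ _ (\int[mu]_y ((g y ^+ 4)%:E * 36%:E))%E).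
    apply: ge0_le_integral => //.
    - by move=> y _; exact: I0.
    - exact: mI.
    - by apply: emeasurable_funM => //; exact/measurable_EFinP.
    move=> y _; rewrite /H1 /=; under eq_integral do rewrite EFinM.
    rewrite ge0_integralZl//; last 3 first.
    - exact/measurable_EFinP.
    - by move=> z _; rewrite lee_fin exprn_ge0.
    - by rewrite lee_fin exprn_ge0.
    by apply: lee_wpmul2l; [rewrite lee_fin exprn_ge0|exact: kap_integral].
  rewrite ge0_integralZr//; last 2 first.
  - exact/measurable_EFinP.
  - by move=> y _; rewrite lee_fin exprn_ge0.
  by rewrite EFinM; apply: lee_wpmul2r.
have b2 : (\int[mu]_y \int[mu]_z (H2 (y, z))%:E <= (36 * B)%:E)%E.
  have -> : (\int[mu]_y \int[mu]_z (H2 (y, z))%:E = \int[mu]_y ((g y ^+ 4)%:E * B%:E))%E.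
    apply: eq_integral => y _; rewrite /H2 /=; under eq_integral do rewrite EFinM.
    rewrite ge0_integralZl//; last 3 first.
    - exact/measurable_EFinP.
    - by move=> z _; rewrite lee_fin sqr_ge0.
    - by rewrite lee_fin exprn_ge0.
    by congr (_ * _)%E; exact: BE.
  rewrite ge0_integralZr//; last 2 first.
  - exact/measurable_EFinP.
  - by move=> y _; rewrite lee_fin exprn_ge0.
  by rewrite EFinM; apply: lee_wpmul2r; rewrite ?lee_fin.
have b3 : (\int[mu]_y \int[mu]_z (H3 (y, z))%:E <= (36 * B)%:E)%E.
  have -> : (\int[mu]_y \int[mu]_z (H3 (y, z))%:E = \int[mu]_z \int[mu]_y (H3 (y, z))%:E)%E.
    apply: (@fubini_tonelli _ _ (plane R) (plane R) R (leb2 R) (leb2 R) (EFin \o H3)) => //=.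
    exact/measurable_EFinP.
  apply: (@le_trans _ _ (\int[mu]_z (36%:E * (F z ^+ 2)%:E))%E).
    apply: ge0_le_integral => //.
    - by move=> z _; apply: integral_ge0 => y _; rewrite lee_fin.
    - apply: (measurable_fun_fubini_tonelli_G (EFin \o H3)) => //=.
      exact/measurable_EFinP.
    - by apply: emeasurable_funM => //; exact/measurable_EFinP.
    move=> z _; rewrite /H3 /=; under eq_integral do rewrite EFinM.
    rewrite ge0_integralZr//; last 3 first.
    - exact/measurable_EFinP.
    - by move=> y _; rewrite lee_fin exprn_ge0.
    - by rewrite lee_fin sqr_ge0.
    by apply: lee_wpmul2r; [rewrite lee_fin sqr_ge0|exact: kap_integral'].
  rewrite ge0_integralZl//; last 2 first.
  - exact/measurable_EFinP.
  - by move=> y _; rewrite lee_fin sqr_ge0.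
  by rewrite EFinM; apply: lee_wpmul2l => //; rewrite BE.
apply: (@le_trans _ _ (\int[mu]_y (\int[mu]_z (H1 (y, z))%:E + \int[mu]_z (H2 (y, z))%:E + \int[mu]_z (H3 (y, z))%:E))%E).
  have mw3F : measurable_fun [set: plane R * plane R] (fun p : plane R * plane R => w p.1 p.2 ^+ 3 * F p.2).
    by apply: measurable_funM => //; exact: measurable_funX.
  apply: ge0_le_integral => //.
  - move=> y _; apply: mule_ge0; first by rewrite lee_fin exprn_ge0.
    by apply: integral_ge0 => z _; rewrite lee_fin mulr_ge0// exprn_ge0.
  - apply: emeasurable_funM; first by apply/measurable_EFinP; exact: measurable_funX.
    apply: (mI (fun p => w p.1 p.2 ^+ 3 * F p.2)) => // p.
    by rewrite mulr_ge0// exprn_ge0.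
  - by apply: emeasurable_funD; [apply: emeasurable_funD|]; exact: mI.
  move=> y _.
  have mHy (H : plane R * plane R -> R) : measurable_fun setT H ->
    measurable_fun [set: plane R] (fun z => H (y, z)).
    by move=> mH; exact: measurableT_comp mH (pair1_measurable (y : plane R)).
  rewrite -ge0_integralZl//; last 3 first.
  - by apply/measurable_EFinP; exact: (mHy (fun p => w p.1 p.2 ^+ 3 * F p.2)).
  - by move=> z _; rewrite lee_fin mulr_ge0// exprn_ge0.
  - by rewrite lee_fin exprn_ge0.
  rewrite -ge0_integralD//; try (by move=> z _; rewrite lee_fin); try (by apply/measurable_EFinP; exact: mHy).
  rewrite -ge0_integralD//; last 4 first.
  - by move=> z _; rewrite adde_ge0 ?lee_fin.
  - by apply: emeasurable_funD; apply/measurable_EFinP; exact: mHy.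
  - by move=> z _; rewrite lee_fin.
  - by apply/measurable_EFinP; exact: mHy.
  apply: ge0_le_integral => //.
  - by move=> z _; rewrite -EFinM lee_fin !mulr_ge0// ?exprn_ge0.
  - apply: emeasurable_funM => //.
    by apply/measurable_EFinP; exact: (mHy (fun p => w p.1 p.2 ^+ 3 * F p.2)).
  - by do 2?apply: emeasurable_funD; apply/measurable_EFinP; exact: mHy.
  move=> z _; rewrite -EFinM -!EFinD lee_fin /H1 /H2 /H3 /=.
  have gg := g0 y; have ww := w0 y z; have ff := F0 z.
  move: (g y) (w y z) (F z) gg ww ff => a b c a0 b0 c0.
  have h1 := sqr_ge0 (a ^+ 2 * b ^+ 2 - a * b * c).
  have h3 : 0 <= c ^+ 2 * (a ^+ 2 - b ^+ 2) ^+ 2 by rewrite mulr_ge0// sqr_ge0.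
  have h4 : 0 <= a ^+ 4 * b ^+ 4 by rewrite mulr_ge0// exprn_ge0.
  have h5 : 0 <= a ^+ 4 * c ^+ 2 by rewrite mulr_ge0// exprn_ge0.
  have h6 : 0 <= b ^+ 4 * c ^+ 2 by rewrite mulr_ge0// exprn_ge0.
  lra.
rewrite ge0_integralD//; last 4 first.
- by move=> y _; rewrite adde_ge0// I0.
- by apply: emeasurable_funD; exact: mI.
- by move=> y _; exact: I0.
- exact: mI.
rewrite ge0_integralD//; [|by move=> y _; exact: I0|exact: mI|by move=> y _; exact: I0|exact: mI].
by rewrite !EFinD; apply: leeD => //; apply: leeD.
Qed.

Hypothesis hF : {ae mu, forall y,
  ((F y)%:E <= A%:E + A%:E * \int[mu]_z (w y z ^+ 3 * F z)%:E)%E}.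

(** Inserting the pointwise bound once gives the convolution of two truncated Riesz
    kernels with [F], which [young3] bounds uniformly. *)
Lemma riesz_bootstrap : exists C, forall x, (\int[mu]_y (w x y ^+ 3 * F y)%:E <= C%:E)%E.
Proof.
exists (A * 36 + A * (36 * 36 + 36 * B + 36 * B)) => x.
have mk : measurable_fun [set: plane R] (w x).
  exact: measurableT_comp (@kap_measurable R) (psub_measurable1 x).
have mk3 : measurable_fun [set: plane R] (fun y => w x y ^+ 3) by exact: measurable_funX.
have w0 y z : 0 <= w y z by exact: kap_ge0.
pose J y := (\int[mu]_z (w y z ^+ 3 * F z)%:E)%E.
have J0 y : (0 <= J y)%E by apply: integral_ge0 => z _; rewrite lee_fin mulr_ge0// exprn_ge0.
have mJ : measurable_fun [set: plane R] J.
  apply: (measurable_fun_fubini_tonelli_F (fun p : plane R * plane R => (w p.1 p.2 ^+ 3 * F p.2)%:E)).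
    by apply/measurable_EFinP; apply: measurable_funM => //; exact: measurable_funX.
  by move=> p; rewrite lee_fin mulr_ge0// exprn_ge0.
apply: (@le_trans _ _ (\int[mu]_y (A%:E * (w x y ^+ 3)%:E + A%:E * ((w x y ^+ 3)%:E * J y)))%E).
  have bound : {ae mu, forall y : plane R, setT y ->
      ((w x y ^+ 3 * F y)%:E <= A%:E * (w x y ^+ 3)%:E + A%:E * ((w x y ^+ 3)%:E * J y))%E}.
    apply: filterS hF => y hy _.
    rewrite EFinM; apply: le_trans (lee_wpmul2l _ hy) _; first by rewrite lee_fin exprn_ge0.
    rewrite -/(J y) ge0_muleDr ?lee_fin//; last by rewrite mule_ge0 ?lee_fin.
    by rewrite [X in (X + _ <= _)%E]muleC muleCA.
  apply: ae_ge0_le_integral => //.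
  - by move=> y _; rewrite lee_fin mulr_ge0// exprn_ge0.
  - by apply/measurable_EFinP; apply: measurable_funM.
  - by move=> y _; rewrite adde_ge0// !mule_ge0// lee_fin// exprn_ge0.
  - apply: emeasurable_funD; apply: emeasurable_funM => //; first exact/measurable_EFinP.
    by apply: emeasurable_funM => //; exact/measurable_EFinP.
rewrite ge0_integralD//; last 4 first.
- by move=> y _; rewrite mule_ge0// lee_fin// exprn_ge0.
- by apply: emeasurable_funM => //; exact/measurable_EFinP.
- by move=> y _; rewrite !mule_ge0// lee_fin// exprn_ge0.
- by apply: emeasurable_funM => //; apply: emeasurable_funM => //; exact/measurable_EFinP.
rewrite ge0_integralZl//; last 2 first.
- exact/measurable_EFinP.
- by move=> y _; rewrite lee_fin exprn_ge0.
rewrite ge0_integralZl//; last 2 first.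
- by apply: emeasurable_funM => //; exact/measurable_EFinP.
- by move=> y _; rewrite mule_ge0// lee_fin// exprn_ge0.
rewrite EFinD !EFinM; apply: leeD; apply: lee_wpmul2l; rewrite ?lee_fin//.
  apply: le_trans (kap_integral x); apply: ge0_le_integral => //.
  - by move=> y _; rewrite lee_fin exprn_ge0.
  - exact/measurable_EFinP.
  - by apply/measurable_EFinP; exact: measurable_funX.
  - by move=> y _; rewrite lee_fin; exact: kap_exp_le.
apply: young3 => //; exact: kap_integral.
Qed.

End Bootstrap.

(** * Integration by parts in the plane *)

#[export] Instance nbhs_ae_lebesgue_filter (R : realType) :
  Filter (nbhs (almost_everywhere (@lebesgue_measure R))).
Proof. exact: ae_filter_ringOfSetsType. Qed.

Section TestFunctionFacts.
Variable R : realType.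
Local Notation mu := (leb2 R).
Implicit Types (x y z : R * R) (chi : R * R -> R) (k : 'I_2).

Lemma test_derivable chi k x : test_function chi -> is_derive x (evec R k) chi (dpartial k chi x).
Proof.
move=> [/(_ 1%N)/= [_ /(_ k)[+ _]] _] => /(_ x) d.
exact: derivableP.
Qed.

Lemma test_continuous chi : test_function chi -> continuous chi.
Proof. by move=> [/(_ 0%N)[]]. Qed.

Lemma dpartial_continuous chi k : test_function chi -> continuous (dpartial k chi).
Proof. by move=> [/(_ 1%N)/= [_ /(_ k)[_ []]]]. Qed.

Lemma dpartial_eq0 chi k (K : set (R * R)) x : closed K ->
  (forall z, ~ K z -> chi z = 0) -> ~ K x -> dpartial k chi x = 0.
Proof.
move=> cK K0 Kx; rewrite /dpartial.
have nK : \forall z \near x, chi z = cst 0 z.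
  have oK : open (~` K) by exact: closed_openC.
  have : nbhs x (~` K) by apply: open_nbhs_nbhs.
  by apply: filterS => z /K0.
by rewrite (near_eq_derive _ nK) derive_cst.
Qed.

Lemma continuous_bounded_box (f : R * R -> R) M : continuous f ->
  (forall x, ~ box M x -> f x = 0) -> exists D, forall x, `|f x| <= D.
Proof.
move=> cf f0.
have := continuous_compact (continuous_subspaceT cf) (@box_compact R M).
move=> /compact_bounded[D [_ HD]].
exists (`|D| + 1) => x; have [xM|/f0 ->] := pselect (box M x); last by rewrite normr0.
apply: HD; first by rewrite (le_lt_trans (ler_norm _))// ltrDl.
by exists x.
Qed.

Lemma test_bounds chi : test_function chi -> exists M D, [/\
  forall x, ~ box M x -> chi x = 0, forall k x, ~ box M x -> dpartial k chi x = 0,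
  forall x, `|chi x| <= D & forall k x, `|dpartial k chi x| <= D].
Proof.
move=> tchi; have [_ /compact_sub_box[M M0 sM]] := tchi.
have c0 x : ~ box M x -> chi x = 0.
  move=> bx; apply: contra_notP bx => /eqP chx; apply: sM.
  exact: subset_closure.
have cb : closed (box M : set (R * R)).
  by apply: compact_closed (@box_compact R M); exact: norm_hausdorff.
have d0 k x : ~ box M x -> dpartial k chi x = 0 by exact: dpartial_eq0 c0.
have [D HD] := continuous_bounded_box (test_continuous tchi) c0.
have [D0 HD0] := continuous_bounded_box (dpartial_continuous (k := 0) tchi) (d0 0).
have [D1 HD1] := continuous_bounded_box (dpartial_continuous (k := 1) tchi) (d0 1).
have Dn := le_trans (normr_ge0 _) (HD (0, 0)).
have D0n := le_trans (normr_ge0 _) (HD0 (0, 0)).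
have D1n := le_trans (normr_ge0 _) (HD1 (0, 0)).
exists M, (D + D0 + D1); split => // [x|k x].
  by apply: le_trans (HD x) _; lra.
case: (ord2P k) => ->.
- by apply: le_trans (HD0 x) _; lra.
- by apply: le_trans (HD1 x) _; lra.
Qed.

End TestFunctionFacts.

Section IntegrationByParts.
Variable R : realType.
Local Notation leb := (@lebesgue_measure R).
Local Notation mu := (leb2 R).

(** Outside a bounded interval the integrand vanishes; inside, it is the derivative of
    [F * g], which vanishes at both ends. *)
Lemma line_ibp (F G g dg : R -> R) (M : R) :
  (forall s, is_derive s (1 : R) F (G s)) -> continuous G ->
  (forall s, is_derive s (1 : R) g (dg s)) -> continuous dg ->
  (forall s, M < `|s| -> g s = 0) -> (forall s, M < `|s| -> dg s = 0) ->
  \int[leb]_s (F s * dg s + G s * g s) = 0.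
Proof.
move=> dF cG dg' cdg g0 dg0.
pose N := `|M| + 1; have MN : M < N by rewrite (le_lt_trans (ler_norm _))// ltrDl.
have N0 : 0 < N by rewrite ltr_wpDl.
pose h s := F s * dg s + G s * g s.
have cF : continuous F by move=> s; exact: is_derive1_continuous (dF s).
have cg : continuous g by move=> s; exact: is_derive1_continuous (dg' s).
have ch : continuous h.
  by move=> s; apply: cvgD; apply: cvgM; [exact: cF|exact: cdg|exact: cG|exact: cg].
have dP s : is_derive s (1 : R) (fun s => F s * g s) (h s).
  by apply: (is_derive_eq (is_derive1_mul (dF s) (dg' s))); rewrite /h [g s * _]mulrC.
have E : (\int[leb]_s (h s)%:E = \int[leb]_(s in `[(- N)%R, N]) (h s)%:E)%E.
  rewrite [RHS]integral_mkcond; apply: eq_integral => s _; rewrite patchE.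
  case: ifPn => //; rewrite notin_setE /= in_itv/= => /negP; rewrite -ler_norml -ltNge => sN.
  have Ms : M < `|s| by exact: lt_trans sN.
  by rewrite /h g0// dg0// !mulr0 addr0.
rewrite /Rintegral E (@continuous_FTC2 R h (fun s => F s * g s)).
- by rewrite !g0 ?mulr0 ?subee// ?normrN gtr0_norm.
- by rewrite (lt_trans _ N0)// oppr_lt0.
- exact: continuous_subspaceT.
- split.
  + by move=> s _; have [] := dP s.
  + by apply: cvg_at_right_filter; exact: is_derive1_continuous (dP _).
  + by apply: cvg_at_left_filter; exact: is_derive1_continuous (dP _).
- by move=> s _; rewrite derive1E; have [] := dP s.
Qed.

Lemma upd0 (x : R * R) s : upd 0 x s = (s, x.2). Proof. by []. Qed.
Lemma upd1 (x : R * R) s : upd 1 x s = (x.1, s). Proof. by []. Qed.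

Lemma upd_continuous k (x : R * R) : continuous (fun s => upd k x s).
Proof.
move=> s; rewrite /upd; case: (k == 0) => A [[P Q] /= [nP nQ] PQ].
  have Px2 : Q x.2 by exact: nbhs_singleton.
  by apply: filterS nP => t Pt; exact: PQ.
have Px1 : P x.1 by exact: nbhs_singleton.
by apply: filterS nQ => t Qt; exact: PQ.
Qed.

(** Fubini's theorem and integration by parts on the lines parallel to an axis. A
    singularity of [F] at the point [c] spoils a single line, which has measure zero. *)
Lemma plane_ibp k (F G chi : R * R -> R) (c : R * R) : test_function chi ->
  mu.-integrable [set: plane R] (EFin \o (fun x => F x * dpartial k chi x)) ->
  mu.-integrable [set: plane R] (EFin \o (fun x => G x * chi x)) ->
  (forall x, (forall s, upd k x s != c) ->
     (forall s, is_derive s (1 : R) (fun s => F (upd k x s)) (G (upd k x s))) /\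
     continuous (fun s => G (upd k x s))) ->
  \int[mu]_x (F x * dpartial k chi x) = - \int[mu]_x (G x * chi x).
Proof.
move=> tchi I1 I2 H.
have [M [D [c0 d0 _ _]]] := test_bounds tchi.
have I := integrable_addr I1 I2.
suff : \int[mu]_x (F x * dpartial k chi x + G x * chi x) = 0.
  by rewrite RintegralD// => /eqP; rewrite addr_eq0 => /eqP.
have line x : (forall s, upd k x s != c) ->
    \int[leb]_s (F (upd k x s) * dpartial k chi (upd k x s) + G (upd k x s) * chi (upd k x s)) = 0.
  move=> xc; have [dF cG] := H x xc.
  have off s : M < `|s| -> ~ box M (upd k x s).
    move=> Ms /boxE[]; rewrite /upd; case: (k == 0) => /=.
      by move=> + _; rewrite leNgt Ms.
    by move=> _; rewrite leNgt Ms.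
  apply: (@line_ibp (fun s => F (upd k x s)) (fun s => G (upd k x s))
           (fun s => chi (upd k x s)) (fun s => dpartial k chi (upd k x s)) M) => //.
  - by move=> s; apply/is_derive_upd; exact: test_derivable.
  - move=> s; apply: (@continuous_comp _ _ _ (fun s => upd k x s)); first exact: upd_continuous.
    exact: dpartial_continuous.
  - by move=> s /off; exact: c0.
  - by move=> s /off; exact: d0.
have ae1 (a : R) : {ae leb, forall t, t != a}.
  exists [set a]; split => //; first exact: lebesgue_measure_set1.
  by move=> t /= /negP; rewrite negbK => /eqP.
case: (ord2P k) => [k0|k1].
- rewrite k0 in I line *.
  rewrite (@fubini_prod2 _ _ (measurableTypeR R) (measurableTypeR R) R leb leb
    (fun x => F x * dpartial 0 chi x + G x * chi x) I).
  rewrite (@ae_eq_Rintegral _ (measurableTypeR R) R leb _ (cst 0)).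
  + by rewrite /Rintegral integral0.
  + exact: (@fubini_measurable2 _ _ (measurableTypeR R) (measurableTypeR R) R leb leb _ I).
  + exact: measurable_cst.
  + apply: filterS (ae1 c.2) => t tc.
    apply: (line (0, t)) => s; rewrite upd0 /=.
    by apply: contra tc => /eqP <-.
- rewrite k1 in I line *.
  rewrite (@fubini_prod1 _ _ (measurableTypeR R) (measurableTypeR R) R leb leb
    (fun x => F x * dpartial 1 chi x + G x * chi x) I).
  rewrite (@ae_eq_Rintegral _ (measurableTypeR R) R leb _ (cst 0)).
  + by rewrite /Rintegral integral0.
  + exact: (@fubini_measurable1 _ _ (measurableTypeR R) (measurableTypeR R) R leb leb _ I).
  + exact: measurable_cst.
  + apply: filterS (ae1 c.1) => t tc.
    apply: (line (t, 0)) => s; rewrite upd1 /=.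
    by apply: contra tc => /eqP <-.
Qed.

End IntegrationByParts.

(** * The gradient of the logarithm *)

Section GradientKernel.
Variable R : realType.
Local Notation leb := (@lebesgue_measure R).
Local Notation mu := (leb2 R).
Implicit Types (x y z : R * R) (chi : R * R -> R) (j k : 'I_2).
Local Notation integrable f := (mu.-integrable [set: plane R] (EFin \o f)).

Lemma coord_measurable k : measurable_fun [set: plane R] (@coord R k).
Proof. by rewrite /coord; case: (k == 0); [exact: measurable_fst2|exact: measurable_snd2]. Qed.

Lemma nsqE z : nsq z = coord 0 z ^+ 2 + coord 1 z ^+ 2.
Proof. by []. Qed.

Lemma coord_sqr_le k z : coord k z ^+ 2 <= nsq z.
Proof. by case: (ord2P k) => ->; rewrite nsqE ?lerDl ?lerDr sqr_ge0. Qed.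

Lemma coord_le k z : `|coord k z| <= enorm z.
Proof.
rewrite -(@ler_pXn2r _ 2) ?nnegrE ?enorm_ge0// real_normK ?num_real// enorm_sqr.
exact: coord_sqr_le.
Qed.

(** The gradient of [ln |z|]. *)
Definition rk k z : R := coord k z / nsq z.

(** The gradient of [ln (|z|^2 + d) / 2], a smooth regularization of [ln |z|]. *)
Definition rkd (d : R) k z : R := coord k z / (nsq z + d).

(** The second derivatives of [ln (|z|^2 + d) / 2]. *)
Definition drkd (d : R) j k z : R :=
  ((j == k)%:R * (nsq z + d) - 2 * coord j z * coord k z) / (nsq z + d) ^+ 2.

Lemma measurable_inv_ge0 (f : R * R -> R) : measurable_fun [set: plane R] f ->
  (forall z, 0 <= f z) -> measurable_fun [set: plane R] (fun z => (f z)^-1).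
Proof.
move=> mf f0; rewrite (_ : (fun z => _) = (fun z => f z `^ (- 1))); last first.
  by apply/funext => z; rewrite powR_inv1.
exact: (measurableT_comp (measurable_powR _)) mf.
Qed.

Lemma rk_measurable k : measurable_fun [set: plane R] (rk k).
Proof.
apply: measurable_funM; first exact: coord_measurable.
by apply: measurable_inv_ge0; [exact: nsq_measurable|exact: nsq_ge0].
Qed.

Lemma nsqd_measurable d : measurable_fun [set: plane R] (fun z => nsq z + d).
Proof. by apply: measurable_funD => //; exact: nsq_measurable. Qed.

Lemma nsqd_gt0 d z : 0 < d -> 0 < nsq z + d.
Proof. by move=> d0; rewrite ltr_wpDl// nsq_ge0. Qed.

Lemma rkd_measurable d k : 0 < d -> measurable_fun [set: plane R] (rkd d k).
Proof.
move=> d0; apply: measurable_funM; first exact: coord_measurable.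
apply: measurable_inv_ge0; first exact: nsqd_measurable.
by move=> z; rewrite ltW// nsqd_gt0.
Qed.

Lemma drkd_measurable d j k : measurable_fun [set: plane R] (drkd d j k).
Proof.
apply: measurable_funM.
  apply: measurable_funB; first by apply: measurable_funM => //; exact: nsqd_measurable.
  by apply: measurable_funM; [apply: measurable_funM => //|]; exact: coord_measurable.
apply: measurable_inv_ge0; last by move=> z; exact: sqr_ge0.
by apply: measurable_funX; exact: nsqd_measurable.
Qed.

Lemma rk_le k z : `|rk k z| <= (enorm z)^-1.
Proof.
rewrite /rk -enorm_sqr normrM.
have [->|z0] := eqVneq (enorm z) 0; first by rewrite expr0n/= invr0 normr0 mulr0.
have e0 : 0 < enorm z by rewrite lt_neqAle eq_sym z0 enorm_ge0.
rewrite normrV ?unitfE ?expf_neq0// (gtr0_norm (exprn_gt0 2 e0)) ler_pdivrMr ?exprn_gt0//.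
by rewrite expr2 mulKf// coord_le.
Qed.

Lemma rk_kap k z : `|rk k z| <= 1 + kap z ^+ 4.
Proof.
apply: le_trans (rk_le k z) _; apply: le_trans (riesz_kernel z) _.
by rewrite lerD2l kap_exp_le.
Qed.

Lemma rkd_le d k z : 0 < d -> `|rkd d k z| <= `|rk k z|.
Proof.
move=> d0; rewrite /rkd /rk !normrM.
have n0 := nsq_ge0 z; have nd := nsqd_gt0 z d0.
have [z0|z0] := eqVneq (nsq z) 0.
  have -> : coord k z = 0.
    by apply/eqP; rewrite -sqrf_eq0 eq_le sqr_ge0 andbT -z0 coord_sqr_le.
  by rewrite normr0 !mul0r.
have nz : 0 < nsq z by rewrite lt_neqAle eq_sym z0 n0.
rewrite ler_wpM2l// !normrV ?unitfE ?gt_eqF// !gtr0_norm// lef_pV2 ?posrE//.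
by rewrite lerDl ltW.
Qed.

(** For fixed [d] these derivatives are bounded, although not uniformly as [d] tends to
    zero; hence the regularization is only removed after an integration by parts. *)
Lemma drkd_le d j k z : 0 < d -> `|drkd d j k z| <= 3 / d.
Proof.
move=> d0; have nd := nsqd_gt0 z d0; have n0 := nsq_ge0 z.
rewrite /drkd normrM normrV ?unitfE ?expf_neq0 ?(gt_eqF nd)//.
rewrite (gtr0_norm (exprn_gt0 2 nd)) ler_pdivrMr ?exprn_gt0//.
apply: (@le_trans _ _ (3 * (nsq z + d))).
  apply: le_trans (ler_normB _ _) _; have n2 : `|2 : R| = 2 by rewrite ger0_norm.
  rewrite !normrM n2 (gtr0_norm nd).
  have h1 : `|coord j z| * `|coord k z| <= nsq z.
    rewrite -enorm_sqr expr2; apply: ler_pM => //; exact: coord_le.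
  have h2 : `|(j == k)%:R : R| * (nsq z + d) <= nsq z + d.
    by case: (j == k); rewrite ?normr1 ?mul1r// normr0 mul0r ltW.
  by rewrite -mulrA; lra.
rewrite expr2 mulrA ler_wpM2r ?(ltW nd)//.
by rewrite -mulrA ler_peMr// mulrC ler_pdivlMr// mul1r lerDr.
Qed.

Lemma drkd_sym d j k z : j != k -> drkd d j k z = drkd d k j z.
Proof.
by move=> jk; rewrite /drkd (negbTE jk) eq_sym (negbTE jk) [_ * coord j z * _]mulrAC.
Qed.

(** The Laplacian of the regularized logarithm. *)
Lemma drkd_trace d z : 0 < d ->
  drkd d 0 0 z + drkd d 1 1 z = 2 * d / (nsq z + d) ^+ 2.
Proof.
move=> d0; rewrite /drkd -mulrDl; congr (_ / _).
by rewrite /= nsqE; ring.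
Qed.

Lemma coord_psub k x y : coord k (psub x y) = coord k x - coord k y.
Proof. by rewrite /coord /psub; case: (k == 0). Qed.

Lemma is_derive_psub_coord j k x y s :
  is_derive s (1 : R) (fun s => coord j (psub (upd k x s) y)) ((j == k)%:R).
Proof.
have -> : (fun s => coord j (psub (upd k x s) y)) =
   (fun s => (if j == k then s else coord j x) + - coord j y).
  apply/funext => t; rewrite coord_psub; congr (_ - _).
  by case: (ord2P j) (ord2P k) => -> [] ->.
have -> : ((j == k)%:R = (if j == k then 1 else 0) + 0 :> R) by rewrite addr0; case: (j == k).
apply: (is_derive1_add _ (is_derive_cst (- coord j y) s 1)).
by case: (j == k); [exact: is_derive_id|exact: is_derive_cst].
Qed.

Lemma is_derive_psub_nsq k x y s :
  is_derive s (1 : R) (fun s => nsq (psub (upd k x s) y)) (2 * coord k (psub (upd k x s) y)).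
Proof.
have -> : (fun s => nsq (psub (upd k x s) y)) =
   (fun s => coord 0 (psub (upd k x s) y) * coord 0 (psub (upd k x s) y) +
             coord 1 (psub (upd k x s) y) * coord 1 (psub (upd k x s) y)).
  by apply/funext => t; rewrite nsqE !expr2.
have d0 := is_derive_psub_coord 0 k x y s; have d1 := is_derive_psub_coord 1 k x y s.
apply: (is_derive_eq (is_derive1_add (is_derive1_mul d0 d0) (is_derive1_mul d1 d1))).
by case: (ord2P k) => ->; rewrite /= ?mulr1 ?mulr0; ring.
Qed.

Lemma nsq_gt0_line k x y : (forall s, upd k x s != y) -> forall s, 0 < nsq (psub (upd k x s) y).
Proof.
move=> xy s; rewrite lt_neqAle nsq_ge0 andbT eq_sym; apply/eqP.
rewrite nsqE => /eqP; rewrite paddr_eq0 ?sqr_ge0// !sqrf_eq0 !coord_psub !subr_eq0 => /andP[/eqP h0 /eqP h1].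
have := xy s; rewrite (_ : upd k x s = y) ?eqxx//.
by move: h0 h1; rewrite /coord/=; case: (upd k x s) (y) => a b [c d]/= -> ->.
Qed.

Let cvg_line (g : R -> R) : (forall s, exists dg, is_derive s (1 : R) g dg) -> continuous g.
Proof. by move=> H s; have [dg] := H s; exact: is_derive1_continuous. Qed.

Lemma kernel_test_integrable (K : R * R -> R) (f : R * R -> R) (M D a b : R) y :
  measurable_fun [set: plane R] K -> measurable_fun [set: plane R] f ->
  (forall x, box M x -> `|K (psub x y)| <= a + b * kap (psub x y) ^+ 4) ->
  (forall x, `|f x| <= D) -> (forall x, ~ box M x -> f x = 0) ->
  integrable (fun x => K (psub x y) * f x).
Proof.
move=> mK mf hK fD f0; have D0 := le_trans (normr_ge0 _) (fD (0, 0)).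
apply: (@integrable_dom _ (plane R) R mu _
   (fun x => D * (`|a| * \1_(box M) x + `|b| * kap (psub x y) ^+ 4))).
- apply: measurable_funM => //; exact: measurableT_comp mK (psub_measurable2 y).
- move=> x; rewrite normrM indicE.
  have [xM|xM] := pselect (box M x); last first.
    rewrite f0// normr0 mulr0 mulr_ge0// addr_ge0// mulr_ge0// ?exprn_ge0 ?kap_ge0//.
  rewrite mem_set// mulr1 mulrC; apply: ler_pM => //.
  apply: le_trans (hK x xM) _; apply: lerD; first exact: ler_norm.
  by rewrite ler_wpM2r ?exprn_ge0 ?kap_ge0// ler_norm.
- apply: integrable_scale; apply: integrable_addr; apply: integrable_scale.
    apply: (@bounded_box_integrable R (\1_(box M)) M 1).
    + exact: measurable_indic (box_measurable M).
    + by move=> x; rewrite indicE; case: (_ \in _); rewrite ?normr1 ?normr0.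
    + by move=> x xM; rewrite indicE memNset.
  by have := kap4_integrable y; under eq_fun do rewrite kapC.
Qed.

(** The logarithm is smooth except at one point, where it and its gradient are locally
    integrable, so integration by parts applies directly. *)
Lemma log_gradient chi k y : test_function chi ->
  \int[mu]_x (lnk (psub x y) * dpartial k chi x) = - \int[mu]_x (rk k (psub x y) * chi x).
Proof.
move=> tchi; have [M [D [c0 d0 cD dD]]] := test_bounds tchi.
have mc := plane_continuous_measurable (test_continuous tchi).
have md := plane_continuous_measurable (dpartial_continuous (k := k) tchi).
apply: (@plane_ibp R k (fun x => lnk (psub x y)) (fun x => rk k (psub x y)) chi y) => //.
- pose c := (4 + ln 4 : R) * ((1 + `|ln (1 + M + M)|) * (1 + lnj y)).
  apply: (@kernel_test_integrable _ _ M D c (4 + ln 4)) => //; first exact: lnk_measurable.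
  + move=> x xM; apply: le_trans (lnk_kernel x y) _.
    have l4 : 0 <= ln 4 :> R by rewrite ln_ge0// ler1n.
    have l40 : 0 <= 4 + ln 4 :> R by rewrite addr_ge0.
    rewrite mulrDr /c; apply: lerD; rewrite ler_wpM2l//; last exact: kap_exp_le.
    rewrite ler_wpM2r ?addr_ge0 ?lnj_ge0// lerD2l (le_trans (lnj_box xM))// ler_norm//.
  + exact: d0.
- apply: (@kernel_test_integrable _ _ M D 1 1) => //; first exact: rk_measurable.
  by move=> x _; rewrite mul1r rk_kap.
move=> x xy; have npos := nsq_gt0_line xy; split.
- move=> s.
  have -> : (fun s => lnk (psub (upd k x s) y)) = (fun s => 2^-1 * ln (nsq (psub (upd k x s) y))).
    by apply/funext => t; rewrite lnkE.
  have dl := @is_derive1_chain R (@ln R) (fun s => nsq (psub (upd k x s) y)) s _ _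
    (is_derive1_ln (npos s)) (is_derive_psub_nsq k x y s).
  apply: (is_derive_eq (is_derive1_scale 2^-1 dl)).
  by rewrite /rk [(nsq _)^-1 * _]mulrC !mulrA mulVf// mul1r.
- apply: cvg_line => s; eexists.
  apply: is_derive1_mul; first exact: is_derive_psub_coord.
  by apply: is_derive1_inv; [rewrite gt_eqF|exact: is_derive_psub_nsq].
Qed.

Lemma rkd_ibp d chi j k y : 0 < d -> test_function chi ->
  \int[mu]_x (rkd d j (psub x y) * dpartial k chi x) = - \int[mu]_x (drkd d j k (psub x y) * chi x).
Proof.
move=> dpos tchi; have [M [D [c0 d0 cD dD]]] := test_bounds tchi.
have mc := plane_continuous_measurable (test_continuous tchi).
have md := plane_continuous_measurable (dpartial_continuous (k := k) tchi).
apply: (@plane_ibp R k (fun x => rkd d j (psub x y)) (fun x => drkd d j k (psub x y)) chi y) => //.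
- apply: (@kernel_test_integrable _ _ M D 1 1) => //; first exact: rkd_measurable.
  + by move=> x _; rewrite mul1r (le_trans (rkd_le _ _ dpos))// rk_kap.
  + exact: d0.
- apply: (@kernel_test_integrable _ _ M D (3 / d) 0) => //; first exact: drkd_measurable.
  by move=> x _; rewrite mul0r addr0 drkd_le.
have dn s (x : R * R) : is_derive s (1 : R) (fun s => nsq (psub (upd k x s) y) + d) (2 * coord k (psub (upd k x s) y)).
  apply: (is_derive_eq (is_derive1_add (is_derive_psub_nsq k x y s) (@is_derive_cst _ _ _ d s 1))).
  by rewrite addr0.
move=> x _; split.
- move=> s.
  have nd := nsqd_gt0 (psub (upd k x s) y) dpos.
  have di := @is_derive1_inv R (fun s => nsq (psub (upd k x s) y) + d) s _
    (lt0r_neq0 nd) (dn s x).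
  apply: (is_derive_eq (is_derive1_mul (is_derive_psub_coord j k x y s) di)).
  rewrite /drkd; field; exact: lt0r_neq0.
- have cc i : continuous (fun s => coord i (psub (upd k x s) y)).
    by move=> s; exact: is_derive1_continuous (is_derive_psub_coord i k x y s).
  have cn : continuous (fun s => nsq (psub (upd k x s) y) + d).
    by move=> s; exact: is_derive1_continuous (dn s x).
  move=> s; apply: cvgM.
    apply: cvgB; first by apply: cvgM; [exact: cvg_cst|exact: cn].
    by apply: cvgM; [apply: cvgM; [exact: cvg_cst|exact: cc]|exact: cc].
  apply: cvgV; first by rewrite expf_neq0 ?(gt_eqF (nsqd_gt0 _ dpos)).
  have -> : (fun s => (nsq (psub (upd k x s) y) + d) ^+ 2) =
     (fun s => (nsq (psub (upd k x s) y) + d) * (nsq (psub (upd k x s) y) + d)).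
    by apply/funext => t; rewrite expr2.
  by rewrite expr2; apply: cvgM; exact: cn.
Qed.

(** The regularized kernel is dominated by the gradient kernel. *)
Lemma rkd_cvg chi j k y : test_function chi ->
  \int[mu]_x (rkd n.+1%:R^-1 j (psub x y) * dpartial k chi x) @[n --> \oo] -->
  \int[mu]_x (rk j (psub x y) * dpartial k chi x).
Proof.
move=> tchi; have [M [D [c0 d0 cD dD]]] := test_bounds tchi.
have md := plane_continuous_measurable (dpartial_continuous (k := k) tchi).
have I : integrable (fun x => rk j (psub x y) * dpartial k chi x).
  apply: (@kernel_test_integrable _ _ M D 1 1) => //; first exact: rk_measurable.
  + by move=> x _; rewrite mul1r rk_kap.
  + exact: d0.
apply: (@dominated_cvg_Rintegral _ (plane R) R mu
  (fun n x => rkd n.+1%:R^-1 j (psub x y) * dpartial k chi x) _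
  (fun x => `|rk j (psub x y) * dpartial k chi x|)).
- move=> n; apply: measurable_funM => //.
  by apply: measurableT_comp (psub_measurable2 y); apply: rkd_measurable; rewrite invr_gt0.
- exact: integrable_measurable I.
- apply: aeW => x; apply: cvgM; last exact: cvg_cst.
  rewrite /rkd /rk; set z := psub x y.
  have [z0|z0] := eqVneq (nsq z) 0.
    have -> : coord j z = 0.
      by apply/eqP; rewrite -sqrf_eq0 eq_le sqr_ge0 andbT -z0 coord_sqr_le.
    by under eq_fun do rewrite mul0r; rewrite mul0r; exact: cvg_cst.
  apply: cvgM; first exact: cvg_cst.
  apply: cvgV => //; rewrite -[X in _ --> X]addr0; apply: cvgD; first exact: cvg_cst.
  exact: cvg_harmonic.
- exact: integrable_norm.
- apply: aeW => x n.
  rewrite [leLHS]normrM [leRHS]normrM ler_wpM2r//; apply: rkd_le.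
  by rewrite invr_gt0.
Qed.

(** The regularized kernels have symmetric derivatives, and the identity that follows
    by integration by parts survives the removal of the regularization. *)
Lemma rk_curl_free chi y : test_function chi ->
  \int[mu]_x (rk 0 (psub x y) * dpartial 1 chi x) =
  \int[mu]_x (rk 1 (psub x y) * dpartial 0 chi x).
Proof.
move=> tchi; have h0 := @rkd_cvg chi 0 1 y tchi.
have := @rkd_cvg chi 1 0 y tchi.
have -> : (fun n => \int[mu]_x (rkd n.+1%:R^-1 1 (psub x y) * dpartial 0 chi x)) =
          (fun n => \int[mu]_x (rkd n.+1%:R^-1 0 (psub x y) * dpartial 1 chi x)).
  apply/funext => n; rewrite !rkd_ibp ?invr_gt0//; congr (- _).
  by apply: eq_Rintegral => x _; rewrite drkd_sym.
by move=> /cvg_lim <-//; move/cvg_lim : h0 => <-.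
Qed.

End GradientKernel.

(** * The fundamental solution of the Laplacian *)

Section FundamentalSolution.
Variable R : realType.
Local Notation leb := (@lebesgue_measure R).
Local Notation mu := (leb2 R).
Implicit Types (x y z : R * R) (chi : R * R -> R) (j k : 'I_2).
Local Notation integrable f := (mu.-integrable [set: plane R] (EFin \o f)).

Lemma plane_int_add (f g : R * R -> R) : integrable f -> integrable g ->
  \int[mu]_x (f x + g x) = \int[mu]_x f x + \int[mu]_x g x.
Proof. exact: (@RintegralD _ (plane R) R mu setT). Qed.

Lemma plane_int_sub (f g : R * R -> R) : integrable f -> integrable g ->
  \int[mu]_x (f x - g x) = \int[mu]_x f x - \int[mu]_x g x.
Proof. exact: (@RintegralB _ (plane R) R mu setT). Qed.

Lemma plane_int_scale (a : R) (f : R * R -> R) : integrable f ->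
  \int[mu]_x (a * f x) = a * \int[mu]_x f x.
Proof. exact: (@RintegralZl _ (plane R) R mu setT). Qed.

Lemma plane_int_le (f g : R * R -> R) : integrable f -> integrable g ->
  (forall x, f x <= g x) -> \int[mu]_x f x <= \int[mu]_x g x.
Proof. by move=> iF iG fg; apply: (@le_Rintegral _ (plane R) R mu setT). Qed.

Lemma plane_int_norm (f : R * R -> R) : integrable f ->
  `|\int[mu]_x f x| <= \int[mu]_x `|f x|.
Proof. exact: (@le_normr_Rintegral _ (plane R) R mu setT). Qed.

Lemma even_integral (f F : R -> R) (l : R) : (forall t, 0 <= f t) ->
  (forall t, f (- t) = f t) -> continuous f -> (forall t, is_derive t (1 : R) F (f t)) ->
  F 0 = 0 -> F t @[t --> +oo] --> l -> (\int[leb]_t (f t)%:E = (2 * l)%:E)%E.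
Proof.
move=> f0 fN cf dF F0 Fl; rewrite ge0_symfun_integralT//; last by move=> t /=; rewrite fN.
have -> : [set x : R | 0 <= x] = `[0, +oo[%classic by apply/seteqP; split=> t/=; rewrite in_itv/= andbT.
rewrite (@ge0_continuous_FTC2y R f F 0 l)// ?F0 ?sube0 ?EFinM//.
- by apply: continuous_in_subspaceT => t _; exact: cf.
- by apply: cvg_at_right_filter; rewrite -[X in _ --> X]F0; exact: is_derive1_continuous (dF 0).
- by move=> t _; rewrite derive1E; have [] := dF t.
Qed.

Lemma cvgy_inv (c : R) : c / t @[t --> +oo] --> (0 : R).
Proof.
rewrite -[X in _ --> X](mulr0 c); apply: cvgM; first exact: cvg_cst.
apply: ((@gtr0_cvgV0 R R (pinfty_nbhs R) _ id _).2 (@cvg_id _ _)); near=> t; near: t.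
exact: nbhs_pinfty_gt.
Unshelve. all: by end_near. Qed.

(** The antiderivative is [s / (2 b^2 (s^2 + b^2)) + atan (s / b) / (2 b^3)]. *)
Lemma integral_inv_sqr2 (b : R) : 0 < b ->
  (\int[leb]_s (((s ^+ 2 + b ^+ 2) ^+ 2)^-1)%:E = (pi / (2 * b ^+ 3))%:E)%E.
Proof.
move=> b0; have bn := lt0r_neq0 b0.
have pos (s : R) : 0 < s ^+ 2 + b ^+ 2 by rewrite ltr_wpDl ?sqr_ge0// exprn_gt0.
have dq (s : R) : is_derive s (1 : R) (fun s => s ^+ 2 + b ^+ 2) (2 * s).
  have := is_derive1_add (is_derive1_mul (is_derive_id s (1 : R)) (is_derive_id s (1 : R)))
     (is_derive_cst (b ^+ 2) s 1).
  have -> : (fun t : R => id t * id t + cst (b ^+ 2) t) = (fun s => s ^+ 2 + b ^+ 2).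
    by apply/funext => t; rewrite expr2.
  by move=> h; apply: (is_derive_eq h); rewrite /=; ring.
have di (s : R) := @is_derive1_inv R (fun s => s ^+ 2 + b ^+ 2) s _ (lt0r_neq0 (pos s)) (dq s).
pose F (s : R) := (2 * b ^+ 2)^-1 * (s * (s ^+ 2 + b ^+ 2)^-1) + (2 * b ^+ 3)^-1 * atan (b^-1 * s).
have -> : pi / (2 * b ^+ 3) = 2 * ((2 * b ^+ 3)^-1 * (pi / 2)) :> R.
  by field; rewrite bn.
apply: (@even_integral _ F).
- by move=> s; rewrite invr_ge0 sqr_ge0.
- by move=> s; rewrite sqrrN.
- move=> s; apply: cvgV; first by rewrite sqrf_eq0 gt_eqF.
  have c : {for s, continuous (fun s : R => s ^+ 2 + b ^+ 2)} := is_derive1_continuous (dq s).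
  exact: (cvgM c c).
- move=> s; have d1 := is_derive1_scale (2 * b ^+ 2)^-1 (is_derive1_mul (is_derive_id s (1 : R)) (di s)).
  have d2 := is_derive1_scale (2 * b ^+ 3)^-1 (@is_derive1_chain R (@atan R) (fun s => b^-1 * s) s _ _
     (is_derive1_atan (b^-1 * s)) (is_derive1_scale b^-1 (is_derive_id s (1 : R)))).
  apply: (is_derive_eq (is_derive1_add d1 d2)) => /=.
  have sn := lt0r_neq0 (pos s).
  have -> : (1 + (b^-1 * s) ^+ 2)^-1 = b ^+ 2 / (s ^+ 2 + b ^+ 2).
    rewrite exprMn exprVn -[1 in LHS](mulVf (expf_neq0 2 bn)) -mulrDr invfM invrK.
    by rewrite [b ^+ 2 + _]addrC.
  by field; rewrite bn sn.
- by rewrite /F mul0r !mulr0 atan0 mulr0 addr0.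
- rewrite -[X in _ --> X]add0r; apply: cvgD.
    rewrite -[X in _ --> X](mulr0 (2 * b ^+ 2)^-1); apply: cvgM; first exact: cvg_cst.
    apply: (@squeeze_cvgr _ _ _ _ (fun=> 0) (fun t => 1 / t)); last 2 first.
    + exact: cvg_cst.
    + exact: cvgy_inv.
    near=> t; have t0 : 0 < t by near: t; exact: nbhs_pinfty_gt.
    rewrite mulr_ge0 ?(ltW t0) ?invr_ge0 ?(ltW (pos _))//=.
    rewrite ler_pdivlMr// mulrAC ler_pdivrMr ?pos// mul1r -expr2 lerDl sqr_ge0//.
  apply: cvgM; first exact: cvg_cst.
  apply: (cvg_comp _ _ _ (@cvgy_atan R)).
  by apply: gt0_cvgMry; rewrite ?invr_gt0//.
Unshelve. all: by end_near. Qed.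

(** The antiderivative is [t / (d sqrt (t^2 + d))], which tends to [1 / d]. *)
Lemma integral_inv_cube (d : R) : 0 < d ->
  (\int[leb]_t ((Num.sqrt (t ^+ 2 + d) ^+ 3)^-1)%:E = (2 / d)%:E)%E.
Proof.
move=> d0; have dn := lt0r_neq0 d0.
have pos (t : R) : 0 < t ^+ 2 + d by rewrite ltr_wpDl ?sqr_ge0.
pose b (t : R) := Num.sqrt (t ^+ 2 + d).
have bpos t : 0 < b t by rewrite sqrtr_gt0.
have b2 t : b t ^+ 2 = t ^+ 2 + d by rewrite sqr_sqrtr// ltW.
have dq (s : R) : is_derive s (1 : R) (fun s => s ^+ 2 + d) (2 * s).
  have := is_derive1_add (is_derive1_mul (is_derive_id s (1 : R)) (is_derive_id s (1 : R)))
     (is_derive_cst d s 1).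
  have -> : (fun t : R => id t * id t + cst d t) = (fun s => s ^+ 2 + d).
    by apply/funext => t; rewrite expr2.
  by move=> h; apply: (is_derive_eq h); rewrite /=; ring.
have db (s : R) : is_derive s (1 : R) b (s / b s).
  have h := @is_derive1_chain R (@Num.sqrt R) (fun s => s ^+ 2 + d) s _ _ (is_derive1_sqrt (pos s)) (dq s).
  apply: (is_derive_eq h); rewrite -/(b s); field; exact: lt0r_neq0.
have dbi (s : R) := @is_derive1_inv R b s _ (lt0r_neq0 (bpos s)) (db s).
rewrite (_ : 2 / d = 2 * (d^-1 * 1)); last by rewrite mulr1.
apply: (@even_integral _ (fun t => d^-1 * (t * (b t)^-1))).
- by move=> t; rewrite invr_ge0 exprn_ge0// sqrtr_ge0.
- by move=> t; rewrite sqrrN.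
- move=> t; have c : {for t, continuous b} := is_derive1_continuous (db t).
  apply: cvgV; first by rewrite expf_neq0// -/(b t) gt_eqF.
  exact: (cvgM c (cvgM c c)).
- move=> s; have h := is_derive1_scale d^-1 (is_derive1_mul (is_derive_id s (1 : R)) (dbi s)).
  apply: (is_derive_eq h) => /=; rewrite -/(b s).
  have bn := lt0r_neq0 (bpos s).
  have dE : d = b s ^+ 2 - s ^+ 2 by rewrite b2 addrC addKr.
  have dn' : b s ^+ 2 - s ^+ 2 != 0 by rewrite -dE.
  by rewrite [X in X^-1 * _]dE; field; rewrite bn dn'.
- by rewrite mul0r mulr0.
- apply: cvgM; first exact: cvg_cst.
  apply: (@squeeze_cvgr _ _ _ _ (fun t => 1 - Num.sqrt d / t) (fun=> 1)); last 2 first.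
  + rewrite -[X in _ --> X](subr0 1); apply: cvgB; [exact: cvg_cst|exact: cvgy_inv].
  + exact: cvg_cst.
  near=> t; have t0 : 0 < t by near: t; exact: nbhs_pinfty_gt.
  have tb : t <= b t by rewrite -(@ler_pXn2r _ 2) ?nnegrE ?(ltW t0) ?(ltW (bpos t))// b2 lerDl ltW.
  have bt : b t <= t + Num.sqrt d.
    rewrite -(@ler_pXn2r _ 2) ?nnegrE ?(ltW (bpos _)) ?addr_ge0 ?sqrtr_ge0 ?(ltW t0)//.
    rewrite b2 sqrrD sqr_sqrtr ?(ltW d0)// lerD2r lerDl mulrn_wge0// mulr_ge0 ?sqrtr_ge0 ?(ltW t0)//.
  apply/andP; split; last by rewrite ler_pdivrMr ?mul1r.
  rewrite ler_pdivlMr// mulrBl mul1r lerBlDr.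
  apply: (le_trans bt); rewrite lerD2l -mulrAC ler_pdivlMr// ler_wpM2l ?sqrtr_ge0//.
Unshelve. all: by end_near. Qed.

(** The Laplacian of [ln (|z|^2 + d) / 2], an approximate identity. *)
Definition bumpd (d : R) z : R := 2 * d / (nsq z + d) ^+ 2.

Lemma bumpd_ge0 d z : 0 < d -> 0 <= bumpd d z.
Proof. by move=> d0; rewrite mulr_ge0 ?invr_ge0 ?sqr_ge0// mulr_ge0// ltW. Qed.

Lemma bumpd_measurable d : measurable_fun [set: plane R] (bumpd d).
Proof.
apply: measurable_funM => //; apply: measurable_inv_ge0; last by move=> z; exact: sqr_ge0.
by apply: measurable_funX; exact: nsqd_measurable.
Qed.

(** Tonelli's theorem, with the two one-dimensional integrals computed above. *)
Lemma bumpd_integral d y : 0 < d -> (\int[mu]_x (bumpd d (psub x y))%:E = (2 * pi)%:E)%E.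
Proof.
move=> d0; have dn := lt0r_neq0 d0.
have mF : measurable_fun [set: plane R] (fun x => bumpd d (psub x y)).
  exact: measurableT_comp (@bumpd_measurable d) (psub_measurable2 y).
rewrite (@fubini_tonelli1 _ _ (measurableTypeR R) (measurableTypeR R) R leb leb
  (fun x => (bumpd d (psub x y))%:E))//=; last 2 first.
  exact/measurable_EFinP.
  by move=> x; rewrite lee_fin bumpd_ge0.
rewrite /fubini_F/=.
pose b (t : R) := Num.sqrt (t ^+ 2 + d).
have bpos t : 0 < b t by rewrite sqrtr_gt0 ltr_wpDl ?sqr_ge0.
have b2 t : b t ^+ 2 = t ^+ 2 + d by rewrite sqr_sqrtr// addr_ge0 ?sqr_ge0 ?ltW.
pose g (t : R) := ((pi * d)%:E * ((b t ^+ 3)^-1)%:E)%E.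
have mb : measurable_fun [set: R] b.
  apply: (measurableT_comp (continuous_measurable_fun (@sqrt_continuous R))).
  by apply: measurable_funD => //; exact: measurable_funX.
have mb3 : measurable_fun [set: R] (fun t => (b t ^+ 3)^-1).
  rewrite (_ : (fun t => _) = (fun t => (b t ^+ 3) `^ (- 1))); last first.
    by apply/funext => t; rewrite powR_inv1// exprn_ge0// ltW.
  by apply: (measurableT_comp (measurable_powR _)); exact: measurable_funX.
have inner (t : R) : (\int[leb]_s (bumpd d (psub (t, s) y))%:E = g (t + - y.1)%R)%E.
  have -> : (\int[leb]_s (bumpd d (psub (t, s) y))%:E =
     \int[leb]_s (fun s => (2 * d)%:E * (((s ^+ 2 + b (t - y.1) ^+ 2) ^+ 2)^-1)%:E) (s + - y.2)%R)%E.
    apply: eq_integral => s _; rewrite /= /bumpd /psub /nsq/= -EFinM b2; congr (_ / _ ^+ 2)%:E.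
    by ring.
  have ms : measurable_fun [set: R] (fun s : R => ((s ^+ 2 + b (t - y.1) ^+ 2) ^+ 2)^-1).
    rewrite (_ : (fun s => _) = (fun s => ((s ^+ 2 + b (t - y.1) ^+ 2) ^+ 2) `^ (- 1))); last first.
      by apply/funext => s; rewrite powR_inv1// sqr_ge0.
    apply: (measurableT_comp (measurable_powR _)); apply: measurable_funX.
    by apply: measurable_funD => //; exact: measurable_funX.
  have mE : measurable_fun [set: R] (fun s => (2 * d)%:E * (((s ^+ 2 + b (t - y.1) ^+ 2) ^+ 2)^-1)%:E)%E.
    by under eq_fun do rewrite -EFinM; apply/measurable_EFinP; exact: measurable_funM.
  have d20 : 0 <= 2 * d by rewrite mulr_ge0// ltW.
  rewrite (@ge0_integral_translate R (fun s => (2 * d)%:E * (((s ^+ 2 + b (t - y.1) ^+ 2) ^+ 2)^-1)%:E)%E)//; last first.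
    by move=> s; rewrite -EFinM lee_fin mulr_ge0// invr_ge0 sqr_ge0.
  rewrite ge0_integralZl//; [|exact/measurable_EFinP|by move=> s _; rewrite lee_fin invr_ge0 sqr_ge0].
  rewrite integral_inv_sqr2// -EFinM /g -EFinM; congr (_%:E).
  by have bn := lt0r_neq0 (bpos (t - y.1)); field; rewrite bn.
have pd0 : 0 <= pi * d by rewrite mulr_ge0 ?pi_ge0// ltW.
have mg : measurable_fun [set: R] g.
  by rewrite /g; under eq_fun do rewrite -EFinM; apply/measurable_EFinP; exact: measurable_funM.
under eq_integral do rewrite inner.
rewrite (@ge0_integral_translate R g)//; last first.
  by move=> t; rewrite /g -EFinM lee_fin mulr_ge0// invr_ge0 exprn_ge0// ltW.
rewrite /g ge0_integralZl//; [|exact/measurable_EFinP|by move=> s _; rewrite lee_fin invr_ge0 exprn_ge0// ltW].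
by rewrite integral_inv_cube// -EFinM; congr (_%:E); field.
Qed.

(** Away from the origin the mass is of order [d], with an integrable profile. *)
Lemma bumpd_far d r z : 0 < d -> 0 < r -> r <= nsq z ->
  bumpd d z <= d * (2 * ((1 + r) / r) ^+ 2) * (1 + nsq z) `^ (- 1 - 1).
Proof.
move=> d0 r0 rz; have n0 := nsq_ge0 z; have rn := lt0r_neq0 r0.
have p1 : 0 < 1 + nsq z by rewrite ltr_pwDl.
have pz : 0 < nsq z by exact: lt_le_trans rz.
have -> : (1 + nsq z) `^ (- 1 - 1) = ((1 + nsq z) ^+ 2)^-1.
  by rewrite -opprD powRN -powR_mulrn// ltW.
set c := (1 + r) / r.
rewrite /bumpd (_ : 2 * d / _ = d * (2 * (nsq z + d) ^- 2)); last by ring.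
rewrite [leRHS](_ : _ = d * (2 * (c ^+ 2 / (1 + nsq z) ^+ 2))); last by rewrite !mulrA.
rewrite ler_wpM2l ?(ltW d0)// ler_wpM2l//.
rewrite -exprVn -[(1 + nsq z) ^- 2]exprVn -exprMn ler_pXn2r ?nnegrE ?invr_ge0 ?(ltW (nsqd_gt0 _ d0))//; last first.
  by rewrite /c !mulr_ge0// ?invr_ge0 ?(ltW r0) ?(ltW p1)// addr_ge0 ?ltW.
apply: (@le_trans _ _ (nsq z)^-1).
  by rewrite lef_pV2 ?posrE ?nsqd_gt0// lerDl ltW.
rewrite ler_pdivlMr// mulrC ler_pdivrMr// /c mulrAC ler_pdivlMr//.
by lra.
Qed.

(** Integration by parts turns the left-hand side, for the regularized kernels, into the
    integral of [chi] against an approximate identity of total mass [2 * pi]. *)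
Lemma rk_divergence chi y : test_function chi ->
  \int[mu]_x (rk 0 (psub x y) * dpartial 0 chi x) +
  \int[mu]_x (rk 1 (psub x y) * dpartial 1 chi x) = - (2 * pi) * chi y.
Proof.
move=> tchi; have [M [D [c0 _ cD _]]] := test_bounds tchi.
have D0 : 0 <= D := le_trans (normr_ge0 _) (cD (0, 0)).
have mc := plane_continuous_measurable (test_continuous tchi).
have lim := cvgD (@rkd_cvg R chi 0 0 y tchi) (@rkd_cvg R chi 1 1 y tchi).
pose w (x : R * R) := (1 + nsq (psub x y)) `^ (- 1 - 1).
have iw : integrable w.
  apply: (@integrable_dom _ (plane R) R mu _
     (fun x => (2 * (1 + nsq y)) ^+ 2 * (1 + nsq x) `^ (- 1 - 1))).
  - apply: (measurableT_comp (measurable_powR _)); apply: measurable_funD => //.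
    exact: measurableT_comp (@nsq_measurable R) (psub_measurable2 y).
  - move=> x; rewrite (ger0_norm (powR_ge0 _ _)) /w.
    have p (z : R * R) : 0 < 1 + nsq z by rewrite ltr_pwDl// nsq_ge0.
    have pw (z : R * R) : (1 + nsq z) `^ (- 1 - 1) = (1 + nsq z)^-1 ^+ 2.
      by rewrite exprVn -opprD powRN -powR_mulrn// ltW.
    rewrite !pw -exprMn ler_pXn2r ?nnegrE ?mulr_ge0 ?invr_ge0 ?(ltW (p _))//.
    rewrite ler_pdivlMr// mulrC ler_pdivrMr// mulrAC.
    exact: peetre.
  - by apply: integrable_scale; exact: integrable_japanese.
have ib n : integrable (fun x => bumpd n.+1%:R^-1 (psub x y)).
  apply: (@ge0_integrable _ (plane R) R mu).
  - exact: measurableT_comp (@bumpd_measurable _) (psub_measurable2 y).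
  - by move=> x; rewrite bumpd_ge0// invr_gt0.
  - by rewrite bumpd_integral ?invr_gt0// ltry.
have ibc n : integrable (fun x => bumpd n.+1%:R^-1 (psub x y) * chi x).
  apply: (@integrable_dom _ (plane R) R mu _ (fun x => D * bumpd n.+1%:R^-1 (psub x y))).
  - exact: measurable_funM (integrable_measurable (ib n)) mc.
  - move=> x; rewrite normrM mulrC (@ger0_norm _ (bumpd _ _)) ?bumpd_ge0 ?invr_gt0//.
    by rewrite ler_wpM2r ?bumpd_ge0 ?invr_gt0.
  - exact: integrable_scale.
have e n : \int[mu]_x (rkd n.+1%:R^-1 0 (psub x y) * dpartial 0 chi x) +
   \int[mu]_x (rkd n.+1%:R^-1 1 (psub x y) * dpartial 1 chi x) =
   - \int[mu]_x (bumpd n.+1%:R^-1 (psub x y) * chi x).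
  have dpos : 0 < n.+1%:R^-1 :> R by rewrite invr_gt0.
  have id k : integrable (fun x => drkd n.+1%:R^-1 k k (psub x y) * chi x).
    apply: (@kernel_test_integrable R (drkd n.+1%:R^-1 k k) chi M D (3 / n.+1%:R^-1) 0) => //.
    + exact: drkd_measurable.
    + by move=> x _; rewrite mul0r addr0 drkd_le.
  rewrite !rkd_ibp// -opprD -(plane_int_add (id 0) (id 1)); congr (- _).
  by apply: eq_Rintegral => x _; rewrite -mulrDl drkd_trace.
have key : \int[mu]_x (bumpd n.+1%:R^-1 (psub x y) * chi x) @[n --> \oo] --> 2 * pi * chi y.
  have pi0 : 0 < pi :> R := pi_gt0 R.
  apply/cvgrPdist_le => e0 e0pos.
  (* half of the tolerance, divided by the total mass *)
  pose e1 := e0 / (4 * pi).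
  have e1pos : 0 < e1 by rewrite divr_gt0// mulr_gt0.
  have [r r0 Hr] : exists2 r : R, 0 < r & forall x, nsq (psub x y) < r -> `|chi x - chi y| <= e1.
    have cy : {for y, continuous chi} by exact: test_continuous.
    move: cy => /cvgrPdist_le /(_ _ e1pos) /nbhs_ballP [s /= s0 Hs].
    exists (s ^+ 2); first exact: exprn_gt0.
    move=> x xs; rewrite distrC; apply: Hs; split => /=; rewrite /ball/=.
      rewrite -(@ltr_pXn2r _ 2) ?nnegrE ?(ltW s0)// real_normK ?num_real//.
      by apply: le_lt_trans xs; rewrite -[(_ - _) ^+ 2]sqrrN opprB lerDl sqr_ge0.
    rewrite -(@ltr_pXn2r _ 2) ?nnegrE ?(ltW s0)// real_normK ?num_real//.
    by apply: le_lt_trans xs; rewrite -[(_ - _) ^+ 2]sqrrN opprB lerDr sqr_ge0.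
  pose c := 2 * ((1 + r) / r) ^+ 2; pose W := \int[mu]_x w x.
  have c0' : 0 <= c by rewrite mulr_ge0// sqr_ge0.
  have W0 : 0 <= W by apply: Rintegral_ge0 => x _; exact: powR_ge0.
  have bound n : `|2 * pi * chi y - \int[mu]_x (bumpd n.+1%:R^-1 (psub x y) * chi x)| <=
      e0 / 2 + n.+1%:R^-1 * (2 * D * c * W).
    set d := n.+1%:R^-1; have dpos : 0 < d by rewrite invr_gt0.
    have -> : 2 * pi * chi y = \int[mu]_x (bumpd d (psub x y) * chi y).
      by under eq_Rintegral do rewrite mulrC; rewrite (plane_int_scale _ (ib n)) mulrC /Rintegral bumpd_integral.
    have ic : integrable (fun x => bumpd d (psub x y) * chi y).
      have -> : (fun x => bumpd d (psub x y) * chi y) = (fun x => chi y * bumpd d (psub x y)).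
        by apply/funext => x; rewrite mulrC.
      exact: integrable_scale (ib n).
    rewrite -(plane_int_sub ic (ibc n)).
    have ib2 : integrable (fun x => e1 * bumpd d (psub x y) + d * (2 * D * c) * w x).
      by apply: integrable_addr; [exact: integrable_scale (ib n)|exact: integrable_scale iw].
    apply: (@le_trans _ _ (\int[mu]_x (e1 * bumpd d (psub x y) + d * (2 * D * c) * w x))).
      apply: le_trans (plane_int_norm (integrable_subr ic (ibc n))) _.
      apply: plane_int_le => //; first exact/integrable_norm/(integrable_subr ic (ibc n)).
      move=> x; rewrite -mulrBr normrM (ger0_norm (bumpd_ge0 _ dpos)) distrC.
      have b0 := bumpd_ge0 (psub x y) dpos.
      have [xr|xr] := ltP (nsq (psub x y)) r.
        apply: (@le_trans _ _ (e1 * bumpd d (psub x y))); first by rewrite mulrC ler_wpM2r// Hr.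
        rewrite lerDl; apply: mulr_ge0; last exact: powR_ge0.
        by apply: (mulr_ge0 (ltW dpos)); apply: mulr_ge0 c0'; exact: mulr_ge0.
      apply: (@le_trans _ _ (bumpd d (psub x y) * (2 * D))).
        rewrite ler_wpM2l// (le_trans (ler_normB _ _))//.
        by have := cD x; have := cD y; lra.
      apply: (@le_trans _ _ ((d * c * w x) * (2 * D))).
        by rewrite ler_wpM2r ?mulr_ge0//; exact: bumpd_far.
      rewrite (_ : d * c * w x * (2 * D) = d * (2 * D * c) * w x); last by ring.
      by rewrite lerDr mulr_ge0// ltW.
    rewrite (plane_int_add (integrable_scale e1 (ib n)) (integrable_scale (d * (2 * D * c)) iw)).
    rewrite (plane_int_scale e1 (ib n)) (plane_int_scale (d * (2 * D * c)) iw).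
    rewrite -/W /Rintegral bumpd_integral//=.
    have -> : e1 * (2 * pi) = e0 / 2.
      have h (p q : R) : p != 0 -> q / (4 * p) * (2 * p) = q / 2 by move=> ?; field.
      by apply: h; rewrite gt_eqF.
    by rewrite lerD2l -[d * _ * W]mulrA.
  have h : n.+1%:R^-1 * (2 * D * c * W) @[n --> \oo] --> (0 : R).
    by rewrite -[X in _ --> X](mul0r (2 * D * c * W)); apply: cvgM; [exact: cvg_harmonic|exact: cvg_cst].
  have e02 : 0 < e0 / 2 by rewrite divr_gt0.
  move/cvgr0Pnorm_le : h => /(_ _ e02); apply: filterS => n hn; apply: (le_trans (bound n)).
  rewrite [leRHS](_ : _ = e0 / 2 + e0 / 2); last by lra.
  by rewrite lerD2l (le_trans (ler_norm _)).
move: (lim (@eventually_filter)); rewrite (_ : _ + _ = (fun n => - \int[mu]_x (bumpd n.+1%:R^-1 (psub x y) * chi x))); last first.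
  by apply/funext => n; rewrite -e.
move=> /cvg_lim <-//; rewrite mulNr; apply: cvg_lim => //; exact: cvgN.
Qed.
End FundamentalSolution.

(** * Potentials of tame densities *)

Section Potentials.
Variable R : realType.
Local Notation mu := (leb2 R).
Implicit Types (x y z : R * R) (f g chi K : R * R -> R) (j k : 'I_2).
Local Notation integrable f := (mu.-integrable [set: plane R] (EFin \o f)).

(** Kernels whose potentials of tame functions Fubini's theorem can handle. *)
Definition mild_kernel K := measurable_fun [set: plane R] K /\
  exists c, forall x y,
    `|K (psub x y)| <= c * ((1 + lnj x) * (1 + lnj y) + kap (psub x y) ^+ 3).

Lemma mild_lnk : mild_kernel (@lnk R).
Proof. by split; [exact: lnk_measurable|exists (4 + ln 4); exact: lnk_kernel]. Qed.

Lemma mild_rk k : mild_kernel (@rk R k).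
Proof.
split; first exact: rk_measurable.
exists 1 => x y; rewrite mul1r; apply: le_trans (rk_le k _) _.
apply: le_trans (riesz_kernel _) _; rewrite lerD2r.
by have := lnj_ge0 x; have := lnj_ge0 y; nra.
Qed.

Lemma potential_measurable K f : measurable_fun [set: plane R] K ->
  measurable_fun [set: plane R] f -> measurable_fun [set: plane R] (potential K f).
Proof.
move=> mK mf; apply: (@measurable_parametric_Rintegral _ _ _ _ _ (leb2 R)
   (fun p : plane R * plane R => K (psub p.1 p.2) * f p.2)).
apply: measurable_funM; last exact: measurableT_comp mf measurable_snd.
exact: measurableT_comp mK (@psub_measurable R).
Qed.

Section Pairing.
Variables (K f chi : R * R -> R) (D M : R).
Hypotheses (mK : mild_kernel K) (tf : tame f) (mchi : measurable_fun [set: plane R] chi)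
  (chiD : forall x, `|chi x| <= D) (chi0 : forall x, ~ box M x -> chi x = 0).

Let prodI : (leb2 R \x leb2 R)%E.-integrable [set: plane R * plane R]
    (EFin \o (fun p => K (psub p.1 p.2) * f p.2 * chi p.1)).
Proof.
have [mk [c Hc]] := mK; exact: (kernel_product_integrable mk tf mchi Hc chiD chi0).
Qed.

Let slice : {ae mu, forall x,
  \int[mu]_y (K (psub x y) * f y * chi x) = potential K f x * chi x}.
Proof.
have := fubini_section1 prodI; apply: filterS => x /= Ix.
have [c0|c0] := eqVneq (chi x) 0.
  rewrite c0 mulr0; have -> : (fun y => K (psub x y) * f y * 0) = (fun=> 0).
    by apply/funext => y; rewrite mulr0.
  by rewrite /Rintegral integral0.
have I : integrable (fun y => K (psub x y) * f y).
  have := integrable_scale (chi x)^-1 Ix; congr (_.-integrable _ _).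
  by apply/funext => y /=; rewrite mulrC mulfK.
rewrite mulrC -(plane_int_scale _ I); congr Rintegral.
by apply/funext => y; rewrite mulrC.
Qed.

Let mP : measurable_fun [set: plane R] (fun x => potential K f x * chi x).
Proof.
by apply: measurable_funM => //; apply: potential_measurable; [have [] := mK|have [] := tf].
Qed.

Lemma potential_pairing_integrable : integrable (fun x => potential K f x * chi x).
Proof. exact: (ae_eq_integrable mP slice (fubini_integrable1 prodI)). Qed.

Let mQ : measurable_fun [set: plane R] (fun y => f y * \int[mu]_x (K (psub x y) * chi x)).
Proof.
have [mk _] := mK; have [mf _ _] := tf.
apply: measurable_funM => //.
apply: (@measurable_parametric_Rintegral _ _ _ _ _ (leb2 R)
  (fun p : plane R * plane R => K (psub p.2 p.1) * chi p.2)).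
apply: measurable_funM; last exact: measurableT_comp mchi measurable_snd.
apply: measurableT_comp mk _.
apply: (@measurableT_comp _ _ _ _ _ _ (fun p : plane R * plane R => psub p.1 p.2) _
  (fun p : plane R * plane R => (p.2, p.1))); first exact: psub_measurable.
exact: measurable_swap.
Qed.

Let slice2 : {ae mu, forall y, \int[mu]_x (K (psub x y) * f y * chi x) =
  f y * \int[mu]_x (K (psub x y) * chi x)}.
Proof.
have := fubini_section2 prodI; apply: filterS => y /= Iy.
have [c0|c0] := eqVneq (f y) 0.
  rewrite c0 mul0r; have -> : (fun x => K (psub x y) * 0 * chi x) = (fun=> 0).
    by apply/funext => x; rewrite mulr0 mul0r.
  by rewrite /Rintegral integral0.
have I : integrable (fun x => K (psub x y) * chi x).
  have := integrable_scale (f y)^-1 Iy; congr (_.-integrable _ _).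
  by apply/funext => x /=; rewrite [_ * f y]mulrC -mulrA mulKf.
rewrite -(plane_int_scale _ I); congr Rintegral.
by apply/funext => x; rewrite mulrCA mulrA.
Qed.

Lemma potential_dual_integrable : integrable (fun y => f y * \int[mu]_x (K (psub x y) * chi x)).
Proof. exact: (ae_eq_integrable mQ slice2 (fubini_integrable2 prodI)). Qed.

(** Fubini's theorem moves the integration against [chi] inside the potential. *)
Lemma potential_pairing : \int[mu]_x (potential K f x * chi x) =
  \int[mu]_y (f y * \int[mu]_x (K (psub x y) * chi x)).
Proof.
have := fubini_swap prodI.
rewrite (ae_eq_Rintegral (fubini_measurable1 prodI) mP slice) => ->.
exact: ae_eq_Rintegral (fubini_measurable2 prodI) mQ slice2.
Qed.

End Pairing.

Section Gradient.
Variables (f : R * R -> R) (tf : tame f).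

Lemma potential_box K M : mild_kernel K ->
  integrable (fun x => potential K f x * \1_(box M) x).
Proof.
move=> mK; apply: (@potential_pairing_integrable K f _ 1 M mK tf).
- exact: measurable_indic (box_measurable M).
- by move=> x; rewrite indicE; case: (_ \in _); rewrite ?normr1 ?normr0.
- by move=> x xM; rewrite indicE memNset.
Qed.

Let test_pairing K chi : mild_kernel K -> test_function chi ->
  (\int[mu]_x (potential K f x * chi x) =
     \int[mu]_y (f y * \int[mu]_x (K (psub x y) * chi x))) /\
  integrable (fun y => f y * \int[mu]_x (K (psub x y) * chi x)).
Proof.
move=> mK tchi; have [M [D [c0 _ cD _]]] := test_bounds tchi.
have mc := plane_continuous_measurable (test_continuous tchi).
split; first exact: (potential_pairing mK tf mc cD c0).
exact: (potential_dual_integrable mK tf mc cD c0).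
Qed.

Let test_pairing_partial K chi k : mild_kernel K -> test_function chi ->
  (\int[mu]_x (potential K f x * dpartial k chi x) =
     \int[mu]_y (f y * \int[mu]_x (K (psub x y) * dpartial k chi x))) /\
  integrable (fun y => f y * \int[mu]_x (K (psub x y) * dpartial k chi x)).
Proof.
move=> mK tchi; have [M [D [_ d0 _ dD]]] := test_bounds tchi.
have mc := plane_continuous_measurable (dpartial_continuous (k := k) tchi).
split; first exact: (potential_pairing mK tf mc (dD k) (d0 k)).
exact: (potential_dual_integrable mK tf mc (dD k) (d0 k)).
Qed.

(** Inside the potential, this is the gradient of the logarithm. *)
Lemma potential_gradient chi k : test_function chi ->
  \int[mu]_x (potential (@lnk R) f x * dpartial k chi x) =
    - \int[mu]_x (potential (rk k) f x * chi x).
Proof.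
move=> tchi; have [-> _] := test_pairing_partial k mild_lnk tchi.
have [-> I] := test_pairing (mild_rk k) tchi.
rewrite -mulN1r -(plane_int_scale _ I); apply: eq_Rintegral => y _.
by rewrite log_gradient// mulrN mulN1r.
Qed.

Lemma potential_curl chi : test_function chi ->
  \int[mu]_x (potential (rk 0) f x * dpartial 1 chi x) =
  \int[mu]_x (potential (rk 1) f x * dpartial 0 chi x).
Proof.
move=> tchi; have [-> _] := test_pairing_partial 1 (mild_rk 0) tchi.
have [-> _] := test_pairing_partial 0 (mild_rk 1) tchi.
by apply: eq_Rintegral => y _; rewrite rk_curl_free.
Qed.

(** Inside the potential, the two derivatives add up to a multiple of a Dirac mass. *)
Lemma potential_laplacian chi : test_function chi ->
  \int[mu]_x (potential (rk 0) f x * dpartial 0 chi x) +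
  \int[mu]_x (potential (rk 1) f x * dpartial 1 chi x) =
  - (2 * pi) * \int[mu]_x (f x * chi x).
Proof.
move=> tchi; have [-> I0] := test_pairing_partial 0 (mild_rk 0) tchi.
have [-> I1] := test_pairing_partial 1 (mild_rk 1) tchi.
have If : integrable (fun x => f x * chi x).
  have [M [D [_ _ cD _]]] := test_bounds tchi.
  apply: (@integrable_mulb _ (plane R) R mu _ _ D (tame_integrable tf) _ cD).
  exact: plane_continuous_measurable (test_continuous tchi).
rewrite -(plane_int_scale _ If) -(plane_int_add I0 I1); apply: eq_Rintegral => y _.
by rewrite -mulrDr rk_divergence// mulrCA.
Qed.

(** The gradient kernel splits into a bounded part and a locally singular one;
    the right-hand side may be infinite. *)
Lemma potential_rk_le k x :
  (`|potential (rk k) f x|%:E <=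
   (\int[mu]_y `|f y|)%:E + \int[mu]_y (kap (psub x y) ^+ 3 * `|f y|)%:E)%E.
Proof.
have [mf _ _] := tf; have If := integrable_norm (tame_integrable tf).
have [->|] := eqVneq (\int[mu]_y (kap (psub x y) ^+ 3 * `|f y|)%:E)%E +oo%E.
  by rewrite addey// leey.
rewrite -ltey => foo.
have k3 y : 0 <= kap (psub x y) ^+ 3 by rewrite exprn_ge0 ?kap_ge0.
have mk : measurable_fun [set: plane R] (fun y => kap (psub x y) ^+ 3 * `|f y|).
  apply: measurable_funM; last exact: measurableT_comp mf.
  exact: kapX_measurable1.
have Ik : integrable (fun y => kap (psub x y) ^+ 3 * `|f y|).
  by apply: (@ge0_integrable _ (plane R) R mu) => // y; rewrite mulr_ge0.
have le y : `|rk k (psub x y) * f y| <= `|f y| + kap (psub x y) ^+ 3 * `|f y|.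
  rewrite normrM -[X in X + _]mul1r -mulrDl ler_wpM2r//.
  exact: le_trans (rk_le _ _) (riesz_kernel _).
have I : integrable (fun y => rk k (psub x y) * f y).
  apply: (@integrable_dom _ (plane R) R mu _ _ _ le); last exact: integrable_addr.
  apply: measurable_funM => //.
  exact: measurableT_comp (@rk_measurable R k) (psub_measurable1 x).
have -> : (\int[mu]_y (kap (psub x y) ^+ 3 * `|f y|)%:E =
          (\int[mu]_y (kap (psub x y) ^+ 3 * `|f y|))%:E)%E.
  by rewrite /Rintegral fineK//; have := integrable_fin_num measurableT Ik.
rewrite -EFinD lee_fin -(plane_int_add If Ik).
apply: le_trans (plane_int_norm I) _; apply: plane_int_le => //; first exact: integrable_norm.
exact: integrable_addr.
Qed.
End Gradient.
End Potentials.

(** * Complex-valued functions and weak derivatives *)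

Section ComplexFunctions.
Variable R : realType.
Local Notation C := (R[i])%C.
Local Notation mu := (leb2 R).
Local Notation "'re' z" := (complex.Re z) (at level 10, z at level 8).
Local Notation "'im' z" := (complex.Im z) (at level 10, z at level 8).
Local Open Scope complex_scope.
Implicit Types (x y z : R * R) (f g h chi : R * R -> R) (u w : R * R -> C) (j k : 'I_2).
Local Notation integrable f := (mu.-integrable [set: plane R] (EFin \o f)).

Let complex_oppE (a b a' b' : R) : a = - a' -> b = - b' -> a +i* b = - (a' +i* b') :> C.
Proof. by move=> -> ->. Qed.

Let complex_addE (a b a' b' c d : R) : a + a' = c -> b + b' = d ->
  (a +i* b) + (a' +i* b') = c +i* d :> C.
Proof. by move=> <- <-. Qed.

(** Integrability on boxes centred at the origin is equivalent to local integrability. *)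
Definition box_integrable g := forall M, integrable (fun x => g x * \1_(box M) x).

Lemma box_integrable_on g M : integrable (fun x => g x * \1_(box M) x) ->
  mu.-integrable (box M) (EFin \o g).
Proof.
move=> I; rewrite integrable_mkcond; last exact: box_measurable.
move: I; congr (_.-integrable _ _); apply/funext => x /=; rewrite patchE indicE.
by case: (_ \in _); rewrite ?mulr1 ?mulr0.
Qed.

Lemma box_integrableP g : box_integrable g ->
  forall K : set (R * R), compact K -> mu.-integrable K (EFin \o g).
Proof.
move=> gI K cK; have [M _ KM] := compact_sub_box cK.
apply: (@integrableS _ (plane R) R mu (box M)) KM _; first exact: box_measurable.
  exact: plane_compact_measurable.
exact: box_integrable_on.
Qed.

Lemma compact_box_integrable g :
  (forall K : set (R * R), compact K -> mu.-integrable K (EFin \o g)) -> box_integrable g.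
Proof.
move=> gI M; have := gI _ (@box_compact R M).
rewrite integrable_mkcond; last exact: box_measurable.
congr (_.-integrable _ _); apply/funext => x /=; rewrite patchE indicE.
by case: (_ \in _); rewrite ?mulr1 ?mulr0.
Qed.

(** Each point lies in all large boxes, so the function is a pointwise limit of
    truncated measurable functions. *)
Lemma box_integrable_measurable g : box_integrable g -> measurable_fun [set: plane R] g.
Proof.
move=> gI; apply: (@measurable_fun_cvg _ (plane R) R setT
  (fun n x => g x * \1_(box n%:R) x)).
  by move=> n; exact: integrable_measurable (gI _).
move=> x _; apply: (@cvg_near_cst _ _ _ _ _ (@eventually_filter)).
have [N HN] : exists N : nat, `|x.1| + `|x.2| <= N%:R.
  by exists (Num.truncn (`|x.1| + `|x.2|)).+1; rewrite ltW// truncnS_gt.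
exists N => // n /= Nn; rewrite indicE mem_set ?mulr1//; apply/boxE.
have h : `|x.1| + `|x.2| <= n%:R by apply: (le_trans HN); rewrite ler_nat.
by have := normr_ge0 x.1; have := normr_ge0 x.2; split; lra.
Qed.

Lemma box_integrable_test g h (D M : R) : box_integrable g ->
  measurable_fun [set: plane R] h -> (forall x, `|h x| <= D) ->
  (forall x, ~ box M x -> h x = 0) -> integrable (fun x => g x * h x).
Proof.
move=> gI mh hD h0.
have := @integrable_mulb _ (plane R) R mu _ _ D (gI M) mh hD.
congr (_.-integrable _ _); apply/funext => x /=; rewrite indicE.
have [xM|xM] := pselect (box M x); first by rewrite mem_set// mulr1.
by rewrite h0// !mulr0.
Qed.

Definition cbox_integrable u := box_integrable (fun x => re (u x)) /\
  box_integrable (fun x => im (u x)).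

Lemma cloc_integrableP u : cloc_integrable u <-> cbox_integrable u.
Proof.
split=> [uI|[I1 I2] K cK].
  by split; apply: compact_box_integrable => K /uI [].
by split; [exact: box_integrableP I1 _ _|exact: box_integrableP I2 _ _].
Qed.

Lemma cloc_measurable u : cloc_integrable u -> cmeasurable u.
Proof. by move=> /cloc_integrableP[I1 I2]; split; exact: box_integrable_measurable. Qed.

Definition cpair u h : C := cint (fun x => u x * (h x)%:C).

Lemma cpairE u h : cpair u h = (\int[mu]_x (re (u x) * h x)) +i* (\int[mu]_x (im (u x) * h x)).
Proof.
rewrite /cpair /cint; congr (_ +i* _); apply: eq_Rintegral => x _;
  by case: (u x) => a b /=; ring.
Qed.

Definition pairable u h := integrable (fun x => re (u x) * h x) /\
  integrable (fun x => im (u x) * h x).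

Lemma cloc_pairable u chi : cloc_integrable u -> test_function chi ->
  pairable u chi /\ forall k, pairable u (dpartial k chi).
Proof.
move=> /cloc_integrableP[I1 I2] tchi; have [M [D [c0 d0 cD dD]]] := test_bounds tchi.
have mc := plane_continuous_measurable (test_continuous tchi).
split; first by split; exact: box_integrable_test mc cD c0.
move=> k; have md := plane_continuous_measurable (dpartial_continuous (k := k) tchi).
by split; exact: box_integrable_test md (dD k) (d0 k).
Qed.

Lemma pairable_scale (a : C) u h : pairable u h -> pairable (fun x => a * u x) h.
Proof.
case: a => a1 a2 [i1 i2]; split.
  have := integrable_subr (integrable_scale a1 i1) (integrable_scale a2 i2).
  by congr (_.-integrable _ _); apply/funext => x /=; case: (u x) => ? ? /=; rewrite mulrBl !mulrA.
have := integrable_addr (integrable_scale a1 i2) (integrable_scale a2 i1).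
by congr (_.-integrable _ _); apply/funext => x /=; case: (u x) => ? ? /=; rewrite mulrDl !mulrA.
Qed.

Lemma pairable_add u w h : pairable u h -> pairable w h -> pairable (fun x => u x + w x) h.
Proof.
move=> [i1 i2] [j1 j2]; split.
  have := integrable_addr i1 j1; congr (_.-integrable _ _); apply/funext => x /=.
  by case: (u x) (w x) => ? ? [? ?] /=; rewrite mulrDl.
have := integrable_addr i2 j2; congr (_.-integrable _ _); apply/funext => x /=.
by case: (u x) (w x) => ? ? [? ?] /=; rewrite mulrDl.
Qed.

Lemma cpair_add u w h : pairable u h -> pairable w h ->
  cpair (fun x => u x + w x) h = cpair u h + cpair w h.
Proof.
move=> [u1 u2] [w1 w2]; rewrite !cpairE.
rewrite [RHS](_ : _ = (\int[mu]_x (re (u x) * h x) + \int[mu]_x (re (w x) * h x)) +i*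
   (\int[mu]_x (im (u x) * h x) + \int[mu]_x (im (w x) * h x)))//.
rewrite -(plane_int_add u1 w1) -(plane_int_add u2 w2).
by congr (_ +i* _); apply: eq_Rintegral => x _; case: (u x) (w x) => a b [c d] /=; ring.
Qed.

Lemma cpair_scale (a : C) u h : pairable u h ->
  cpair (fun x => a * u x) h = a * cpair u h.
Proof.
case: a => a b [u1 u2]; rewrite !cpairE.
rewrite [RHS](_ : _ = (a * \int[mu]_x (re (u x) * h x) + - b * \int[mu]_x (im (u x) * h x)) +i*
   (a * \int[mu]_x (im (u x) * h x) + b * \int[mu]_x (re (u x) * h x))); last first.
  by rewrite mulNr.
rewrite -!(plane_int_scale _ u1) -!(plane_int_scale _ u2).
rewrite -(plane_int_add (integrable_scale _ u1) (integrable_scale _ u2)).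
rewrite -(plane_int_add (integrable_scale _ u2) (integrable_scale _ u1)).
by congr (_ +i* _); apply: eq_Rintegral => x _; case: (u x) => c d /=; ring.
Qed.

Lemma cpair_ae u w h : cmeasurable u -> cmeasurable w -> measurable_fun [set: plane R] h ->
  {ae mu, forall x, u x = w x} -> cpair u h = cpair w h.
Proof.
move=> [u1 u2] [w1 w2] mh uw; rewrite !cpairE; congr (_ +i* _);
  (apply: ae_eq_Rintegral; [exact: measurable_funM|exact: measurable_funM|]);
  by apply: filterS uw => x ->.
Qed.

(** Test functions separate, so a weak derivative is determined almost everywhere; this
    transfers explicit computations to the representative chosen by [weak_partial]. *)
Lemma weak_partial_unique k u w w' : is_weak_partial k u w -> is_weak_partial k u w' ->
  {ae mu, forall x, w x = w' x}.
Proof.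
move=> [_ wI Hw] [_ w'I Hw'].
have E chi : test_function chi -> cpair w chi = cpair w' chi.
  by move=> tchi; apply: oppr_inj; rewrite -[LHS]Hw// -[RHS]Hw'.
have S (g g' : R * R -> R) : measurable_fun [set: plane R] g -> measurable_fun [set: plane R] g' ->
    box_integrable g -> box_integrable g' ->
    (forall chi, test_function chi -> \int[mu]_x (g x * chi x) = \int[mu]_x (g' x * chi x)) ->
    {ae mu, forall x, g x = g' x}.
  move=> mg mg' Ig Ig' gg'.
  have : {ae mu, forall x, g x - g' x = 0}.
    apply: test_functions_separate.
    - exact: measurable_funB.
    - move=> M; apply: box_integrable_on.
      have := integrable_subr (Ig M) (Ig' M); congr (_.-integrable _ _).
      by apply/funext => x /=; rewrite mulrBl.
    - move=> chi tchi; have [M [D [c0 d0 cD dD]]] := test_bounds tchi.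
      have mc := plane_continuous_measurable (test_continuous tchi).
      have i1 := box_integrable_test Ig mc cD c0; have i2 := box_integrable_test Ig' mc cD c0.
      under eq_Rintegral do rewrite mulrBl.
      by rewrite (plane_int_sub i1 i2) gg'// subrr.
  by apply: filterS => x /eqP; rewrite subr_eq0 => /eqP.
have [m1 m2] := cloc_measurable wI; have [m1' m2'] := cloc_measurable w'I.
have /cloc_integrableP[b1 b2] := wI; have /cloc_integrableP[b1' b2'] := w'I.
have H1 : {ae mu, forall x, re (w x) = re (w' x)}.
  apply: S => // chi tchi; have := E _ tchi; rewrite !cpairE; by case.
have H2 : {ae mu, forall x, im (w x) = im (w' x)}.
  apply: S => // chi tchi; have := E _ tchi; rewrite !cpairE; by case.
apply: filterS2 H1 H2 => x; by case: (w x) (w' x) => a b [c d] /= -> ->.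
Qed.

Lemma weak_partialP k u w : is_weak_partial k u w ->
  is_weak_partial k u (weak_partial k u) /\ {ae mu, forall x, weak_partial k u x = w x}.
Proof.
move=> H; have H' : is_weak_partial k u (weak_partial k u).
  by apply: (@xgetPex _ (fun=> 0) [set w | is_weak_partial k u w]); exists w.
by split => //; exact: weak_partial_unique H' H.
Qed.

Definition ctame u := tame (fun x => re (u x)) /\ tame (fun x => im (u x)).

(** For [K = lnk] this is the operator [G0s], and for [K = rk k] its gradient. *)
Definition cpotential (K : R * R -> R) u x : C :=
  (- (2 * pi)^-1 * potential K (fun y => re (u y)) x) +i*
  (- (2 * pi)^-1 * potential K (fun y => im (u y)) x).

Lemma G0sE u : G0s u = cpotential (@lnk R) u.
Proof.
apply/funext => x; rewrite /G0s /cpotential /cint /potential.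
rewrite (_ : \int[mu]_y complex.Re _ = \int[mu]_y (lnk (psub x y) * re (u y))); last first.
  by apply: eq_Rintegral => y _; case: (u y) => a b /=; rewrite /lnk /psub mul0r subr0.
rewrite (_ : \int[mu]_y complex.Im _ = \int[mu]_y (lnk (psub x y) * im (u y))); last first.
  by apply: eq_Rintegral => y _; case: (u y) => a b /=; rewrite /lnk /psub mul0r addr0.
apply/eqP; rewrite eq_complex /= oppr0 !mul0r subr0 addr0 !eqxx//.
Qed.

Lemma cpotential_cloc K u : mild_kernel K -> ctame u -> cloc_integrable (cpotential K u).
Proof.
move=> mK [t1 t2]; apply/cloc_integrableP; split=> M.
  have := integrable_scale (- (2 * pi)^-1) (potential_box t1 M mK).
  by congr (_.-integrable _ _); apply/funext => x /=; rewrite mulrA.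
have := integrable_scale (- (2 * pi)^-1) (potential_box t2 M mK).
by congr (_.-integrable _ _); apply/funext => x /=; rewrite mulrA.
Qed.

Lemma cpotential_pair K u h : mild_kernel K -> ctame u ->
  integrable (fun x => potential K (fun y => re (u y)) x * h x) ->
  integrable (fun x => potential K (fun y => im (u y)) x * h x) ->
  cpair (cpotential K u) h =
   (- (2 * pi)^-1 * \int[mu]_x (potential K (fun y => re (u y)) x * h x)) +i*
   (- (2 * pi)^-1 * \int[mu]_x (potential K (fun y => im (u y)) x * h x)).
Proof.
move=> mK tu i1 i2; rewrite cpairE.
congr (_ +i* _).
  by rewrite -(plane_int_scale _ i1); apply: eq_Rintegral => x _; exact: esym (mulrA _ _ _).
by rewrite -(plane_int_scale _ i2); apply: eq_Rintegral => x _; exact: esym (mulrA _ _ _).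
Qed.

Section PotentialPairing.
Variables (u : R * R -> C) (tu : ctame u).

Let pairs K chi : mild_kernel K -> test_function chi ->
  (integrable (fun x => potential K (fun y => re (u y)) x * chi x) /\
   integrable (fun x => potential K (fun y => im (u y)) x * chi x)) /\
  forall k, integrable (fun x => potential K (fun y => re (u y)) x * dpartial k chi x) /\
   integrable (fun x => potential K (fun y => im (u y)) x * dpartial k chi x).
Proof.
move=> mK tchi; have [t1 t2] := tu.
have [M [D [c0 d0 cD dD]]] := test_bounds tchi.
have mc := plane_continuous_measurable (test_continuous tchi).
split; first by split; apply: potential_pairing_integrable cD c0.
move=> k; have md := plane_continuous_measurable (dpartial_continuous (k := k) tchi).
by split; apply: potential_pairing_integrable (dD k) (d0 k).
Qed.

(** The real identity for the logarithmic potential, applied to both parts. *)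
Lemma G0s_weak_partial k : is_weak_partial k (G0s u) (cpotential (rk k) u).
Proof.
have [t1 t2] := tu; rewrite G0sE; split.
- exact: cpotential_cloc (@mild_lnk R) tu.
- exact: cpotential_cloc (@mild_rk R k) tu.
move=> chi tchi; rewrite -/(cpair _ _) -/(cpair _ chi).
have [_ /(_ k)[i1 i2]] := pairs (@mild_lnk R) tchi.
have [[j1 j2] _] := pairs (@mild_rk R k) tchi.
rewrite (cpotential_pair (@mild_lnk R) tu i1 i2) (cpotential_pair (@mild_rk R k) tu j1 j2).
apply: complex_oppE; rewrite -mulrN; congr (_ * _).
  exact: (potential_gradient t1 k tchi).
exact: (potential_gradient t2 k tchi).
Qed.

Lemma cpotential_curl chi : test_function chi ->
  cpair (cpotential (rk 0) u) (dpartial 1 chi) = cpair (cpotential (rk 1) u) (dpartial 0 chi).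
Proof.
move=> tchi; have [t1 t2] := tu.
have [_ /(_ 1)[i1 i2]] := pairs (@mild_rk R 0) tchi.
have [_ /(_ 0)[j1 j2]] := pairs (@mild_rk R 1) tchi.
rewrite (cpotential_pair (@mild_rk R 0) tu i1 i2) (cpotential_pair (@mild_rk R 1) tu j1 j2).
exact: (congr2 (fun s t => (- (2 * pi)^-1 * s) +i* (- (2 * pi)^-1 * t))
  (potential_curl t1 tchi) (potential_curl t2 tchi)).
Qed.

Lemma cpotential_laplacian chi : test_function chi ->
  cpair (cpotential (rk 0) u) (dpartial 0 chi) + cpair (cpotential (rk 1) u) (dpartial 1 chi) =
  cpair u chi.
Proof.
move=> tchi; have [t1 t2] := tu.
have [_ /(_ 0)[i1 i2]] := pairs (@mild_rk R 0) tchi.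
have [_ /(_ 1)[j1 j2]] := pairs (@mild_rk R 1) tchi.
rewrite (cpotential_pair (@mild_rk R 0) tu i1 i2) (cpotential_pair (@mild_rk R 1) tu j1 j2).
have pn : 2 * pi != 0 :> R by rewrite mulf_neq0// gt_eqF// pi_gt0.
have c a : - (2 * pi)^-1 * (- (2 * pi) * a) = a :> R by rewrite mulrA mulrNN mulVf// mul1r.
rewrite cpairE; apply: complex_addE; rewrite -mulrDr.
  by apply: etrans (c _); congr (_ * _); exact: (potential_laplacian t1 tchi).
by apply: etrans (c _); congr (_ * _); exact: (potential_laplacian t2 tchi).
Qed.

End PotentialPairing.
End ComplexFunctions.

(** * Bounds for complex-valued functions *)

Section ComplexBounds.
Variable R : realType.
Local Notation C := (R[i])%C.
Local Notation mu := (leb2 R).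
Local Notation "'re' z" := (complex.Re z) (at level 10, z at level 8).
Local Notation "'im' z" := (complex.Im z) (at level 10, z at level 8).
Local Notation normc := ComplexField.Normc.normc.
Local Open Scope complex_scope.
Implicit Types (x y : R * R) (u w : R * R -> C) (a b z : C) (j k : 'I_2).
Local Notation integrable f := (mu.-integrable [set: plane R] (EFin \o f)).

(** An equivalent norm on complex numbers that is additive in the two parts, for which
    integrals split without square roots. *)
Definition abs1 z : R := `|re z| + `|im z|.

Lemma abs1_ge0 z : 0 <= abs1 z.
Proof. by rewrite addr_ge0. Qed.

Lemma abs1D a b : abs1 (a + b) <= abs1 a + abs1 b.
Proof.
rewrite /abs1; case: a b => a1 a2 [b1 b2] /=.
by have := ler_normD a1 b1; have := ler_normD a2 b2; lra.
Qed.

Lemma abs1N a : abs1 (- a) = abs1 a.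
Proof. by rewrite /abs1; case: a => a1 a2 /=; rewrite !normrN. Qed.

Lemma abs1M a b : abs1 (a * b) <= abs1 a * abs1 b.
Proof.
rewrite /abs1; case: a b => a1 a2 [b1 b2] /=.
have h1 := ler_normB (a1 * b1) (a2 * b2); have h2 := ler_normD (a1 * b2) (a2 * b1).
move: h1 h2; rewrite !normrM => h1 h2.
by rewrite mulrDr !mulrDl; lra.
Qed.

Lemma abs1_conj z : abs1 z^* = abs1 z.
Proof. by case: z => a b; rewrite /abs1/= normrN. Qed.

Lemma abs1_re (r : R) : abs1 r%:C = `|r|.
Proof. by rewrite /abs1/= normr0 addr0. Qed.

Lemma normc_sqr z : normc z ^+ 2 = re z ^+ 2 + im z ^+ 2.
Proof. by case: z => a b; rewrite /= sqr_sqrtr// addr_ge0 ?sqr_ge0. Qed.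

Lemma normc_ge0 z : 0 <= normc z.
Proof. by case: z => a b; exact: sqrtr_ge0. Qed.

Lemma normc_le_abs1 z : normc z <= abs1 z.
Proof.
rewrite -(@ler_pXn2r _ 2) ?nnegrE ?normc_ge0 ?abs1_ge0// normc_sqr /abs1 sqrrD.
rewrite !real_normK ?num_real// -addrA [X in _ <= _ + X]addrC addrA lerDl mulrn_wge0//.
Qed.

Lemma abs1_le_normc z : abs1 z <= 2 * normc z.
Proof.
have h (r s : R) : `|r| <= Num.sqrt (r ^+ 2 + s ^+ 2).
  by rewrite -sqrtr_sqr ler_wsqrtr// lerDl sqr_ge0.
case: z => r s; rewrite /abs1 /=; have := h r s; have := h s r.
by rewrite [s ^+ 2 + _]addrC; lra.
Qed.

Lemma re_le_abs1 z : `|re z| <= abs1 z.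
Proof. by rewrite lerDl. Qed.

Lemma im_le_abs1 z : `|im z| <= abs1 z.
Proof. by rewrite lerDr. Qed.

Lemma cmeasurable_cst a : cmeasurable (fun=> a : C).
Proof. by split; exact: measurable_cst. Qed.

Lemma cmeasurable_real (f : R * R -> R) : measurable_fun [set: plane R] f ->
  cmeasurable (fun x => (f x)%:C).
Proof. by move=> mf; split => //; exact: measurable_cst. Qed.

Lemma cmeasurableD u w : cmeasurable u -> cmeasurable w -> cmeasurable (fun x => u x + w x).
Proof.
move=> [u1 u2] [w1 w2]; split.
  rewrite (_ : (fun x => _) = (fun x => re (u x) + re (w x))); first exact: measurable_funD.
  by apply/funext => x; case: (u x) (w x) => [? ?] [? ?].
rewrite (_ : (fun x => _) = (fun x => im (u x) + im (w x))); first exact: measurable_funD.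
by apply/funext => x; case: (u x) (w x) => [? ?] [? ?].
Qed.

Lemma cmeasurableM u w : cmeasurable u -> cmeasurable w -> cmeasurable (fun x => u x * w x).
Proof.
move=> [u1 u2] [w1 w2]; split.
  rewrite (_ : (fun x => _) = (fun x => re (u x) * re (w x) - im (u x) * im (w x))).
    by apply: measurable_funB; exact: measurable_funM.
  by apply/funext => x; case: (u x) (w x) => [? ?] [? ?].
rewrite (_ : (fun x => _) = (fun x => re (u x) * im (w x) + im (u x) * re (w x))).
  by apply: measurable_funD; exact: measurable_funM.
by apply/funext => x; case: (u x) (w x) => [? ?] [? ?].
Qed.

Lemma cmeasurable_conj u : cmeasurable u -> cmeasurable (fun x => (u x)^*).
Proof.
move=> [u1 u2]; split.
  rewrite (_ : (fun x => _) = (fun x => re (u x))) //.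
  by apply/funext => x; case: (u x).
rewrite (_ : (fun x => _) = (fun x => - im (u x))); first exact: measurableT_comp.
by apply/funext => x; case: (u x).
Qed.

Lemma abs1_measurable u : cmeasurable u -> measurable_fun [set: plane R] (fun x => abs1 (u x)).
Proof. by move=> [u1 u2]; apply: measurable_funD; exact: measurableT_comp. Qed.

Lemma cLp2_integrable u : cLp 2%:E u ->
  cmeasurable u /\ integrable (fun x => abs1 (u x) ^+ 2).
Proof.
move=> [mu' L]; split => //; have [m1 m2] := mu'.
have mn : measurable_fun [set: plane R] (fun x => normc (u x) ^+ 2).
  rewrite (_ : (fun x => _) = (fun x => re (u x) ^+ 2 + im (u x) ^+ 2)).
    by apply: measurable_funD; exact: measurable_funX.
  by apply/funext => x; rewrite normc_sqr.
have I : integrable (fun x => normc (u x) ^+ 2).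
  apply: (@ge0_integrable _ (plane R) R mu) => //; first by move=> x; exact: sqr_ge0.
  have e := @poweR_Lnorm _ (plane R) R mu (fun x => (normc (u x))%:E) 2 (lt0r_neq0 (ltr0Sn _ _)).
  have -> : (\int[mu]_x (normc (u x) ^+ 2)%:E =
    \int[mu]_x (`| (normc (u x))%:E | `^ 2%R))%E.
    apply: eq_integral => x _; rewrite abse_EFin ger0_norm ?normc_ge0// poweR_EFin.
    by rewrite powR_mulrn// normc_ge0.
  by rewrite -e; apply: poweR_lty.
apply: (@integrable_dom _ (plane R) R mu _ (fun x => 4 * normc (u x) ^+ 2)).
- by apply: measurable_funX; exact: abs1_measurable.
- move=> x; rewrite ger0_norm ?sqr_ge0// (_ : 4 = 2 ^+ 2); last by ring.
  rewrite -exprMn ler_pXn2r ?nnegrE ?abs1_ge0 ?mulr_ge0 ?normc_ge0//.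
  exact: abs1_le_normc.
- exact: integrable_scale.
Qed.

Lemma cLp2_intro (u : R * R -> C) : cmeasurable u -> integrable (fun x => normc (u x) ^+ 2) ->
  cLp 2%:E u.
Proof.
move=> mu' I; split => //; rewrite unlock; apply: poweR_lty.
rewrite (_ : (\int[mu]_x _ = \int[mu]_x (normc (u x) ^+ 2)%:E)%E).
  by apply: integrable_ltoo => // x; exact: sqr_ge0.
apply: eq_integral => x _; rewrite abse_EFin ger0_norm ?normc_ge0// poweR_EFin.
by rewrite powR_mulrn// normc_ge0.
Qed.

Lemma cLp_infty u (M : R) : cmeasurable u -> {ae mu, forall x, abs1 (u x) <= M} ->
  cLp +oo%E u.
Proof.
move=> mu' uM; split => //; rewrite unlock; case: ifP => _; last exact: ltry.
apply: (@le_lt_trans _ _ M%:E); last exact: ltry.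
apply/ess_supP; apply: filterS uM => x /= h.
by rewrite lee_fin ger0_norm ?normc_ge0// (le_trans (normc_le_abs1 _)).
Qed.

(** An essentially bounded function is first truncated at its essential bound. *)
Lemma cbounded_cloc u (M : R) : cmeasurable u -> {ae mu, forall x, abs1 (u x) <= M} ->
  cloc_integrable u.
Proof.
move=> [m1 m2] uM; apply/cloc_integrableP.
have H (g : R * R -> R) : measurable_fun [set: plane R] g ->
    {ae mu, forall x, `|g x| <= M} -> box_integrable g.
  move=> mg gM N.
  pose h x := (if `|g x| <= M then g x else 0) * \1_(box N) x.
  have mi : measurable_fun [set: plane R] (\1_(box N) : plane R -> R).
    exact: measurable_indic (box_measurable N).
  have Ih : integrable h.
    apply: (@bounded_box_integrable R h N `|M|).
    + apply: measurable_funM => //; apply: measurable_fun_ifT => //.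
      by apply: measurable_fun_ler => //; exact: measurableT_comp.
    + move=> x; rewrite normrM indicE.
      case: ifP => gx; last by rewrite normr0 mul0r.
      by case: (_ \in _); rewrite ?normr1 ?normr0 ?mulr1 ?mulr0// (le_trans gx)// ler_norm.
    + by move=> x xM; rewrite /h indicE memNset// mulr0.
  apply: (ae_eq_integrable _ _ Ih); first exact: measurable_funM.
  by apply: filterS gM => x gx; rewrite /h gx.
split; apply: H => //; apply: filterS uM => x; apply: le_trans.
  exact: re_le_abs1.
exact: im_le_abs1.
Qed.

Lemma ctame_weight u (g : R * R -> R) (K eps : R) : 0 < eps ->
  cmeasurable u -> measurable_fun [set: plane R] g ->
  integrable (fun y => g y ^+ 2) ->
  (forall y, abs1 (u y) <= K * jbracket y `^ (- 1 - eps) * `|g y|) -> ctame u.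
Proof.
move=> e0 [m1 m2] mg ig ug; split; apply: (tame_weight e0 _ mg ig) => // y;
  apply: le_trans (ug y); [exact: re_le_abs1|exact: im_le_abs1].
Qed.

(** The vanishing of the total mass cancels the logarithmic growth. *)
Lemma cpotential_lnk_bounded u : ctame u -> cint u = 0 ->
  exists M, forall x, abs1 (G0s u x) <= M.
Proof.
move=> [t1 t2] u0; have [e1 e2] : \int[mu]_x re (u x) = 0 /\ \int[mu]_x im (u x) = 0.
  by move: u0 => /eqP; rewrite eq_complex /= => /andP[/eqP ? /eqP ?].
have [M1 H1] := lnk_potential_bounded t1 e1; have [M2 H2] := lnk_potential_bounded t2 e2.
exists (`|(2 * pi)^-1| * (M1 + M2)) => x; rewrite G0sE /abs1 /cpotential.
by rewrite /= !normrM normrN -mulrDr ler_wpM2l// lerD//.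
Qed.

Lemma cpotential_rk_le k u x : ctame u ->
  ((abs1 (cpotential (rk k) u x))%:E <=
   `|(2 * pi)^-1|%:E * ((\int[mu]_y abs1 (u y))%:E +
     \int[mu]_y (kap (psub x y) ^+ 3 * abs1 (u y))%:E))%E.
Proof.
move=> [t1 t2]; have [m1 _ _] := t1; have [m2 _ _] := t2.
have k3 y : 0 <= kap (psub x y) ^+ 3 by rewrite exprn_ge0 ?kap_ge0.
have mk : measurable_fun [set: plane R] (fun y => kap (psub x y) ^+ 3).
  exact: kapX_measurable1.
have p1 := potential_rk_le t1 k x; have p2 := potential_rk_le t2 k x.
have i1 := integrable_norm (tame_integrable t1); have i2 := integrable_norm (tame_integrable t2).
have -> : \int[mu]_y abs1 (u y) = \int[mu]_y `|re (u y)| + \int[mu]_y `|im (u y)|.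
  exact: plane_int_add i1 i2.
have -> : (\int[mu]_y (kap (psub x y) ^+ 3 * abs1 (u y))%:E =
   \int[mu]_y (kap (psub x y) ^+ 3 * `|re (u y)|)%:E +
   \int[mu]_y (kap (psub x y) ^+ 3 * `|im (u y)|)%:E)%E.
  rewrite -ge0_integralD//.
  - by apply: eq_integral => y _; rewrite -EFinD -mulrDr.
  - by move=> y _; rewrite lee_fin mulr_ge0.
  - by apply/measurable_EFinP; apply: measurable_funM => //; exact: measurableT_comp.
  - by move=> y _; rewrite lee_fin mulr_ge0.
  - by apply/measurable_EFinP; apply: measurable_funM => //; exact: measurableT_comp.
rewrite /abs1 /cpotential /= !normrM normrN -mulrDr EFinM lee_wpmul2l ?lee_fin//.
by rewrite !EFinD addeACA leeD.
Qed.
End ComplexBounds.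

(** * Factorization of the matrix potential and the orthogonality relation *)

Section Factorization.
Variable R : realType.
Local Notation C := (R[i])%C.
Local Open Scope complex_scope.
Local Open Scope sesquilinear_scope.
Variables (V B : R * R -> 'M[C]_2) (lam : 'I_2 -> R * R -> R).
Hypotheses (VE : forall x, V x = (B x)^t* *m diagC (fun j => lam j x) *m B x).

Lemma diagC_mul (d e : 'I_2 -> R) : diagC d *m diagC e = diagC (fun j => d j * e j).
Proof.
rewrite /diagC mulmx_diag; congr diag_mx; apply/rowP => j; rewrite !mxE.
by apply/eqP; rewrite eq_complex /= !mul0r !mulr0 subr0 addr0 !eqxx.
Qed.

Lemma diagC_adj (d : 'I_2 -> R) : (diagC d)^t* = diagC d.
Proof.
apply/matrixP => i j; rewrite !mxE eq_sym; case: (eqVneq i j) => [->|_]; rewrite ?mulr1n ?mulr0n.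
  by apply/eqP; rewrite eq_complex /= oppr0 !eqxx.
exact: conjC0.
Qed.

Lemma Umx_sqr x : Umx lam x *m Umx lam x = 1%:M.
Proof.
rewrite /Umx diagC_mul; apply/matrixP => i j; rewrite !mxE.
case: (eqVneq i j) => [->|_]; rewrite ?mulr1n ?mulr0n//.
by rewrite /sgn1; case: ifP => _; rewrite ?mulr1 ?mulrNN ?mulr1.
Qed.

(** Entrywise, [sqrt |r| * sign r * sqrt |r| = r], with the sign of [0] equal to [1]. *)
Lemma potential_factor x : V x = (vmx lam B x)^t* *m (Umx lam x *m vmx lam B x).
Proof.
rewrite VE /vmx /Umx trmx_mul map_mxM/= -/((B x)^t*) -/((diagC _)^t*) diagC_adj.
rewrite -!mulmxA; congr (_ *m _); rewrite !mulmxA; congr (_ *m _).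
rewrite !diagC_mul; congr diagC; apply/funext => j; rewrite /sgn1.
set r := lam j x; have h : Num.sqrt `|r| * Num.sqrt `|r| = `|r| by rewrite -expr2 sqr_sqrtr.
case: ifP => r0; rewrite ?mulr1 ?mulrN1 ?mulNr h; first by rewrite ger0_norm.
by rewrite ler0_norm ?opprK// ltW// ltNge r0.
Qed.

End Factorization.

Section Orthogonality.
Variable R : realType.
Local Notation normc := ComplexField.Normc.normc.
Local Notation C := (R[i])%C.
Local Notation mu := (leb2 R).
Local Notation "'re' z" := (complex.Re z) (at level 10, z at level 8).
Local Notation "'im' z" := (complex.Im z) (at level 10, z at level 8).
Local Open Scope complex_scope.
Local Open Scope sesquilinear_scope.
Implicit Types (f g w : R * R -> 'cV[C]_2) (u : R * R -> C).
Local Notation integrable f := (mu.-integrable [set: plane R] (EFin \o f)).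

Lemma sum2E (T : zmodType) (F : 'I_2 -> T) : \sum_j F j = F 0 + F 1.
Proof. by rewrite !big_ord_recl big_ord0 addr0; congr (F _ + F _); exact/val_inj. Qed.

Lemma dotE (a b : 'cV[C]_2) : (a^t* *m b) 0 0 = (a 0 0)^* * b 0 0 + (a 1 0)^* * b 1 0.
Proof. by rewrite mxE sum2E !mxE. Qed.

(** Linearity of the integral is inherited from the pairing with the constant [1]. *)
Lemma cint_pair u : cint u = cpair u (fun=> 1).
Proof. by rewrite /cpair; congr cint; apply/funext => x; rewrite mulr1. Qed.

Lemma vLp2_measurable f j : vLp 2%:E f -> cmeasurable (coordf f j).
Proof. by move=> /(_ j) /cLp2_integrable []. Qed.

Definition dot f g x : C := ((f x)^t* *m g x) 0 0.

Lemma dot_measurable f g : (forall j, cmeasurable (coordf f j)) ->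
  (forall j, cmeasurable (coordf g j)) -> cmeasurable (dot f g).
Proof.
move=> mf mg; rewrite (_ : dot f g = (fun x => (coordf f 0 x)^* * coordf g 0 x + (coordf f 1 x)^* * coordf g 1 x)).
  by apply: cmeasurableD; apply: cmeasurableM => //; exact: cmeasurable_conj.
by apply/funext => x; rewrite /dot dotE.
Qed.

Lemma dot_pairable f g : vLp 2%:E f -> vLp 2%:E g -> pairable (dot f g) (fun=> 1).
Proof.
move=> Lf Lg.
have [m1 m2] := dot_measurable (fun j => vLp2_measurable j Lf) (fun j => vLp2_measurable j Lg).
have I j : integrable (fun x => abs1 (f x j 0) * abs1 (g x j 0)).
  have [mf If] := cLp2_integrable (Lf j); have [mg Ig] := cLp2_integrable (Lg j).
  by apply: (@integrable_mul2 _ (plane R) R mu) => //; exact: abs1_measurable.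
have le x : abs1 (dot f g x) <= abs1 (f x 0 0) * abs1 (g x 0 0) + abs1 (f x 1 0) * abs1 (g x 1 0).
  rewrite /dot dotE; apply: le_trans (abs1D _ _) _.
  by apply: lerD; apply: le_trans (abs1M _ _) _; rewrite abs1_conj.
split; apply: (@integrable_dom _ (plane R) R mu _ _ _ _ (integrable_addr (I 0) (I 1))).
- exact: measurable_funM.
- by move=> x; rewrite mulr1; apply: le_trans (le x); exact: re_le_abs1.
- exact: measurable_funM.
- by move=> x; rewrite mulr1; apply: le_trans (le x); exact: im_le_abs1.
Qed.

Lemma L2innerE f g : L2inner f g = cpair (dot f g) (fun=> 1).
Proof. by rewrite -cint_pair. Qed.

Lemma L2inner_self w : vLp 2%:E w -> L2inner w w = (L2norm w ^+ 2)%:C.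
Proof.
move=> Lw; rewrite /L2norm sqr_sqrtr; last first.
  by apply: Rintegral_ge0 => x _; apply: sumr_ge0 => j _; rewrite sqr_ge0.
rewrite /L2inner /cint; apply/eqP; rewrite eq_complex /=; apply/andP; split; apply/eqP.
  apply: eq_Rintegral => x _; rewrite -/(dot w w x) /dot dotE.
  rewrite sum2E !normc_sqr.
  by case: (w x 0 0) (w x 1 0) => a b [c d] /=; ring.
rewrite (_ : \int[mu]_x _ = \int[mu]_x (cst 0 x : R)).
  by rewrite /Rintegral integral0.
apply: eq_Rintegral => x _; rewrite -/(dot w w x) /dot dotE /=.
by case: (w x 0 0) (w x 1 0) => a b [c d] /=; ring.
Qed.

(** A nonnegative function with vanishing integral is zero almost everywhere. *)
Lemma L2norm_neq0 (u : R * R -> 'cV[C]_2) : vLp 2%:E u -> ~ {ae mu, forall x, u x = 0} ->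
  L2norm u != 0.
Proof.
move=> Lu; apply: contra_notN => /eqP n0.
have I j : integrable (fun x => normc (u x j 0) ^+ 2).
  have [mj Ij] := cLp2_integrable (Lu j); have [m1 m2] := mj.
  apply: (@integrable_dom _ (plane R) R mu _ _ _ _ Ij).
    rewrite (_ : (fun x => _) = (fun x => re (coordf u j x) ^+ 2 + im (coordf u j x) ^+ 2)).
      by apply: measurable_funD; exact: measurable_funX.
    by apply/funext => x; rewrite normc_sqr.
  move=> x; rewrite ger0_norm ?sqr_ge0// ler_pXn2r ?nnegrE ?normc_ge0 ?abs1_ge0//.
  exact: normc_le_abs1.
have Is := integrable_addr (I 0) (I 1).
pose s x := normc (u x 0 0) ^+ 2 + normc (u x 1 0) ^+ 2.
have s0 x : 0 <= s x by rewrite addr_ge0 ?sqr_ge0.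
have sE : (fun x => \sum_j normc (u x j 0) ^+ 2) = s by apply/funext => x; rewrite sum2E.
have : \int[mu]_x s x = 0.
  have q : 0 <= \int[mu]_x s x by apply: Rintegral_ge0.
  apply/eqP; rewrite eq_le q andbT -sqrtr_eq0; move: n0; rewrite /L2norm.
  by rewrite sE => ->.
move=> s00.
have /(ae_eq_integral_abs mu measurableT (measurable_int _ Is)) : (\int[mu]_x `|(s x)%:E| = 0)%E.
  rewrite (_ : (\int[mu]_x _ = \int[mu]_x (s x)%:E)%E); last first.
    by apply: eq_integral => x _; rewrite abse_EFin ger0_norm.
  have fin := integrable_fin_num measurableT Is.
  by have := fineK fin => <-; congr (_%:E); exact: s00.
apply: filterS => x /= /(_ Logic.I) [] /eqP; rewrite paddr_eq0 ?sqr_ge0// !sqrf_eq0 => /andP[/eqP h0 /eqP h1].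
have z (c : C) : normc c = 0 -> c = 0 by move/ComplexField.Normc.eq0_normc.
by apply/colP => j; rewrite mxE; case: (ord2P j) => ->; exact: z.
Qed.

(** Subtracting the projection removes the component along [w]. *)
Lemma Qop_orthogonal w g phi : vLp 2%:E w -> vLp 2%:E g -> L2norm w != 0 ->
  vLp 2%:E phi -> {ae mu, forall x, phi x = Qop w g x} -> L2inner w phi = 0.
Proof.
move=> Lw Lg w0 Lphi ae.
have Pg := dot_pairable Lw Lg; have Pw := dot_pairable Lw Lw.
set c := L2inner w g / (L2norm w ^+ 2)%:C.
have mw := dot_measurable (fun j => vLp2_measurable j Lw) (fun j => vLp2_measurable j Lw).
have mg := dot_measurable (fun j => vLp2_measurable j Lw) (fun j => vLp2_measurable j Lg).
have mphi := dot_measurable (fun j => vLp2_measurable j Lw) (fun j => vLp2_measurable j Lphi).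
have Pcw := pairable_scale (- c) Pw.
rewrite L2innerE (@cpair_ae _ _ (fun x => dot w g x + - c * dot w w x)) //; first last.
- apply: filterS ae => x e; rewrite /dot e /Qop /Pop -/c mulmxBr -scalemxAr !mxE.
  by rewrite mulNr.
- by apply: cmeasurableD => //; apply: cmeasurableM => //; exact: cmeasurable_cst.
rewrite cpair_add// cpair_scale// -!L2innerE L2inner_self// /c mulNr mulfVK ?subrr//.
apply/eqP => /(congr1 (@complex.Re _)) /= /eqP; rewrite sqrf_eq0; exact/negP.
Qed.

End Orthogonality.

(** * Threshold solutions of the Dirac operator *)

Section DiracMatrices.
Variable R : realType.
Local Notation C := (R[i])%C.
Local Open Scope complex_scope.
Local Open Scope sesquilinear_scope.
Implicit Types (a b : 'cV[C]_2).

Lemma diagC_entry (d : 'I_2 -> R) (A : 'M[C]_2) i j : (diagC d *m A) i j = (d i)%:C * A i j.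
Proof. by rewrite /diagC mul_diag_mx !mxE. Qed.

Lemma adj_entry (A : 'M[C]_2) i j : (A^t*) i j = (A j i)^*.
Proof. by rewrite !mxE. Qed.

Lemma col_add a b j : (a + b) j 0 = a j 0 + b j 0.
Proof. by rewrite mxE. Qed.

Lemma col_opp a j : (- a) j 0 = - a j 0.
Proof. by rewrite mxE. Qed.

Lemma col_scale (c : C) a j : (c *: a) j 0 = c * a j 0.
Proof. by rewrite mxE. Qed.

Lemma alpha0_0 a : (dirac_alpha R 0 *m a) 0 0 = a 1 0.
Proof. by rewrite mxE sum2E !mxE /= mul0r mul1r add0r. Qed.

Lemma alpha0_1 a : (dirac_alpha R 0 *m a) 1 0 = a 0 0.
Proof. by rewrite mxE sum2E !mxE /= mul0r mul1r addr0. Qed.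

Lemma alpha1_0 a : (dirac_alpha R 1 *m a) 0 0 = - 'i * a 1 0.
Proof. by rewrite mxE sum2E !mxE /= mul0r add0r. Qed.

Lemma alpha1_1 a : (dirac_alpha R 1 *m a) 1 0 = 'i * a 0 0.
Proof. by rewrite mxE sum2E !mxE /= mul0r addr0. Qed.

Lemma beta_0 a : (dirac_beta R *m a) 0 0 = a 0 0.
Proof. by rewrite mxE sum2E !mxE /= mul0r addr0 mul1r. Qed.

Lemma beta_1 a : (dirac_beta R *m a) 1 0 = - a 1 0.
Proof. by rewrite mxE sum2E !mxE /= mul0r add0r mulN1r. Qed.

Lemma e1E j : e1 R j 0 = (j == 0)%:R.
Proof. by rewrite mxE eqxx andbT. Qed.

Let sqr_i : ('i : C) * 'i = - 1.
Proof. by rewrite -expr2 sqrCi. Qed.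

(** Upper component of the first order operator that defines [psi]. *)
Lemma dirac_0 (c d : C) (a : 'I_2 -> 'cV[C]_2) g :
  (c *: e1 R - (- 'i *: (\sum_k dirac_alpha R k *m a k) + d *: g)) 0 0 =
  c + 'i * a 0 1 0 + a 1 1 0 - d * g 0 0.
Proof.
rewrite sum2E col_add col_opp col_add !col_scale col_add alpha0_0 alpha1_0 e1E eqxx mulr1n.
by set p := a 0 1 0; set q := a 1 1 0; ring: sqr_i.
Qed.

Lemma dirac_1 (c d : C) (a : 'I_2 -> 'cV[C]_2) g :
  (c *: e1 R - (- 'i *: (\sum_k dirac_alpha R k *m a k) + d *: g)) 1 0 =
  'i * a 0 0 0 - a 1 0 0 - d * g 1 0.
Proof.
rewrite sum2E col_add col_opp col_add !col_scale col_add alpha0_1 alpha1_1 e1E mulr0n.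
by ring: sqr_i.
Qed.

(** In the upper component the mass terms cancel at the threshold. *)
Lemma dirac_pairing_0 (c : C) (a : 'I_2 -> 'cV[C]_2) p q :
  (- 'i *: (\sum_k dirac_alpha R k *m a k) + c *: (dirac_beta R *m p) + q - c *: p) 0 0 =
  - 'i * a 0 1 0 - a 1 1 0 + q 0 0.
Proof.
rewrite sum2E !col_add col_opp !col_scale col_add alpha0_0 alpha1_0 beta_0.
by ring: sqr_i.
Qed.

(** In the lower component the mass terms add up to [- 2 * c]. *)
Lemma dirac_pairing_1 (c : C) (a : 'I_2 -> 'cV[C]_2) p q :
  (- 'i *: (\sum_k dirac_alpha R k *m a k) + c *: (dirac_beta R *m p) + q - c *: p) 1 0 =
  - 'i * a 0 0 0 + a 1 0 0 - 2 * c * p 1 0 + q 1 0.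
Proof.
rewrite sum2E !col_add col_opp !col_scale col_add alpha0_1 alpha1_1 beta_1.
by ring: sqr_i.
Qed.

End DiracMatrices.

Section Threshold.
Variable R : realType.
Local Notation C := (R[i])%C.
Local Notation mu := (leb2 R).
Local Notation "'re' z" := (complex.Re z) (at level 10, z at level 8).
Local Notation "'im' z" := (complex.Im z) (at level 10, z at level 8).
Local Notation normc := ComplexField.Normc.normc.
Local Open Scope complex_scope.
Local Open Scope sesquilinear_scope.
Local Notation integrable f := (mu.-integrable [set: plane R] (EFin \o f)).
Variables (m : R) (V B : R * R -> 'M[C]_2) (lam : 'I_2 -> R * R -> R).
Hypotheses (B_measurable : forall i j, cmeasurable (fun x => B x i j))
  (lam_measurable : forall j, measurable_fun [set: plane R] (lam j))
  (V_diag : forall x, V x = (B x)^t* *m diagC (fun j => lam j x) *m B x).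
Local Notation U := (Umx lam).
Local Notation v := (vmx lam B).
Let w : R * R -> 'cV[C]_2 := fun x => col 0 (v x).
Hypothesis w_neq0 : ~ {ae mu, forall x, w x = 0}.
Variables (eps K : R).
Hypotheses (eps_gt0 : 0 < eps)
  (decay : forall x i j, normc (v x i j) <= K * jbracket x `^ (- 1 - eps)).

Lemma vmx_measurable i j : cmeasurable (fun x => v x i j).
Proof.
rewrite (_ : (fun x => _) = (fun x => (Num.sqrt `|lam i x|)%:C * B x i j)); last first.
  by apply/funext => x; rewrite /vmx /diagC mul_diag_mx !mxE.
apply: cmeasurableM => //; apply: cmeasurable_real.
apply: (measurableT_comp (continuous_measurable_fun (@sqrt_continuous R))).
exact: measurableT_comp.
Qed.

Lemma jbracket_powR_sqr x : (jbracket x `^ (- 1 - eps)) ^+ 2 = (1 + nsq x) `^ (- 1 - eps).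
Proof.
have p : 0 <= 1 + nsq x by rewrite addr_ge0// nsq_ge0.
rewrite jbracketE -powR12_sqrt// -powRrM -powR_mulrn ?powR_ge0// -powRrM.
by congr (_ `^ _); lra.
Qed.

Let K0 : 0 <= K.
Proof.
have := le_trans (normc_ge0 _) (decay (0, 0) 0 0).
by rewrite pmulr_lge0// powR_gt0// (lt_le_trans ltr01)// jbracket_ge1.
Qed.

(** The decay rate exceeds the critical exponent of square integrability. *)
Lemma w_Lp2 : vLp 2%:E w.
Proof.
move=> j; have wE x : coordf w j x = v x j 0 by rewrite /coordf /w mxE.
have mw : cmeasurable (coordf w j).
  by rewrite (_ : coordf w j = (fun x => v x j 0)); [exact: vmx_measurable|apply/funext].
apply: cLp2_intro => //; have [m1 m2] := mw.
apply: (@integrable_dom _ (plane R) R mu _ (fun x => K ^+ 2 * (1 + nsq x) `^ (- 1 - eps))).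
- rewrite (_ : (fun x => _) = (fun x => re (coordf w j x) ^+ 2 + im (coordf w j x) ^+ 2)).
    by apply: measurable_funD; exact: measurable_funX.
  by apply/funext => x; rewrite normc_sqr.
- move=> x; rewrite ger0_norm ?sqr_ge0// -jbracket_powR_sqr -exprMn.
  by rewrite ler_pXn2r ?nnegrE ?normc_ge0 ?mulr_ge0 ?powR_ge0// wE.
- by apply: integrable_scale; exact: integrable_japanese.
Qed.

Variable phi : R * R -> 'cV[C]_2.
Hypothesis ker : in_ker_QTQ m U v w phi.
Let f : R * R -> 'cV[C]_2 := mxapply (mxadj v) phi.
Let c0 : C := L2inner w (Top m U v phi) / (L2norm w ^+ 2)%:C.
Let psi : R * R -> 'cV[C]_2 := fun x => c0 *: e1 R - calG0 m f x.

Let orth : L2inner w phi = 0.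
Proof.
have [Lphi [g Lg pg] _] := ker.
exact: Qop_orthogonal w_Lp2 Lg (L2norm_neq0 w_Lp2 w_neq0) Lphi pg.
Qed.

Let wE x : w x = v x *m e1 R.
Proof. by rewrite /w colE. Qed.

(** As [phi] is orthogonal to [w], the equation says that [T phi] is a multiple of
    [w = v e1], namely [c0 w]. Solving for [U phi] gives [v psi], and [U] is an involution. *)
Lemma phi_factor : {ae mu, forall x, phi x = U x *m (v x *m psi x)}.
Proof.
have [_ _] := ker; apply: filterS => x.
have -> : Qop w phi = phi.
  by apply/funext => y; rewrite /Qop /Pop orth mul0r scale0r subr0.
rewrite /Qop /Pop -/c0 => /eqP; rewrite subr_eq0 /Top -/f => /eqP e.
have e' : U x *m phi x = v x *m psi x.
  by rewrite /psi mulmxBr -scalemxAr -wE -e addrK.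
by rewrite -e' mulmxA Umx_sqr mul1mx.
Qed.

(** Combine [phi = U v psi] with the factorization [V = v^* U v]. *)
Let Vpsi : {ae mu, forall x, V x *m psi x = f x}.
Proof.
apply: filterS phi_factor => x e.
by rewrite /f /mxapply /mxadj e (potential_factor V_diag) !mulmxA.
Qed.

Let fE j x : f x j 0 = (v x 0 j)^* * phi x 0 0 + (v x 1 j)^* * phi x 1 0.
Proof. by rewrite /f /mxapply /mxadj mxE sum2E !mxE. Qed.

Let mphi j : cmeasurable (coordf phi j).
Proof. by have [L _ _] := ker; exact: vLp2_measurable. Qed.

Let mf j : cmeasurable (coordf f j).
Proof.
rewrite (_ : coordf f j = (fun x => (v x 0 j)^* * coordf phi 0 x + (v x 1 j)^* * coordf phi 1 x)).
  apply: cmeasurableD; apply: cmeasurableM => //.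
    exact: cmeasurable_conj (vmx_measurable 0 j).
  exact: cmeasurable_conj (vmx_measurable 1 j).
by apply/funext => x; rewrite /coordf fE.
Qed.

(** The factor [v^*] contributes the decay, and [phi] is square integrable. *)
Let tf j : ctame (coordf f j).
Proof.
have [L _ _] := ker; have [m0 I0] := cLp2_integrable (L 0); have [m1 I1] := cLp2_integrable (L 1).
pose g x := abs1 (coordf phi 0 x) + abs1 (coordf phi 1 x).
have mg : measurable_fun [set: plane R] g by apply: measurable_funD; exact: abs1_measurable.
have Ig : integrable (fun x => g x ^+ 2).
  apply: (@integrable_dom _ (plane R) R mu _ _ _ _ (integrable_scale 2 (integrable_addr I0 I1))).
    exact: measurable_funX.
  move=> x; rewrite ger0_norm ?sqr_ge0// /g.
  set a := abs1 _; set b := abs1 (coordf phi 1 x); have := sqr_ge0 (a - b); nra.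
apply: (@ctame_weight R _ g (2 * K) eps) => // y.
rewrite /coordf fE; apply: le_trans (abs1D _ _) _.
have b i : abs1 (v y i j)^* <= 2 * K * jbracket y `^ (- 1 - eps).
  by rewrite abs1_conj (le_trans (abs1_le_normc _))// -mulrA ler_wpM2l.
rewrite (@ger0_norm _ (g y)) ?addr_ge0 ?abs1_ge0// mulrDr.
by apply: lerD; apply: le_trans (abs1M _ _) _; rewrite ler_wpM2r ?abs1_ge0 ?b.
Qed.

(** The total mass of the upper component is the inner product of [w] with [phi]. This
    is what removes the logarithmic growth of the potential of that component. *)
Let f0_int : cint (coordf f 0) = 0.
Proof.
rewrite -orth; congr cint; apply/funext => x; rewrite -/(dot w phi x) /dot dotE.
by rewrite /coordf fE /w !mxE.
Qed.

Local Notation W k j := (weak_partial k (G0s (coordf f j))).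
Opaque weak_partial.

Let wgradE k (u : R * R -> 'cV[C]_2) x j : wgrad k u x j 0 = weak_partial k (coordf u j) x.
Proof. by rewrite mxE. Qed.

Let G0E (u : R * R -> 'cV[C]_2) x j : G0 u x j 0 = G0s (coordf u j) x.
Proof. by rewrite mxE. Qed.

Let coordf_G0 (u : R * R -> 'cV[C]_2) j : coordf (G0 u) j = G0s (coordf u j).
Proof. by apply/funext => x; rewrite /coordf /G0 mxE. Qed.

Let G0s0 x : G0s (fun=> 0 : C) x = 0.
Proof.
rewrite /G0s /cint (_ : (\int[mu]_y _) +i* _ = 0) ?mulr0//.
rewrite (_ : (fun y => complex.Re _) = (fun=> 0)); last by apply/funext => y; rewrite mulr0.
rewrite (_ : (fun y => complex.Im _) = (fun=> 0)); last by apply/funext => y; rewrite mulr0.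
by rewrite /Rintegral integral0.
Qed.

Let I1f0 : coordf (mxapply (fun=> I1 R) f) 0 = coordf f 0.
Proof. by apply/funext => x; rewrite /coordf /mxapply /I1 mxE sum2E !mxE /= mul1r mul0r addr0. Qed.

Let I1f1 : coordf (mxapply (fun=> I1 R) f) 1 = (fun=> 0).
Proof. by apply/funext => x; rewrite /coordf /mxapply /I1 mxE sum2E !mxE /= !mul0r addr0. Qed.

Let psi0E x : psi x 0 0 =
  c0 + 'i * W 0 1 x + W 1 1 x - (2 * m)%:C * G0s (coordf f 0) x.
Proof.
by rewrite -I1f0 -G0E -!coordf_G0 -!wgradE; exact: dirac_0.
Qed.

Let psi1E x : psi x 1 0 = 'i * W 0 0 x - W 1 0 x.
Proof.
apply: etrans (dirac_1 _ _ _ _) _.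
have z : G0 (mxapply (fun=> I1 R) f) x 1 0 = 0.
  by rewrite -[LHS]/(coordf (G0 _) 1 x) coordf_G0 I1f1 G0s0.
by rewrite z mulr0 subr0 -coordf_G0 -!wgradE.
Qed.

Let WP k j : is_weak_partial k (G0s (coordf f j)) (W k j) /\
  {ae mu, forall x, W k j x = cpotential (rk k) (coordf f j) x}.
Proof. exact: weak_partialP (G0s_weak_partial (tf j) k). Qed.

Let W_ae : {ae mu, forall x k j, W k j x = cpotential (rk k) (coordf f j) x}.
Proof.
have h00 := (WP 0 0).2; have h01 := (WP 0 1).2; have h10 := (WP 1 0).2; have h11 := (WP 1 1).2.
apply: filterS2 (filterI h00 h01) (filterI h10 h11) => x [e00 e01] [e10 e11] k i.
by case: (ord2P k) (ord2P i) => -> [] ->.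
Qed.

Let Wloc k j : cloc_integrable (W k j).
Proof. by have [[]] := WP k j. Qed.

Let Gloc j : cloc_integrable (G0s (coordf f j)).
Proof. by have [[]] := WP 0 j. Qed.

Let mpsi j : cmeasurable (coordf psi j).
Proof.
have mW k i : cmeasurable (W k i) := cloc_measurable (Wloc k i).
have mG i : cmeasurable (G0s (coordf f i)) := cloc_measurable (Gloc i).
case: (ord2P j) => ->.
  rewrite (_ : coordf psi 0 = (fun x => (c0 + 'i * W 0 1 x) + W 1 1 x + (- (2 * m)%:C) * G0s (coordf f 0) x)).
    by do ![apply: cmeasurableD => // | apply: cmeasurableM => // | exact: cmeasurable_cst].
  by apply/funext => x; rewrite /coordf psi0E mulNr.
rewrite (_ : coordf psi 1 = (fun x => 'i * W 0 0 x + (- 1) * W 1 0 x)).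
  by do ![apply: cmeasurableD => // | apply: cmeasurableM => // | exact: cmeasurable_cst].
by apply/funext => x; rewrite /coordf psi1E mulN1r.
Qed.

(** The size of the source [f = v^* phi], to which the bootstrap applies. *)
Let F x := abs1 (coordf f 0 x) + abs1 (coordf f 1 x).

Let F0 x : 0 <= F x.
Proof. by rewrite addr_ge0 ?abs1_ge0. Qed.

Let mF : measurable_fun [set: plane R] F.
Proof. by apply: measurable_funD; exact: abs1_measurable. Qed.

(** The truncated Riesz potential of the source; it may be infinite before the bootstrap. *)
Let conv x : \bar R := (\int[mu]_y (kap (psub x y) ^+ 3 * F y)%:E)%E.

Let conv_ge0 x : (0 <= conv x)%E.
Proof. by apply: integral_ge0 => y _; rewrite lee_fin mulr_ge0 ?exprn_ge0 ?kap_ge0. Qed.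

Let grad_le : exists2 A : R, 0 <= A & forall k j x,
  ((abs1 (cpotential (rk k) (coordf f j) x))%:E <= A%:E + A%:E * conv x)%E.
Proof.
pose a : R := `|(2 * pi)^-1|; pose I : R := \int[mu]_y F y.
have I0 : 0 <= I by apply: Rintegral_ge0.
have a0 : 0 <= a by exact: normr_ge0.
exists (a * (I + 1)) => [|k j x]; first by rewrite mulr_ge0// addr_ge0.
have Fj y : abs1 (coordf f j y) <= F y by case: (ord2P j) => ->; rewrite /F ?lerDl ?lerDr abs1_ge0.
apply: le_trans (cpotential_rk_le k x (tf j)) _; rewrite -/a.
have iF i : integrable (fun y => abs1 (coordf f i y)).
  have [t1 t2] := tf i.
  exact: integrable_addr (integrable_norm (tame_integrable t1)) (integrable_norm (tame_integrable t2)).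
have le1 : \int[mu]_y abs1 (coordf f j y) <= I.
  by apply: plane_int_le => //; exact: integrable_addr.
have mk : measurable_fun [set: plane R] (fun y => kap (psub x y) ^+ 3).
  exact: kapX_measurable1.
have le2 : (\int[mu]_y (kap (psub x y) ^+ 3 * abs1 (coordf f j y))%:E <= conv x)%E.
  apply: ge0_le_integral => //.
  - by move=> y _; rewrite lee_fin mulr_ge0 ?exprn_ge0 ?kap_ge0 ?abs1_ge0.
  - by apply/measurable_EFinP; apply: measurable_funM => //; exact: abs1_measurable.
  - by apply/measurable_EFinP; exact: measurable_funM.
  - by move=> y _; rewrite lee_fin ler_wpM2l ?exprn_ge0 ?kap_ge0.
apply: (@le_trans _ _ (a%:E * (I%:E + conv x))%E).
  by rewrite lee_wpmul2l ?lee_fin// leeD// lee_fin.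
rewrite ge0_muleDr ?lee_fin// leeD//.
  by rewrite -EFinM lee_fin ler_wpM2l// lerDl.
by rewrite lee_wpmul2r// lee_fin ler_peMr// lerDr.
Qed.

Let psi_le (x : R * R) (b M : R) : 0 <= b ->
  (forall k j, abs1 (W k j x) <= b) -> abs1 (G0s (coordf f 0) x) <= M ->
  forall j, abs1 (psi x j 0) <= abs1 c0 + (abs1 'i + 1) * b + abs1 (2 * m)%:C * M.
Proof.
move=> b0 Wb GM; have i0 : 0 <= abs1 ('i : C) by exact: abs1_ge0.
have M0 : 0 <= M := le_trans (abs1_ge0 _) GM.
have ib k j : abs1 ('i * W k j x) <= abs1 'i * b.
  by apply: le_trans (abs1M _ _) _; rewrite ler_wpM2l.
have gb : abs1 ((2 * m)%:C * G0s (coordf f 0) x) <= abs1 (2 * m)%:C * M.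
  by apply: le_trans (abs1M _ _) _; rewrite ler_wpM2l ?abs1_ge0.
have s4 (p q r s : C) : abs1 (p + q + r - s) <= abs1 p + abs1 q + abs1 r + abs1 s.
  have h1 := abs1D (p + q + r) (- s); have h2 := abs1D (p + q) r; have h3 := abs1D p q.
  by move: h1; rewrite abs1N; lra.
move=> j; rewrite mulrDl mul1r; case: (ord2P j) => ->.
  rewrite psi0E; apply: le_trans (s4 _ _ _ _) _.
  by have := ib 0 1; have := Wb 1 1; lra.
rewrite psi1E; have h := abs1D ('i * W 0 0 x) (- W 1 0 x); rewrite abs1N in h.
apply: le_trans h _; have := ib 0 0; have := Wb 1 0.
by have := abs1_ge0 c0; have := mulr_ge0 (abs1_ge0 (2 * m)%:C) M0; lra.
Qed.

Let v_bounded x i j : normc (v x i j) <= K.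
Proof.
apply: le_trans (decay x i j) _; rewrite ler_piMr//.
have j1 := jbracket_ge1 x.
rewrite -[leRHS](powRr0 (jbracket x)); apply: ler_powR => //.
by have := eps_gt0; lra.
Qed.

Let VEntry x i j : V x i j =
  (v x 0 i)^* * ((sgn1 (lam 0 x))%:C * v x 0 j) + (v x 1 i)^* * ((sgn1 (lam 1 x))%:C * v x 1 j).
Proof.
have e k : (U x *m v x) k j = (sgn1 (lam k x))%:C * v x k j by exact: diagC_entry.
by rewrite (potential_factor V_diag) mxE sum2E !e !adj_entry.
Qed.

Let V_bounded x i j : abs1 (V x i j) <= 8 * K ^+ 2.
Proof.
have vb k l : abs1 (v x k l) <= 2 * K.
  by apply: le_trans (abs1_le_normc _) _; rewrite ler_wpM2l// v_bounded.
have sg k : abs1 (sgn1 (lam k x))%:C = 1.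
  by rewrite abs1_re /sgn1; case: ifP => _; rewrite ?normrN normr1.
have t k : abs1 ((v x k i)^* * ((sgn1 (lam k x))%:C * v x k j)) <= 4 * K ^+ 2.
  rewrite (_ : 4 * K ^+ 2 = (2 * K) * (2 * K)); last by ring.
  apply: le_trans (abs1M _ _) _; rewrite abs1_conj; apply: ler_pM; rewrite ?abs1_ge0//.
  by apply: le_trans (abs1M _ _) _; rewrite sg mul1r.
have h1 := t 0; have h2 := t 1.
by rewrite VEntry; apply: le_trans (abs1D _ _) _; lra.
Qed.

Let V_measurable i j : cmeasurable (fun x => V x i j).
Proof.
rewrite (_ : (fun x => _) = (fun x => (v x 0 i)^* * ((sgn1 (lam 0 x))%:C * v x 0 j) +
    (v x 1 i)^* * ((sgn1 (lam 1 x))%:C * v x 1 j))); last by apply/funext => x; rewrite VEntry.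
have t k : cmeasurable (fun x => (v x k i)^* * ((sgn1 (lam k x))%:C * v x k j)).
  apply: cmeasurableM; first exact: cmeasurable_conj (vmx_measurable k i).
  apply: cmeasurableM; last exact: vmx_measurable.
  apply: cmeasurable_real; apply: measurable_fun_ifT => //.
  by apply: measurable_fun_ler.
exact: cmeasurableD.
Qed.

Let VpsiE x j : coordf (mxapply V psi) j x = V x j 0 * psi x 0 0 + V x j 1 * psi x 1 0.
Proof. by rewrite /coordf /mxapply mxE sum2E. Qed.

(** The source equals [V psi] with [V] bounded, and [psi] is dominated by a constant plus
    the truncated Riesz potential of the source: the gradient of the potential is controlled by [grad_le], and the
    undifferentiated term by the vanishing total mass. *)
Let F_bootstrap : exists2 A : R, 0 <= A &
  {ae mu, forall y, ((F y)%:E <= A%:E + A%:E * conv y)%E}.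
Proof.
have [D D0 HD] := grad_le; have [M HM] := cpotential_lnk_bounded (tf 0) f0_int.
have M0 : 0 <= M := le_trans (abs1_ge0 _) (HM (0, 0)).
have i1 : 0 <= abs1 ('i : C) + 1 by rewrite addr_ge0 ?abs1_ge0.
pose L := 8 * K ^+ 2; have L0 : 0 <= L by rewrite mulr_ge0 ?sqr_ge0.
pose e := abs1 c0 + abs1 (2 * m)%:C * M.
have e0 : 0 <= e by rewrite addr_ge0 ?abs1_ge0// mulr_ge0 ?abs1_ge0.
pose q := (abs1 'i + 1) * D; have q0 : 0 <= q by rewrite mulr_ge0.
have Le0 : 0 <= 4 * L * (e + q) by apply: mulr_ge0; [exact: mulr_ge0|exact: addr_ge0].
exists (4 * L * (e + q) + 1); first by apply: (addr_ge0 Le0).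
set A := _ + 1.
have A0 : 0 < A by rewrite ltr_wpDl.
apply: filterS2 Vpsi W_ae => y Vy Wy.
(* where the potential is infinite there is nothing to prove, as the constant is positive *)
have [->|] := eqVneq (conv y) +oo%E.
  by rewrite gt0_muley ?lte_fin// addey// leey.
rewrite -ltey => fin; have := conv_ge0 y; have := HD; move/(_ _ _ y).
have : conv y \is a fin_num by rewrite ge0_fin_numE.
move=> /fineK <-; set r := fine _ => HDy; rewrite lee_fin => r0.
have Wb k j : abs1 (W k j y) <= D + D * r.
  by rewrite Wy -lee_fin (le_trans (HDy k j))// -EFinM -EFinD.
have b0 : 0 <= D + D * r by rewrite addr_ge0// mulr_ge0.
have P := psi_le b0 Wb (HM y).
have fb j : abs1 (coordf f j y) <= 2 * L * (e + q + q * r).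
  rewrite /coordf -Vy -[X in abs1 X]/(coordf (mxapply V psi) j y) VpsiE.
  have t k : abs1 (V y j k * psi y k 0) <= L * (e + q + q * r).
    apply: le_trans (abs1M _ _) _; apply: ler_pM; rewrite ?abs1_ge0//.
    apply: le_trans (P k) _; rewrite /e /q.
    rewrite [_ * (D + D * r)]mulrDr mulrA.
    by set a1 := _ * D; set a2 := _ * M; lra.
  apply: le_trans (abs1D _ _) _; have h0 := t 0; have h1 := t 1.
  by rewrite -mulrA; lra.
rewrite -EFinM -EFinD lee_fin /F; have h0 := fb 0; have h1 := fb 1.
have er := mulr_ge0 e0 r0; have Ler := mulr_ge0 L0 er.
rewrite /A; apply: le_trans (lerD h0 h1) _; nra.
Qed.

Let F2 : integrable (fun y => F y ^+ 2).
Proof.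
have T2 i : integrable (fun y => abs1 (coordf f i y) ^+ 2).
  have [[m1 _ I1] [m2 _ I2]] := tf i.
  apply: (@integrable_dom _ (plane R) R mu _ _ _ _ (integrable_scale 2 (integrable_addr I1 I2))).
    by apply: measurable_funX; exact: abs1_measurable.
  move=> x; rewrite ger0_norm ?sqr_ge0// /abs1.
  rewrite -[X in _ <= 2 * (X + _)]real_normK ?num_real// -[X in _ <= 2 * (_ + X)]real_normK ?num_real//.
  set a := `|re _|; set b := `|im _|; have := sqr_ge0 (a - b); nra.
apply: (@integrable_dom _ (plane R) R mu _ _ _ _ (integrable_scale 2 (integrable_addr (T2 0) (T2 1)))).
  exact: measurable_funX.
move=> x; rewrite ger0_norm ?sqr_ge0// /F.
by set a := abs1 _; set b := abs1 (coordf f 1 x); have := sqr_ge0 (a - b); nra.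
Qed.

(** The bootstrap bounds the truncated Riesz potential everywhere, hence the gradient. *)
Let psi_bounded : exists M : R, forall j, {ae mu, forall x, abs1 (coordf psi j x) <= M}.
Proof.
have [A A0 HA] := F_bootstrap; have [c Hc] := riesz_bootstrap mF F0 F2 A0 HA.
have [D D0 HD] := grad_le; have [M HM] := cpotential_lnk_bounded (tf 0) f0_int.
pose b := D + D * `|c|; have b0 : 0 <= b by rewrite addr_ge0// mulr_ge0.
exists (abs1 c0 + (abs1 'i + 1) * b + abs1 (2 * m)%:C * M) => j.
apply: filterS W_ae => x Wx; apply: psi_le => // k i; rewrite Wx -lee_fin.
apply: le_trans (HD k i x) _; rewrite /b EFinD EFinM leeD// lee_wpmul2l// ?lee_fin//.
by apply: le_trans (Hc x) _; rewrite lee_fin ler_norm.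
Qed.

Lemma psi_Linfty : vLp +oo%E psi.
Proof. by move=> j; have [M HM] := psi_bounded; exact: cLp_infty (HM j). Qed.

(** Almost everywhere [V psi] is the integrable source, so it may be replaced by it. *)
Let VpsiLoc j : cloc_integrable (coordf (mxapply V psi) j) /\
  forall h, measurable_fun [set: plane R] h ->
    cpair (coordf (mxapply V psi) j) h = cpair (coordf f j) h.
Proof.
have mV : cmeasurable (coordf (mxapply V psi) j).
  rewrite (_ : coordf _ j = (fun x => V x j 0 * coordf psi 0 x + V x j 1 * coordf psi 1 x)).
    by apply: cmeasurableD; apply: cmeasurableM.
  by apply/funext => x; rewrite VpsiE.
have e : {ae mu, forall x, coordf (mxapply V psi) j x = coordf f j x}.
  by apply: filterS Vpsi => x; rewrite /coordf /mxapply => ->.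
split; last by move=> h mh; exact: cpair_ae.
have [m1 m2] := mV; have [t1 t2] := tf j.
have H (g g' : R * R -> R) : measurable_fun [set: plane R] g -> tame g' ->
    {ae mu, forall x, g x = g' x} -> box_integrable g.
  move=> mg tg gg' M.
  have Ig : integrable g.
    by apply: (ae_eq_integrable mg _ (tame_integrable tg)); apply: filterS gg' => x ->.
  apply: (@integrable_mulb _ (plane R) R mu _ _ 1 Ig).
    exact: measurable_indic (box_measurable M).
  by move=> x; rewrite indicE; case: (_ \in _); rewrite ?normr1 ?normr0.
by apply/cloc_integrableP; split; [apply: H m1 t1 _|apply: H m2 t2 _]; apply: filterS e => x ->.
Qed.

Section Equation.
Variables (chi : R * R -> R) (tchi : test_function chi).

Let mdchi k : measurable_fun [set: plane R] (dpartial k chi).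
Proof. exact: plane_continuous_measurable (dpartial_continuous (k := k) tchi). Qed.

Let mchi : measurable_fun [set: plane R] chi.
Proof. exact: plane_continuous_measurable (test_continuous tchi). Qed.

Let pW k j : pairable (W k j) chi := (cloc_pairable (Wloc k j) tchi).1.
Let pdW k j l : pairable (W k j) (dpartial l chi) := (cloc_pairable (Wloc k j) tchi).2 l.
Let pdG l : pairable (G0s (coordf f 0)) (dpartial l chi) := (cloc_pairable (Gloc 0) tchi).2 l.

Let W_pair k l j :
  cpair (W k j) (dpartial l chi) = cpair (cpotential (rk k) (coordf f j)) (dpartial l chi).
Proof.
apply: cpair_ae (WP k j).2 => //; first exact: cloc_measurable.
by apply: cloc_measurable; exact: (cpotential_cloc (@mild_rk R k) (tf j)).
Qed.

Let W_curl j : cpair (W 0 j) (dpartial 1 chi) = cpair (W 1 j) (dpartial 0 chi).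
Proof. exact: (etrans (W_pair 0 1 j) (etrans (cpotential_curl (tf j) tchi) (esym (W_pair 1 0 j)))). Qed.

Let W_div j : cpair (W 0 j) (dpartial 0 chi) + cpair (W 1 j) (dpartial 1 chi) = cpair (coordf f j) chi.
Proof.
exact: (etrans (congr2 +%R (W_pair 0 0 j) (W_pair 1 1 j)) (cpotential_laplacian (tf j) tchi)).
Qed.

Let W_grad k : cpair (G0s (coordf f 0)) (dpartial k chi) = - cpair (W k 0) chi.
Proof. by have [[_ _ H] _] := WP k 0; exact: H. Qed.

(** Integration by parts with a constant. *)
Let cst_pair (a : C) k : pairable (fun=> a) (dpartial k chi) /\ cpair (fun=> a) (dpartial k chi) = 0.
Proof.
have [M [D [_ d0 _ dD]]] := test_bounds tchi.
have I : integrable (dpartial k chi).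
  exact: (bounded_box_integrable (mdchi k) (dD k) (d0 k)).
have z : \int[mu]_x dpartial k chi x = 0.
  have I0 : integrable (fun x => cst 0 x * chi x : R).
    rewrite (_ : (fun x => _) = (fun=> 0)); last by apply/funext => x; rewrite mul0r.
    exact: integrable0.
  have I1 : integrable (fun x => cst 1 x * dpartial k chi x : R).
    by rewrite (_ : (fun x => _) = dpartial k chi)//; apply/funext => x; rewrite mul1r.
  have := @plane_ibp R k (cst 1) (cst 0) chi (0, 0) tchi I1 I0.
  under eq_Rintegral do rewrite mul1r.
  under [X in _ = - X]eq_Rintegral do rewrite mul0r.
  rewrite {2}/Rintegral integral0 oppr0; apply => x _; split.
    by move=> s; exact: is_derive_cst.
  by move=> s; exact: cvg_cst.
split; first by split; exact: integrable_scale.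
rewrite cpairE (plane_int_scale _ I) (plane_int_scale _ I) z !mulr0.
by [].
Qed.

Let psi0_pair k : cpair (coordf psi 0) (dpartial k chi) =
  'i * cpair (W 0 1) (dpartial k chi) + cpair (W 1 1) (dpartial k chi) +
  (2 * m)%:C * cpair (W k 0) chi.
Proof.
have [pc zc] := cst_pair c0 k.
rewrite (_ : coordf psi 0 = (fun x => ((c0 + 'i * W 0 1 x) + W 1 1 x) + (- (2 * m)%:C) * G0s (coordf f 0) x)); last first.
  by apply/funext => x; rewrite /coordf psi0E mulNr.
have p1 := pairable_scale 'i%R (pdW 0 1 k); have p2 := pairable_scale (- (2 * m)%:C) (pdG k).
rewrite (cpair_add (pairable_add (pairable_add pc p1) (pdW 1 1 k)) p2).
rewrite (cpair_add (pairable_add pc p1) (pdW 1 1 k)) (cpair_add pc p1).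
by rewrite (cpair_scale 'i%R (pdW 0 1 k)) (cpair_scale _ (pdG k)) zc add0r W_grad mulrNN.
Qed.

Let psi1_pair h : pairable (W 0 0) h -> pairable (W 1 0) h -> cpair (coordf psi 1) h =
  'i * cpair (W 0 0) h - cpair (W 1 0) h.
Proof.
move=> p0 p1; rewrite (_ : coordf psi 1 = (fun x => 'i * W 0 0 x + (- 1) * W 1 0 x)); last first.
  by apply/funext => x; rewrite /coordf psi1E mulN1r.
rewrite (cpair_add (pairable_scale 'i%R p0) (pairable_scale (- 1) p1)).
by apply: etrans (congr2 +%R (cpair_scale 'i%R p0) (cpair_scale (- 1) p1)) _; rewrite mulN1r.
Qed.

(** The algebra of the upper component: the curl terms cancel and the divergence of the
    gradient is the source. *)
Let component0 (x y q p0 p1 a00 a01 a10 a11 : C) : x = - p0 -> y = - p1 ->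
  q = a00 + a11 -> p0 = 'i * a00 - a10 -> p1 = 'i * a01 - a11 -> a01 = a10 ->
  - 'i * x - y + q = 0.
Proof.
have sqr_i : ('i : C) * 'i = - 1 by rewrite -expr2 sqrCi.
by move=> -> -> -> -> -> ->; ring: sqr_i.
Qed.

(** The algebra of the lower component, where moreover the mass terms cancel against the
    derivative of the undifferentiated potential in [psi]. *)
Let component1 (x y p q p0 p1 a0 a1 e e' w0 w1 c d : C) : x = - p0 -> y = - p1 ->
  q = a0 + a1 -> p0 = 'i * a0 + e' + d * w0 -> p1 = 'i * e + a1 + d * w1 -> e = e' ->
  p = 'i * w0 - w1 -> d = 2 * c -> - 'i * x + y - 2 * c * p + q = 0.
Proof.
have sqr_i : ('i : C) * 'i = - 1 by rewrite -expr2 sqrCi.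
by move=> -> -> -> -> -> -> -> ->; ring: sqr_i.
Qed.

(** Formally, [D_m - m] applied to the potential gives back the source: the square of the
    massless operator is minus the Laplacian, and the correction [2 m I1] accounts for
    the mass. The constant [c0 e1] lies in the kernel of [D_m - m]. *)
Lemma threshold_equation : pairing_H m V psi chi - m%:C *: pairing psi chi = 0.
Proof.
have pE (u : R * R -> 'cV[C]_2) h j : pairing u h j 0 = cpair (coordf u j) h by rewrite mxE.
have dE k j : pairing_partial k psi chi j 0 = - cpair (coordf psi j) (dpartial k chi).
  by rewrite /pairing_partial col_opp pE.
have QE j : pairing (mxapply V psi) chi j 0 =
    cpair (W 0 j) (dpartial 0 chi) + cpair (W 1 j) (dpartial 1 chi).
  by rewrite W_div pE; exact: (VpsiLoc j).2.
have m2 : (2 * m)%:C = 2 * m%:C :> C.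
  by rewrite rmorphM rmorph_nat.
apply/colP => j; rewrite [RHS]mxE; case: (ord2P j) => ->.
  apply: etrans (dirac_pairing_0 _ _ _ _) _.
  exact: (component0 (dE 0 1) (dE 1 1) (QE 0) (psi1_pair (pdW 0 0 0) (pdW 1 0 0))
    (psi1_pair (pdW 0 0 1) (pdW 1 0 1)) (W_curl 0)).
apply: etrans (dirac_pairing_1 _ _ _ _) _.
exact: (component1 (dE 0 0) (dE 1 0) (QE 1) (psi0_pair 0) (psi0_pair 1) (W_curl 1)
  (etrans (pE _ _ _) (psi1_pair (pW 0 0) (pW 1 0))) m2).
Qed.

End Equation.

Lemma psi_threshold : threshold_solution m V psi.
Proof.
split; last exact: threshold_equation.
  by move=> j; have [M HM] := psi_bounded; exact: cbounded_cloc (mpsi j) (HM j).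
by move=> j; exact: (VpsiLoc j).1.
Qed.

End Threshold.

Unset Implicit Arguments.
Local Open Scope complex_scope.
Local Open Scope sesquilinear_scope.

Theorem lemma7p2 (R : realType) (m : R) (m_gt0 : 0 < m)
    (V B : R * R -> 'M[R[i]]_2) (lam : 'I_2 -> R * R -> R)
    (V_selfadjoint : forall x, (V x)^t* = V x)
    (B_unitary : forall x, B x \is unitarymx)
    (B_measurable : forall i j, cmeasurable (fun x => B x i j))
    (lam_measurable : forall j, measurable_fun [set: plane R] (lam j))
    (V_diag : forall x, V x = (B x)^t* *m diagC (fun j => lam j x) *m B x) :
  let U := Umx lam in
  let v := vmx lam B in
  let ac : R * R -> 'cV[R[i]]_2 := fun x => col 0 (v x) in
  ~ {ae leb2 R, forall x, ac x = 0} ->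
  (exists2 eps : R, 0 < eps & exists K : R, forall x i j,
    ComplexField.Normc.normc (v x i j) <= K * jbracket x `^ (- 1 - eps)) ->
  forall phi : R * R -> 'cV[R[i]]_2, in_ker_QTQ m U v ac phi ->
  let c0 : R[i] := L2inner ac (Top m U v phi) / (L2norm ac ^+ 2)%:C in
  let psi : R * R -> 'cV[R[i]]_2 :=
    fun x => c0 *: e1 R - calG0 m (mxapply (mxadj v) phi) x in
  [/\ {ae leb2 R, forall x, phi x = U x *m (v x *m psi x)},
      vLp +oo%E psi &
      threshold_solution m V psi].
Proof.
move=> U v ac ac_neq0 [eps eps_gt0 [K decay]] phi ker c0 psi; split.
- exact: (phi_factor B_measurable lam_measurable ac_neq0 eps_gt0 decay ker).
- exact: (psi_Linfty B_measurable lam_measurable V_diag ac_neq0 eps_gt0 decay ker).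
- exact: (psi_threshold B_measurable lam_measurable V_diag ac_neq0 eps_gt0 decay ker).
Qed.
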